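(* Let $P\subset\mathbb{R}^n$ be a polytope with $0\in\operatorname{int}P$ whose centroid is the origin. Then the cone-volume measure of $P$ satisfies the subspace concentration condition. That is, if $F_1,\dots,F_m$ are the facets of $P$, $a_i\in S^{n-1}$ is the outer unit normal of $F_i$, and $C_i=\operatorname{conv}(\{0\}\cup F_i)$ for $1\le i\le m$, then for every linear subspace $L\subseteq\mathbb{R}^n$ $$\sum_{i:\,a_i\in L}\mathrm{V}(C_i)\;\le\;\frac{\dim L}{n}\,\mathrm{V}(P),$$ and equality holds for a subspace $L$ if and only if there exists a linear subspace $\overline{L}\subseteq\mathbb{R}^n$ complementary to $L$ such that $\{a_j : a_j\notin L\}\subset\overline{L}$, i.e. $A=(A\cap L)\cup(A\cap\overline{L})$, where $A=\{a_1,\dots,a_m\}$.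
   Context: $\mathrm{V}$ denotes $n$-dimensional Lebesgue measure. The centroid of a set $S\subset\mathbb{R}^n$ with $\mathrm{V}(S)>0$ is $\frac{1}{\mathrm{V}(S)}\int_S x\,\mathrm{d}x$. Facets are the $(n-1)$-dimensional faces. Two linear subspaces $L,\overline{L}$ of $\mathbb{R}^n$ are complementary if $L\oplus\overline{L}=\mathbb{R}^n$. The cone-volume measure of such a polytope $P$ is the Borel measure $\mathrm{V}_P=\sum_{i=1}^m\mathrm{V}(C_i)\,\delta_{a_i}$ on $S^{n-1}$. A finite Borel measure $\mu$ on $S^{n-1}$ satisfies the subspace concentration condition if for every linear subspace $L\subseteq\mathbb{R}^n$ one has $\mu(L\cap S^{n-1})\le\frac{\dim L}{n}\mu(S^{n-1})$, with equality for a subspace $L$ if and only if there is a subspace $\overline{L}$ complementary to $L$ with $\mu(\overline{L}\cap S^{n-1})=\frac{\dim\overline{L}}{n}\mu(S^{n-1})$, i.e. $\mu$ is concentrated on $S^{n-1}\cap(L\cup\overline{L})$. The claim spells this out for $\mu=\mathrm{V}_P$. *)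

(* Defs.v *)
From HB Require Import structures.
From mathcomp Require Import all_boot all_order all_algebra.
From mathcomp Require Import all_classical all_reals all_analysis.

Set Implicit Arguments.
Unset Strict Implicit.
Unset Printing Implicit Defensive.

Import Order.TTheory GRing.Theory Num.Theory.
Import numFieldNormedType.Exports.

Local Open Scope classical_set_scope.
Local Open Scope ring_scope.

(* Borel sigma-algebra of R^n = 'rV[R]_n, generated by the coordinates as in
   the library's instance for n.-tuple T. *)

Definition rV_display : measure_display.
Proof. exact: default_measure_display. Qed.

Section measurable_rV.
Context {R : realType} {n : nat}.

Definition rV_coord (i : 'I_n) (v : 'rV[R]_n) : measurableTypeR R := v ord0 i.

Let rV_set0 : g_sigma_preimage rV_coord set0.
Proof. exact: sigma_algebra0. Qed.

Let rV_setC A : g_sigma_preimage rV_coord A -> g_sigma_preimage rV_coord (~` A).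
Proof. exact: sigma_algebraC. Qed.

Let rV_bigcup (F : (set 'rV[R]_n)^nat) :
  (forall i, g_sigma_preimage rV_coord (F i)) ->
  g_sigma_preimage rV_coord (\bigcup_i (F i)).
Proof. exact: sigma_algebra_bigcup. Qed.

HB.instance Definition _ := @isMeasurable.Build rV_display
  'rV[R]_n (g_sigma_preimage rV_coord) rV_set0 rV_setC rV_bigcup.

Lemma measurable_rV_coord (i : 'I_n) : measurable_fun [set: 'rV[R]_n] (rV_coord i).
Proof.
move=> _ Y mY; rewrite setTI; apply: sub_sigma_algebra => /=.
rewrite -bigcup_seq/=; exists i => /=; first by rewrite mem_index_enum.
by exists Y => //; rewrite setTI.
Qed.

Lemma measurable_fun_rVP d (T : measurableType d) (f : T -> 'rV[R]_n) :
  (forall i, measurable_fun [set: T] (rV_coord i \o f)) ->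
  measurable_fun [set: T] f.
Proof.
move=> mf _ A mA; rewrite setTI.
have : g_sigma_preimage (fun i => rV_coord i \o f) (f @^-1` A).
  by rewrite g_sigma_preimage_comp; exists A => //; rewrite setTI.
apply: smallest_sub; first exact: sigma_algebra_measurable.
rewrite -bigcup_seq => B [i _ [C mC <-]].
exact: mf.
Qed.

End measurable_rV.

(* n-dimensional Lebesgue measure: the n-fold product of the Lebesgue measure
   on R; the identification of R * R^n with R^(n+1) is [rV_cons]. *)

Section lebesgue_rV.
Context {R : realType}.

Definition rV_cons n (p : measurableTypeR R * 'rV[R]_n) : 'rV[R]_n.+1 :=
  row_mx p.1%:M p.2.


Lemma rV_cons0 n (p : measurableTypeR R * 'rV[R]_n) :
  rV_cons p ord0 ord0 = p.1.
Proof.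
rewrite /rV_cons mxE; case: splitP => [j _|//].
by rewrite !ord1 mxE eqxx mulr1n.
Qed.

Lemma rV_consS n (p : measurableTypeR R * 'rV[R]_n) (i : 'I_n) :
  rV_cons p ord0 (lift ord0 i) = p.2 ord0 i.
Proof.
rewrite /rV_cons mxE; case: splitP => [j|k]; first by rewrite ord1.
by rewrite lift0 add1n => -[ik]; congr (_ ord0 _); exact/esym/val_inj.
Qed.

Lemma measurable_rV_cons n : measurable_fun setT (@rV_cons n).
Proof.
apply: measurable_fun_rVP => i.
case: (unliftP ord0 i) => [j ->|->].
  rewrite (_ : _ \o _ = rV_coord j \o snd).
    by apply: measurableT_comp => //; exact: measurable_rV_coord.
  by apply/funext => p /=; rewrite /rV_coord rV_consS.
rewrite (_ : _ \o _ = fst) //.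
by apply/funext => p /=; rewrite /rV_coord rV_cons0.
Qed.

Definition rV_uncons n (v : 'rV[R]_n.+1) : measurableTypeR R * 'rV[R]_n :=
  (v ord0 ord0, \row_i v ord0 (lift ord0 i)).

Lemma rV_consK n : cancel (@rV_cons n) (@rV_uncons n).
Proof.
move=> p; rewrite /rV_uncons rV_cons0 [RHS]surjective_pairing; congr pair.
by apply/rowP => i; rewrite mxE rV_consS.
Qed.

Lemma measurable_rV_uncons n : measurable_fun setT (@rV_uncons n).
Proof.
apply/measurable_fun_pairP; split; first exact: measurable_rV_coord.
apply: measurable_fun_rVP => i.
rewrite (_ : _ \o _ = rV_coord (lift ord0 i)); first exact: measurable_rV_coord.
by apply/funext => v /=; rewrite /rV_coord mxE.
Qed.

Section step.
Local Open Scope ereal_scope.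
Variables (n : nat) (mu : {sigma_finite_measure set 'rV[R]_n -> \bar R}).

Definition lebesgue_rV_step : set 'rV[R]_n.+1 -> \bar R :=
  pushforward (@lebesgue_measure R \x mu) (@rV_cons n).

Let step0 : lebesgue_rV_step set0 = 0.
Proof. by rewrite /lebesgue_rV_step /pushforward preimage_set0 measure0. Qed.

Let step_ge0 A : 0 <= lebesgue_rV_step A.
Proof. by rewrite /lebesgue_rV_step /pushforward; exact: measure_ge0. Qed.

Let step_sigma_additive : semi_sigma_additive lebesgue_rV_step.
Proof.
move=> F mF tF mUF; rewrite /lebesgue_rV_step /pushforward preimage_bigcup.
have mc A : measurable A -> measurable (@rV_cons n @^-1` A).
  by move=> mA; rewrite -[X in measurable X]setTI; exact: measurable_rV_cons.
apply: measure_semi_sigma_additive.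
- by move=> k; exact: mc.
- apply/trivIsetP => /= i j _ _ ij; rewrite -preimage_setI.
  by move/trivIsetP : tF => /(_ _ _ _ _ ij) ->//; rewrite preimage_set0.
- by rewrite -preimage_bigcup; exact: mc.
Qed.

HB.instance Definition _ := isMeasure.Build _ _ _ lebesgue_rV_step
  step0 step_ge0 step_sigma_additive.

Let step_sigma_finite : sigma_finite setT lebesgue_rV_step.
Proof.
have /sigma_finiteP[F [TF ndF Foo]] := sigma_finiteT (@lebesgue_measure R).
have /sigma_finiteP[G [TG ndG Goo]] := sigma_finiteT mu.
exists (fun k => @rV_uncons n @^-1` (F k `*` G k)).
  rewrite -preimage_bigcup (_ : \bigcup_k _ = setT) ?preimage_setT//.
  apply/seteqP; split => // -[x y] _.
  have [i _ Fx] : (\bigcup_k F k) x by rewrite -TF.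
  have [j _ Gy] : (\bigcup_k G k) y by rewrite -TG.
  exists (maxn i j) => //; split => /=.
    by move: x Fx; exact/subsetPset/ndF/leq_maxl.
  by move: y Gy; exact/subsetPset/ndG/leq_maxr.
move=> k; have [mF Fk] := Foo k; have [mG Gk] := Goo k; split.
  rewrite -[X in measurable X]setTI; apply: measurable_rV_uncons => //.
  exact: measurableX.
rewrite /lebesgue_rV_step /pushforward -comp_preimage.
rewrite (_ : @rV_uncons n \o @rV_cons n = id); last exact/funext/rV_consK.
by rewrite preimage_id product_measure1E// lte_mul_pinfty// ge0_fin_numE.
Qed.

HB.instance Definition _ := Measure_isSigmaFinite.Build _ _ _ lebesgue_rV_step
  step_sigma_finite.

End step.

Fixpoint lebesgue_rV n : {sigma_finite_measure set 'rV[R]_n -> \bar R} :=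
  if n is n'.+1 then lebesgue_rV_step (lebesgue_rV n')
  else dirac (0 : 'rV[R]_0).

Lemma lebesgue_rV_box n (A : 'I_n -> set (measurableTypeR R)) :
  (forall i, measurable (A i)) ->
  lebesgue_rV n [set v | forall i, A i (v ord0 i)] =
  (\prod_(i < n) lebesgue_measure (A i))%E.
Proof.
elim: n A => [|n IH] A mA /=.
  by rewrite big_ord0 diracE mem_set// => -[].
have mB : measurable [set v : 'rV[R]_n | forall i, A (lift ord0 i) (v ord0 i)].
  rewrite [X in measurable X](_ : _ = \bigcap_(i in [set: 'I_n])
    (@rV_coord R n i @^-1` A (lift ord0 i))).
    apply: fin_bigcap_measurable => // i _.
    by rewrite -[X in measurable X]setTI; exact: measurable_rV_coord.
  by apply/seteqP; split => v /= h i; [move=> _|]; exact: h.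
rewrite /lebesgue_rV_step /pushforward big_ord_recl -IH//.
rewrite -product_measure1E//.
congr (_ _); apply/seteqP; split => p /=.
  by move=> h; split => [|i /=]; [rewrite -rV_cons0|rewrite -rV_consS].
move=> [h0 h] i; case: (unliftP ord0 i) => [j ->|->].
  by rewrite rV_consS.
by rewrite rV_cons0.
Qed.

End lebesgue_rV.

Section convex_geometry.
Context {R : realType} {n : nat}.
Local Notation V := (lebesgue_rV n).
Implicit Types (S P F A : set 'rV[R]_n) (u v x y : 'rV[R]_n)
  (L : {vspace 'rV[R]_n}).

Definition dotv u v : R := \sum_i u ord0 i * v ord0 i.

Definition enorm u : R := Num.sqrt (dotv u u).

Definition sphere : set 'rV[R]_n := [set u | enorm u = 1].

Definition conv_hull S : set 'rV[R]_n :=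
  smallest (@convex_set R 'rV[R]_n) S.

Definition polytope P := exists2 S, finite_set S & P = conv_hull S.

Definition centroid S : 'rV[R]_n :=
  \row_i ((fine (V S))^-1 * \int[V]_(x in S) x ord0 i).

Definition affine_set A :=
  forall x y (t : R), A x -> A y -> A (t *: x + (1 - t) *: y).

Definition affine_hull S : set 'rV[R]_n := smallest affine_set S.

Definition has_dim S (k : nat) :=
  exists x L, affine_hull S = [set x + u | u in [set` L]] /\ \dim L = k.

Definition face P F :=
  exists u (h : R), P `<=` [set x | dotv u x <= h] /\
                    F = P `&` [set x | dotv u x = h].

(* k.+1 = n rather than k = n.-1: truncated subtraction would make {0} a facet
   of itself in R^0. *)
Definition facets P : set (set 'rV[R]_n) :=
  [set F | face P F /\ exists2 k, k.+1 = n & has_dim F k].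

Definition outer_unit_normal P F u :=
  sphere u /\ exists h : R, P `<=` [set x | dotv u x <= h] /\
                            F `<=` [set x | dotv u x = h].

Definition facet_cone F : set 'rV[R]_n := conv_hull (0 |` F).

Definition complementary L L' := (L :&: L' = 0)%VS /\ (L + L' = fullv)%VS.

End convex_geometry.

Section cone_volume.
Local Open Scope ereal_scope.
Context {R : realType} {n m : nat}.
Variables (F : 'I_m -> set 'rV[R]_n) (a : 'I_m -> 'rV[R]_n).

Definition cone_volume_measure : set 'rV[R]_n -> \bar R :=
  fun A => \sum_(i < m) lebesgue_rV n (facet_cone (F i)) * \d_(a i) A.

Let cvm0 : cone_volume_measure set0 = 0.
Proof. by apply: big1 => i _; rewrite measure0 mule0. Qed.

Let cvm_ge0 A : 0 <= cone_volume_measure A.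
Proof. by apply: sume_ge0 => i _; exact: mule_ge0. Qed.

Let weighted_dirac_bigcup (c : \bar R) (x : 'rV[R]_n) (A : (set 'rV[R]_n)^nat) :
  0 <= c -> trivIset setT A ->
  \sum_(k <oo) c * \d_x (A k) = c * \d_x (\bigcup_k A k).
Proof.
move=> c0 tA; rewrite [in RHS]diracE.
have [[k _ Akx]|nAx] := pselect ((\bigcup_k A k) x); last first.
  rewrite memNset// mule0 eseries0// => k _ _.
  by rewrite diracE memNset ?mule0// => Akx; apply: nAx; exists k.
rewrite (mem_set (_ : (\bigcup_k A k) x)); last by exists k.
rewrite (@nneseriesD1 _ _ k)//; last by move=> *; exact: mule_ge0.
rewrite diracE mem_set// eseries0 ?adde0// => j _ jk.
rewrite diracE memNset ?mule0// => Ajx.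
move/trivIsetP : tA => /(_ j k I I jk) /seteqP[+ _] => /(_ x); exact.
Qed.

Let cvm_sigma_additive : semi_sigma_additive cone_volume_measure.
Proof.
move=> A mA tA mUA; rewrite /cone_volume_measure.
under eq_bigr do rewrite -weighted_dirac_bigcup//.
rewrite -nneseries_sum; last by move=> *; exact: mule_ge0.
apply: is_cvg_nneseries => k _ _.
exact: cvm_ge0.
Qed.

HB.instance Definition _ := isMeasure.Build _ _ _ cone_volume_measure
  cvm0 cvm_ge0 cvm_sigma_additive.

End cone_volume.

(* A finite Borel measure on the sphere is represented by a measure on R^n for
   which the complement of the sphere is null.  In the equality clause, having
   equality for some complementary L' is required together with the
   concentration on the union of L and L': without the latter the "if" part
   fails for the cone-volume measure of a square. *)
Definition subspace_concentration (R : realType) (n : nat)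
    (mu : {measure set 'rV[R]_n -> \bar R}) :=
  [/\ (mu setT < +oo)%E,
      mu (~` sphere) = 0%E &
      forall L : {vspace 'rV[R]_n},
        (mu ([set` L] `&` sphere) <= ((\dim L)%:R / n%:R)%:E * mu sphere)%E /\
        ((mu ([set` L] `&` sphere) = ((\dim L)%:R / n%:R)%:E * mu sphere)%E <->
         exists L' : {vspace 'rV[R]_n},
           [/\ complementary L L',
               (mu ([set` L'] `&` sphere) =
                ((\dim L')%:R / n%:R)%:E * mu sphere)%E &
               mu (sphere `\` ([set` L] `|` [set` L'])) = 0%E])].

(* Main.v *)
(* Split R^n as L^perp + L and let f(y) be the volume of the fibre of P over y in L.  By the
   Brunn-Minkowski inequality f is log-concave, so f(y) <= f(0) exp <p, y> for some p.  Moving the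
   facets with normals in L towards the origin by the factor 1 - l removes from P a set of volume
   (1 - (1 - l)^n) times the sum of the cone volumes of these facets, while log-concavity bounds
   what is left from below by (1 - l)^k times the integral of f^(1 - l) f(0)^l over L, k = dim L.
   To first order in l this is the inequality: the term <p, y> integrates to 0 because the centroid
   of P is 0, and the remainder is the integral of f (log f(0) + <p, y> - log f) >= 0.

   If equality holds, this remainder vanishes, f is log-affine and then, by a scaling argument,
   constant, so Brunn-Minkowski is an equality between fibres.  Applied to the parts of the fibres
   cut off by parallel hyperplanes, it shows that the fibres are translates of one another as far as
   their centroids and supporting half-spaces are concerned.  A facet whose normal a is not in L
   then forces the L-component of a to be the image of its L^perp-component under one linear map,
   the same for all such facets.  The graph of this map is the complement of L. *)
Require Import Defs.
From HB Require Import structures.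
From mathcomp Require Import all_boot all_order all_algebra.
From mathcomp Require Import all_classical all_reals all_analysis.
From mathcomp Require Import measurable_realfun ring lra.

Set Implicit Arguments.
Unset Strict Implicit.
Unset Printing Implicit Defensive.

Import Order.TTheory GRing.Theory Num.Theory.
Import numFieldNormedType.Exports.

Local Open Scope classical_set_scope.
Local Open Scope ring_scope.

(** * Measurability in R^n *)

Section measurability.
Context {R : realType}.

(** The expansion in l takes no limit under an integral: [expR x >= 1 + x] and elementary bounds on
    [(1 - l) ^+ j] give, for each small l, an inequality with an explicit quadratic error. Lebesgue
    measure is split as a product only up to an undetermined factor [c > 0]; the estimates are
    homogeneous in it, so no determinant is computed.

    In the equality case a vanishing integral controls f only almost everywhere, and boundary fibres
    may be degenerate. The argument therefore stays over base points pulled strictly towards 0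
    ([inner]), where concavity removes the exceptional null set. Equality in Brunn-Minkowski is not
    resolved into homothety of the fibres: for each linear functional b the quantile functions of b
    on two fibres and on their midpoint fibre are compared. They differ by constants, which is
    enough for centroids and supports. Centroids are needed because the displacement found for b
    depends on b a priori, whereas the displacement of the centroid is one vector that serves all b
    and makes the dependence on b linear. *)

Lemma measurable_fun_rVD d (T : measurableType d) n (f g : T -> 'rV[R]_n) :
  measurable_fun setT f -> measurable_fun setT g ->
  measurable_fun setT (fun x => f x + g x).
Proof.
move=> mf mg; apply: measurable_fun_rVP => i.
rewrite (_ : _ \o _ = (rV_coord i \o f) \+ (rV_coord i \o g)); last first.
  by apply/funext => x; rewrite /= /rV_coord mxE.
by apply: measurable_funD; apply: measurableT_comp => //; exact: measurable_rV_coord.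
Qed.

Lemma measurable_fun_mulmx d (T : measurableType d) r n (f : T -> 'rV[R]_r)
  (B : 'M[R]_(r, n)) :
  measurable_fun setT f -> measurable_fun setT (fun x => f x *m B).
Proof.
move=> mf; apply: measurable_fun_rVP => i.
rewrite (_ : _ \o _ = fun x => \sum_(j < r) (rV_coord j \o f) x * B j i); last first.
  by apply/funext => x; rewrite /= /rV_coord mxE.
apply: measurable_sum => j; apply: measurable_funM => //.
by apply: measurableT_comp => //; exact: measurable_rV_coord.
Qed.

Lemma measurable_fun_rVZ d (T : measurableType d) n (f : T -> 'rV[R]_n) (c : R) :
  measurable_fun setT f -> measurable_fun setT (fun x => c *: f x).
Proof.
move=> mf; rewrite (_ : (fun x => _) = (fun x => f x *m c%:M)).
  exact: measurable_fun_mulmx.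
by apply/funext => x; rewrite mul_mx_scalar.
Qed.

Lemma measurable_dotv n (u : 'rV[R]_n) :
  measurable_fun [set: 'rV[R]_n] (dotv u : 'rV[R]_n -> measurableTypeR R).
Proof.
rewrite (_ : dotv u = fun x => \sum_(j < n) (u ord0 j * rV_coord j x))//.
apply: measurable_sum => j; apply: measurable_funM => //.
exact: measurable_rV_coord.
Qed.

(** The sigma-algebra comes from the coordinates and the topology from the max norm; they meet
    because the countably many cubes with rational centre and radius [1 / (j + 1)] form a base. *)
Lemma open_measurable_rV n (A : set 'rV[R]_n) : open A -> measurable A.
Proof.
move=> oA.
pose I := ({ffun 'I_n -> rat} * nat)%type.
pose bx (p : I) := [set x : 'rV[R]_n | forall i, `|x ord0 i - ratr (p.1 i)| < p.2.+1%:R^-1].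
have mbx p : measurable (bx p).
  rewrite (_ : bx p = \bigcap_(i in [set: 'I_n]) (rV_coord i @^-1`
     [set t : R | `|t - ratr (p.1 i)| < p.2.+1%:R^-1])); last first.
    by apply/seteqP; split => [x h i _|x h i]; exact: h.
  apply: fin_bigcap_measurable => // i _.
  rewrite -[X in measurable X]setTI; apply: measurable_rV_coord => //.
  rewrite (_ : mkset _ = ball (ratr (p.1 i) : R) (p.2.+1%:R^-1)); last first.
    by apply/seteqP; split=> t; rewrite /ball/= distrC.
  exact: measurable_ball.
rewrite (_ : A = \bigcup_p (if pselect (bx p `<=` A) then bx p else set0)).
  apply: countable_bigcupT_measurable => [|p]; last by case: (pselect (bx p `<=` A)) => ?; [exact: mbx|exact: measurable0].
  exact: countableP.
apply/seteqP; split => [x Ax|x [p _]]; last by case: pselect => // pA /pA.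
have /nbhs_ballP[e /= e0 eA] : nbhs x A by apply: open_nbhs_nbhs.
have [k ke] : exists k : nat, k.+1%:R^-1 < e / 2.
  have /ltr_add_invr[k] : 0 < e / 2 by rewrite divr_gt0.
  by rewrite add0r; exists k.
have /choice[q qP] : forall i, exists q : rat, `|x ord0 i - ratr q| < k.+1%:R^-1.
  move=> i; have /rat_in_itvoo[q] : x ord0 i - k.+1%:R^-1 < x ord0 i + k.+1%:R^-1.
    by rewrite ltrBlDr -addrA ltrDl addr_gt0 ?invr_gt0.
  by rewrite in_itv/= => /andP[q1 q2]; exists q; rewrite ltr_distlC q1 q2.
exists ([ffun i => q i], k) => //; case: pselect => [_ i|]; first by rewrite ffunE.
case=> y yk; apply: eA; split => // i j; rewrite ord1 /ball/=.
have := yk j; rewrite /= ffunE distrC => y1.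
apply: (le_lt_trans (ler_distD (ratr (q j)) _ _)).
by rewrite (splitr e) ltrD ?(lt_trans _ ke)// (lt_trans y1 ke).
Qed.

End measurability.

(** * Invariance of Lebesgue measure *)

Lemma measurable_preimage d d' (T : measurableType d) (U : measurableType d')
  (f : T -> U) (A : set U) :
  measurable_fun setT f -> measurable A -> measurable (f @^-1` A).
Proof. by move=> mf mA; rewrite -[X in measurable X]setTI; exact: mf. Qed.

Section dilation.
Local Open Scope ereal_scope.
Context {R : realType}.

Lemma ge0_integral_dilation d (T : measurableType d)
  (m : {measure set T -> \bar R}) (s : T -> T) (a : {nonneg R}) (g : T -> \bar R) :
  measurable_fun setT s ->
  (forall A, measurable A -> m (s @^-1` A) = (a%:num)%:E * m A) ->
  measurable_fun setT g -> (forall x, 0 <= g x) ->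
  \int[m]_x g (s x) = (a%:num)%:E * \int[m]_x g x.
Proof.
move=> ms sE mg g0.
transitivity (\int[pushforward m s]_x g x).
  by rewrite ge0_integral_pushforward.
rewrite -ge0_integral_mscale//.
apply: eq_measure_integral => /= A mA _.
by rewrite /pushforward sE// /mscale.
Qed.

Lemma product_measure_dilation d1 d2 (T1 : measurableType d1)
  (T2 : measurableType d2) (m1 : {sigma_finite_measure set T1 -> \bar R})
  (m2 : {sigma_finite_measure set T2 -> \bar R})
  (s : T1 -> T1) (t : T2 -> T2) (a b : {nonneg R}) :
  measurable_fun setT s -> measurable_fun setT t ->
  (forall A, measurable A -> m1 (s @^-1` A) = (a%:num)%:E * m1 A) ->
  (forall A, measurable A -> m2 (t @^-1` A) = (b%:num)%:E * m2 A) ->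
  forall C, measurable C ->
  (m1 \x m2) ((fun p => (s p.1, t p.2)) @^-1` C) =
  (a%:num * b%:num)%:E * (m1 \x m2) C.
Proof.
move=> ms mt sE tE C mC; rewrite /product_measure1.
have gE x : (m2 \o xsection ((fun p => (s p.1, t p.2)) @^-1` C)) x =
    (b%:num)%:E * (m2 \o xsection C) (s x).
  rewrite /= -tE; last exact: measurable_xsection.
  congr (m2 _); rewrite !xsectionE; apply/seteqP; split => y //=.
under eq_integral do rewrite gE.
rewrite ge0_integralZl_EFin//; last first.
  apply: measurableT_comp => //; exact: measurable_fun_xsection.
rewrite (ge0_integral_dilation ms sE)//; last exact: measurable_fun_xsection.
by rewrite muleA -EFinM mulrC.
Qed.

Lemma product_measure_invariant d1 d2 (T1 : measurableType d1)
  (T2 : measurableType d2) (m1 : {sigma_finite_measure set T1 -> \bar R})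
  (m2 : {sigma_finite_measure set T2 -> \bar R}) (s : T1 -> T1) (t : T2 -> T2) :
  measurable_fun setT s -> measurable_fun setT t ->
  (forall A, measurable A -> m1 (s @^-1` A) = m1 A) ->
  (forall A, measurable A -> m2 (t @^-1` A) = m2 A) ->
  forall C, measurable C ->
  (m1 \x m2) ((fun p => (s p.1, t p.2)) @^-1` C) = (m1 \x m2) C.
Proof.
move=> ms mt sE tE C mC.
pose o : {nonneg R} := NngNum ler01.
have -> : (m1 \x m2) C = (o%:num * o%:num)%:E * (m1 \x m2) C.
  by rewrite /= mulr1 mul1e.
by apply: product_measure_dilation => // A mA; rewrite mul1e ?sE ?tE.
Qed.

End dilation.

Section lebesgue_affine.
Context {R : realType}.

(** [a] times the pushforward has the right value on half-open intervals, and these determine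
    Lebesgue measure. *)
Lemma lebesgue_measure_dilation (a c : R) (A : set (measurableTypeR R)) :
  (0 < a)%R -> measurable A ->
  lebesgue_measure ((fun x => a * x + c) @^-1` A) =
  ((a^-1)%:E * lebesgue_measure A)%E.
Proof.
move=> a0 mA.
have mf : measurable_fun setT (fun x : measurableTypeR R => a * x + c : measurableTypeR R).
  by apply: measurable_funD => //; apply: measurable_funM.
have an0 : 0 <= a by exact: ltW.
pose m := mscale (NngNum an0) (pushforward (@lebesgue_measure R)
  (fun x : measurableTypeR R => a * x + c : measurableTypeR R)).
suff <- : m mf A = lebesgue_measure A.
  by rewrite /m /mscale/= muleA -EFinM mulVf ?gt_eqF// mul1e.
apply/esym; apply: lebesgue_measure_unique => // X [[x y] _ <-] /=.
rewrite lebesgue_measure_itv/= /m /mscale/= /pushforward.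
rewrite (_ : _ @^-1` _ = `](x - c) / a, (y - c) / a]%classic).
  rewrite lebesgue_measure_itv/= !lte_fin ltr_pM2r ?invr_gt0// ltrD2r.
  case: ifPn => _; last by rewrite mule0.
  rewrite -EFinD -EFinD -EFinM; congr EFin; field.
  by rewrite gt_eqF.
apply/seteqP; split => z/=; rewrite !in_itv/= ltr_pdivrMr// ler_pdivlMr//;
 by rewrite (mulrC z) ltrBlDr lerBrDr.
Qed.

Lemma lebesgue_rV_dilation n (a : R) (c : 'rV[R]_n) (A : set 'rV[R]_n) :
  (0 < a)%R -> measurable A ->
  lebesgue_rV n ((fun x => a *: x + c) @^-1` A) =
  ((a ^- n)%:E * lebesgue_rV n A)%E.
Proof.
move=> a0; have ai0 : 0 <= a^-1 by rewrite invr_ge0 ltW.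
elim: n c A => [|n IH] c A mA.
  rewrite expr0 invr1 mul1e (_ : _ @^-1` _ = A)//.
  by apply/funext => x /=; rewrite thinmx0 [in RHS](thinmx0 x).
rewrite /= /lebesgue_rV_step /pushforward.
have mcA : measurable (@rV_cons R n @^-1` A).
  by apply: measurable_preimage => //; exact: measurable_rV_cons.
pose c' := rV_uncons c.
have dil := @product_measure_dilation R _ _ _ _ (@lebesgue_measure R) (lebesgue_rV n)
  (fun x => a * x + c'.1) (fun x => a *: x + c'.2) (NngNum ai0)
  (NngNum (exprn_ge0 n ai0)).
rewrite exprS invfM -exprVn; apply: etrans (dil _ _ _ _ _ mcA).
- congr ((_ \x _)%E _); rewrite -[LHS]comp_preimage -[RHS]comp_preimage.
  congr (_ @^-1` A); apply/funext => p /=; apply/rowP => i.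
  have E m (u v : 'rV[R]_m) j : (a *: u + v) ord0 j = a * u ord0 j + v ord0 j.
    by rewrite !mxE.
  rewrite E; case: (unliftP ord0 i) => [j ->|->].
    by rewrite !rV_consS E mxE.
  by rewrite !rV_cons0.
- by apply: measurable_funD => //; apply: measurable_funM.
- by apply: measurable_fun_rVD => //; exact: measurable_fun_rVZ.
- by move=> B mB; exact: lebesgue_measure_dilation.
- by move=> B mB; rewrite IH//= exprVn.
Qed.

Lemma lebesgue_rV_translation n (c : 'rV[R]_n) (A : set 'rV[R]_n) :
  measurable A -> lebesgue_rV n ((fun x => x + c) @^-1` A) = lebesgue_rV n A.
Proof.
move=> mA; have := lebesgue_rV_dilation c (@ltr01 R) mA.
rewrite expr1n invr1 mul1e => <-; congr (lebesgue_rV n (_ @^-1` A)).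
by apply/funext => x; rewrite scale1r.
Qed.

Lemma lebesgue_measure_opp (A : set (measurableTypeR R)) : measurable A ->
  lebesgue_measure ((fun x => - x) @^-1` A) = lebesgue_measure A.
Proof.
move=> mA.
have mf : measurable_fun setT (fun x : measurableTypeR R => - x : measurableTypeR R).
  exact: measurable_funN.
pose m := pushforward (@lebesgue_measure R) (fun x : measurableTypeR R => - x : measurableTypeR R).
pose m1 := mscale (NngNum (@ler01 R)) m.
have m1E : m1 mf A = m A by rewrite /m1 /mscale/= mul1e.
rewrite -[LHS]m1E; apply/esym; apply: lebesgue_measure_unique => // X [[x y] _ <-] /=.
rewrite /m1 /mscale/= mul1e /m /pushforward (_ : _ @^-1` _ = `[- y, - x[%classic).
  by rewrite !lebesgue_measure_itv/= !lte_fin ltrN2 -!EFinD opprK addrC.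
by apply/seteqP; split => z/=; rewrite !in_itv/= => /andP[z0 z1]; apply/andP; split; lra.
Qed.

Lemma lebesgue_rV_opp n (A : set 'rV[R]_n) : measurable A ->
  lebesgue_rV n ((fun x => - x) @^-1` A) = lebesgue_rV n A.
Proof.
elim: n A => [|n IH] A mA.
  rewrite (_ : _ @^-1` _ = A)//.
  by apply/funext => x /=; rewrite thinmx0 [in RHS](thinmx0 x).
rewrite /= /lebesgue_rV_step /pushforward.
have mcA : measurable (@rV_cons R n @^-1` A).
  by apply: measurable_preimage => //; exact: measurable_rV_cons.
have mN : measurable_fun setT (fun x : 'rV[R]_n => - x).
  rewrite (_ : (fun x => _) = (fun x => (-1) *: x)); first exact: measurable_fun_rVZ.
  by apply/funext => x; rewrite scaleN1r.
rewrite -(@product_measure_invariant R _ _ _ _ (@lebesgue_measure R) (lebesgue_rV n)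
  (fun x : measurableTypeR R => - x) (fun x => - x) _ _ _ _ _ mcA).
- congr ((_ \x _)%E _); rewrite -[LHS]comp_preimage -[RHS]comp_preimage.
  congr (_ @^-1` A); apply/funext => p /=; apply/rowP => i.
  have E m (u : 'rV[R]_m) j : (- u) ord0 j = - u ord0 j by rewrite mxE.
  rewrite E; case: (unliftP ord0 i) => [j ->|->].
    by rewrite !rV_consS E.
  by rewrite !rV_cons0.
- exact: measurable_funN.
- exact: mN.
- exact: lebesgue_measure_opp.
- exact: IH.
Qed.

End lebesgue_affine.

(** * Uniqueness of Lebesgue measure and orthogonal decompositions *)

Section haar.
Context {R : realType}.

Definition cube n (a b : R) := [set x : 'rV[R]_n | forall i, `[a, b]%classic (x ord0 i)].

Lemma measurable_cube n a b : measurable (@cube n a b).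
Proof.
rewrite (_ : cube a b = \bigcap_(i in [set: 'I_n]) (rV_coord i @^-1` `[a, b]%classic)).
  apply: fin_bigcap_measurable => // i _.
  by apply: measurable_preimage => //; exact: measurable_rV_coord.
by apply/seteqP; split => [x h i _|x h i]; exact: h.
Qed.

Lemma lebesgue_cube n a b : a <= b -> lebesgue_rV n (cube a b) = ((b - a) ^+ n)%:E.
Proof.
move=> ab; have := @lebesgue_rV_box R n (fun=> `[a, b]%classic) (fun=> measurable_itv _).
rewrite /cube => ->; rewrite lebesgue_measure_itv/= lte_fin.
have -> : (if a < b then (b%:E - a%:E)%E else 0%E) = (b - a)%:E.
  by case: ltgtP ab => // -> _; rewrite subrr.
by rewrite prodEFin prodr_const card_ord.
Qed.

Local Open Scope ereal_scope.

(** Both sides are product measures of [C], and product measures are determined by their values on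
    rectangles. *)
Lemma cavalieri d1 d2 (T1 : measurableType d1) (T2 : measurableType d2)
  (m1 : {sigma_finite_measure set T1 -> \bar R})
  (m2 : {sigma_finite_measure set T2 -> \bar R}) (C : set (T1 * T2)) :
  measurable C ->
  \int[m1]_x m2 [set y | C (x, y)] = \int[m2]_y m1 [set x | C (x, y)].
Proof.
move=> mC.
transitivity ((m1 \x m2) C).
  by apply: eq_integral => x _; rewrite /= xsectionE.
transitivity ((m1 \x^ m2) C).
  by apply: product_measure_unique => //= A B mA mB; rewrite product_measure2E.
by apply: eq_integral => x _; rewrite /= ysectionE.
Qed.

(* [mu A * V Q = \int\int 1_A (x + y) 1_Q y], and after the change of variable [y := y - x] this is
   [mu (- Q) * V A]. *)
Lemma haar_unique n (mu : {sigma_finite_measure set 'rV[R]_n -> \bar R}) :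
  (forall (c : 'rV[R]_n) (A : set 'rV[R]_n), measurable A ->
    mu ((fun x => x + c)%R @^-1` A) = mu A) ->
  exists2 k, 0 <= k & forall A, measurable A -> mu A = k * lebesgue_rV n A.
Proof.
move=> muT; pose Q := @cube n 0%R 1%R.
have mQ : measurable Q := measurable_cube _ _.
have LQ : lebesgue_rV n Q = 1 by rewrite lebesgue_cube// subr0 expr1n.
have mN : measurable_fun setT (fun x : 'rV[R]_n => - x)%R.
  rewrite (_ : (fun x => _) = (fun x => (-1) *: x)%R); first exact: measurable_fun_rVZ.
  by apply/funext => x; rewrite scaleN1r.
have constE (m : {measure set 'rV[R]_n -> \bar R}) (A B : set 'rV[R]_n) :
    measurable A -> (\int[lebesgue_rV n]_y m [set x | B x /\ A y] = m B * lebesgue_rV n A).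
  move=> mA; transitivity (\int[lebesgue_rV n]_(y in A) m B); last first.
    by rewrite integral_cst.
  rewrite [RHS]integral_mkcond; apply: eq_integral => y _; rewrite patchE.
  case: ifPn => [|/negP nA].
    by rewrite inE => Ay; congr (m _); apply/seteqP; split => [x []//|x Bx].
  rewrite (_ : mkset _ = set0) ?measure0//; apply/seteqP; split => // x [_ Ay].
  by apply: nA; rewrite inE.
exists (mu ((fun x => - x)%R @^-1` Q)) => // A mA.
have mAdd : measurable_fun setT (fun p : 'rV[R]_n * 'rV[R]_n => p.1 + p.2)%R.
  exact: measurable_fun_rVD.
have mSub : measurable_fun setT (fun p : 'rV[R]_n * 'rV[R]_n => p.2 - p.1)%R.
  by apply: measurable_fun_rVD => //; exact: measurableT_comp.
transitivity (\int[lebesgue_rV n]_y mu [set x | A (x + y)%R /\ Q y]).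
  rewrite -[LHS]mule1 -LQ -constE//; apply: eq_integral => y _.
  suff mB : measurable [set x : 'rV[R]_n | A x /\ Q y].
    by exact: esym (muT y _ mB).
  have [Qy|nQy] := pselect (Q y).
    by rewrite (_ : mkset _ = A)//; apply/seteqP; split => [x []|].
  rewrite (_ : mkset _ = set0); first exact: measurable0.
  by apply/seteqP; split => [x []|].
rewrite -(cavalieri mu (lebesgue_rV n)
  (C := [set p | A (p.1 + p.2)%R /\ Q p.2])); last first.
  apply: measurableI; first exact: measurable_preimage mAdd _.
  exact: (@measurable_preimage _ _ _ _ snd).
transitivity (\int[mu]_x (lebesgue_rV n [set y | A y /\ Q (y - x)%R])).
  apply: eq_integral => x _ /=.
  have mB : measurable [set y | A y /\ Q (y - x)%R].
    apply: measurableI => //; apply: (@measurable_preimage _ _ _ _ (fun y : 'rV[R]_n => y - x)%R Q) => //.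
    exact: measurable_fun_rVD.
  rewrite -(lebesgue_rV_translation x mB); congr (_ _); apply/seteqP.
  by split => y /=; rewrite addrK addrC.
rewrite (cavalieri mu (lebesgue_rV n)
  (C := [set p | A p.2 /\ Q (p.2 - p.1)%R])); last first.
  apply: measurableI; last exact: measurable_preimage mSub _.
  exact: (@measurable_preimage _ _ _ _ snd).
rewrite -constE//; apply: eq_integral => y _ /=.
suff mB : measurable [set x : 'rV[R]_n | Q (- x)%R /\ A y].
  rewrite -(muT (- y)%R _ mB); congr (mu _); apply/seteqP.
  by split => x /=; rewrite opprB => -[].
have [Ay|nAy] := pselect (A y).
  rewrite (_ : mkset _ = (fun x => - x)%R @^-1` Q); first exact: measurable_preimage.
  by apply/seteqP; split => [x []|].
rewrite (_ : mkset _ = set0); first exact: measurable0.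
by apply/seteqP; split => [x []|].
Qed.

End haar.

Section decomposition.
Context {R : realType} {n r k : nat}.
Variables (B : 'M[R]_(r, n)) (D : 'M[R]_(k, n)) (B' : 'M[R]_(n, r)) (D' : 'M[R]_(n, k)).

(** The rows of [B] and [D] form a basis of R^n, and [B'], [D'] read off the coordinates. The
    coordinate along [D] comes first, so that an [xsection] is a fibre in the direction of [B]. *)
Definition glue_rV (p : 'rV[R]_k * 'rV[R]_r) : 'rV[R]_n := p.2 *m B + p.1 *m D.

Lemma measurable_glue : measurable_fun setT glue_rV.
Proof. by apply: measurable_fun_rVD; exact: measurable_fun_mulmx. Qed.

Hypotheses (BD1 : B' *m B + D' *m D = 1%:M) (BB : B *m B' = 1%:M)
  (DD : D *m D' = 1%:M) (BD : B *m D' = 0) (DB : D *m B' = 0).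

Let unglue (x : 'rV[R]_n) := (x *m D', x *m B').

Let measurable_unglue : measurable_fun setT unglue.
Proof. by apply: measurable_fun_pair; exact: measurable_fun_mulmx. Qed.

Let glueK : cancel glue_rV unglue.
Proof.
move=> [y z]; rewrite /unglue /glue_rV !mulmxDl -!mulmxA BD DD BB DB.
by rewrite !mulmx0 !mulmx1 add0r addr0.
Qed.

Let unglueK : cancel unglue glue_rV.
Proof. by move=> x; rewrite /glue_rV/= -!mulmxA -mulmxDr BD1 mulmx1. Qed.

Local Open Scope ereal_scope.

(** The product measure transported by [glue_rV] is translation invariant, hence a multiple of
    Lebesgue measure by [haar_unique]; [c] is the inverse of that multiple. *)
Lemma lebesgue_rV_decomp : exists2 c : R, (0 < c)%R &
  forall A, measurable A -> lebesgue_rV n A =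
    c%:E * (lebesgue_rV k \x lebesgue_rV r) (glue_rV @^-1` A).
Proof.
pose la := @lebesgue_rV R k \x @lebesgue_rV R r.
have mg := measurable_glue.
pose m1 := mscale (NngNum (@ler01 R)) (pushforward la glue_rV).
pose m0 : {measure set 'rV[R]_n -> \bar R} := m1 mg.
have m0E A : m0 A = la (glue_rV @^-1` A) by rewrite /m0/m1/= /mscale/= mul1e.
have sf : sigma_finite setT m0.
  have /sigma_finiteP[F [TF ndF Foo]] := sigma_finiteT (@lebesgue_rV R k).
  have /sigma_finiteP[G [TG ndG Goo]] := sigma_finiteT (@lebesgue_rV R r).
  exists (fun j => unglue @^-1` (F j `*` G j)).
    rewrite -preimage_bigcup (_ : \bigcup_j _ = setT) ?preimage_setT//.
    apply/seteqP; split => // -[x y] _.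
    have [i _ Fx] : (\bigcup_j F j) x by rewrite -TF.
    have [j _ Gy] : (\bigcup_j G j) y by rewrite -TG.
    exists (maxn i j) => //; split => /=.
      by move: x Fx; exact/subsetPset/ndF/leq_maxl.
    by move: y Gy; exact/subsetPset/ndG/leq_maxr.
  move=> j; have [mF Fj] := Foo j; have [mG Gj] := Goo j; split.
    by apply: measurable_preimage => //; exact: measurableX.
  rewrite m0E -comp_preimage (_ : unglue \o glue_rV = id); last exact/funext/glueK.
  by rewrite preimage_id /la product_measure1E// lte_mul_pinfty// ge0_fin_numE.
(* [haar_unique] expects a sigma-finite measure, so this structure is packed onto [m0] by hand. *)
pose sF := isSFinite.Build _ _ _ _ (sfinite_measure_sigma_finite sf).
pose sgF := isSigmaFinite.Build _ _ _ _ sf.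
pose mu := HB.pack_for (SigmaFiniteMeasure.type 'rV[R]_n R) (Measure.sort m0) sF sgF.
have muE A : mu A = la (glue_rV @^-1` A) by exact: m0E.
have muT (c : 'rV[R]_n) (A : set 'rV[R]_n) : measurable A ->
    mu ((fun x => x + c)%R @^-1` A) = mu A.
  move=> mA; rewrite !muE.
  have msh m (v : 'rV[R]_m) : measurable_fun setT (fun x : 'rV[R]_m => x + v)%R.
    exact: measurable_fun_rVD.
  have mC : measurable (glue_rV @^-1` A) by exact: measurable_preimage.
  have inv := product_measure_invariant (msh k (c *m D')%R) (msh r (c *m B')%R)
    (lebesgue_rV_translation _) (lebesgue_rV_translation _) mC.
  have E : glue_rV @^-1` ((fun x => x + c)%R @^-1` A) =
      (fun p => (p.1 + c *m D', p.2 + c *m B')%R) @^-1` (glue_rV @^-1` A).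
    have Ep p : (glue_rV p + c = glue_rV (p.1 + c *m D', p.2 + c *m B'))%R.
      rewrite -[c in LHS]unglueK /glue_rV/= -/(c *m B') -/(c *m D').
      by rewrite !mulmxDl addrACA.
    by apply/funext => p; rewrite /preimage/= Ep.
  by rewrite E; exact: inv.
have [K K0 KE] := haar_unique muT.
(* The image of a product of unit cubes has transported measure 1, which excludes the multiples 0
   and infinity. *)
pose Q := unglue @^-1` (cube 0%R 1%R `*` cube 0%R 1%R).
have mQ : measurable Q.
  by apply: measurable_preimage => //; apply: measurableX; exact: measurable_cube.
have Q1 : K * lebesgue_rV n Q = 1.
  rewrite -KE// muE -comp_preimage (_ : unglue \o glue_rV = id); last exact/funext/glueK.
  rewrite preimage_id /la product_measure1E; try exact: measurable_cube.
  rewrite [X in X * _](lebesgue_cube k ler01) [X in _ * X](lebesgue_cube r ler01).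
  by rewrite !subr0 !expr1n mule1.
have Kfin : K \is a fin_num.
  rewrite ge0_fin_numE// ltey; apply/eqP => Koo; move: Q1; rewrite Koo.
  have [->|Qn0] := eqVneq (lebesgue_rV n Q) 0.
    by rewrite mule0 => /eqP; rewrite lt_eqF.
  by rewrite gt0_mulye// lt_neqAle eq_sym Qn0/=.
have Kn0 : K != 0.
  by apply/eqP => K00; move: Q1; rewrite K00 mul0e => /eqP; rewrite lt_eqF.
have fK0 : (0 < fine K)%R by rewrite fine_gt0// lt_neqAle eq_sym Kn0 K0/= -ge0_fin_numE.
exists (fine K)^-1%R; first by rewrite invr_gt0.
move=> A mA; rewrite [X in _ * X](_ : _ = mu A); last by rewrite muE.
rewrite KE// -{2}(fineK Kfin) muleA -EFinM mulVf ?mul1e//.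
by rewrite gt_eqF.
Qed.



Lemma ge0_integral_decomp : exists2 c : R, (0 < c)%R &
  forall g : 'rV[R]_n -> \bar R, measurable_fun setT g -> (forall x, 0 <= g x) ->
  \int[lebesgue_rV n]_x g x =
  c%:E * \int[lebesgue_rV k]_y \int[lebesgue_rV r]_z g (glue_rV (y, z)).
Proof.
have [c c0 cE] := lebesgue_rV_decomp.
exists c => // g mg g0.
have mgl := measurable_glue.
pose nu := mscale (NngNum (ltW c0)) (pushforward (lebesgue_rV k \x lebesgue_rV r) glue_rV).
transitivity (\int[nu mgl]_x g x).
  by apply: eq_measure_integral => A mA _; exact: (cE A mA).
rewrite ge0_integral_mscale//= ge0_integral_pushforward//.
rewrite fubini_tonelli1//.   exact: measurableT_comp.
by move=> p; exact: g0.
Qed.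

End decomposition.

(** * Orthogonal complements in matrix form *)

Section linear_algebra.
Context {R : realType}.

Lemma row_mul_tr_eq0 n (u : 'rV[R]_n) : u *m u^T = 0 -> u = 0.
Proof.
move=> /matrixP/(_ ord0 ord0); rewrite !mxE => /eqP.
rewrite psumr_eq0 => [/allP u0|i _]; last by rewrite mxE -expr2 sqr_ge0.
apply/rowP => i; rewrite mxE; have := u0 i (mem_index_enum _).
by rewrite mxE -expr2 sqrf_eq0 => /eqP.
Qed.

Lemma gram_unit m n (A : 'M[R]_(m, n)) : row_free A -> A *m A^T \in unitmx.
Proof.
move=> fA; rewrite -row_free_unit; apply: inj_row_free => v vA.
have : (v *m A) *m (v *m A)^T = 0 by rewrite trmx_mul mulmxA -(mulmxA v) vA mul0mx.
by move/row_mul_tr_eq0 => vA0; apply: (row_free_inj fA); rewrite mul0mx.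
Qed.

Lemma orth_split k n (D : 'M[R]_(k, n)) : row_free D ->
  exists r (B : 'M[R]_(r, n)) (B' : 'M[R]_(n, r)) (D' : 'M[R]_(n, k)),
  [/\ B' *m B + D' *m D = 1%:M, B *m B' = 1%:M, D *m D' = 1%:M,
      B *m D' = 0 & D *m B' = 0] /\
  [/\ (r + k)%N = n, B *m D^T = 0 &
      forall x : 'rV[R]_n, x *m B^T = 0 -> exists y, x = y *m D].
Proof.
move=> fD; pose B := row_base (kermx D^T); exists _, B.
have fB : row_free B := row_base_free _.
have BD : B *m D^T = 0.
  by apply/sub_kermxP; rewrite /B eq_row_base.
clearbody B.
have DB : D *m B^T = 0 by rewrite -[LHS]trmxK trmx_mul trmxK BD trmx0.
exists (B^T *m invmx (B *m B^T)), (D^T *m invmx (D *m D^T)).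
have rk : (\rank (kermx D^T) + k)%N = n.
  rewrite mxrank_ker mxrank_tr; move/eqP: (fD) => ->.
  by rewrite subnK// -{1}(eqP fD) rank_leq_col.
have perpB m (X : 'M[R]_(m, n)) : X *m B^T = 0 -> (X <= D)%MS.
  move=> XB; have : (X <= kermx B^T)%MS by apply/sub_kermxP.
  suff /eqmxP DE : (D == kermx B^T)%MS by rewrite DE.
  rewrite -(geq_leqif (mxrank_leqif_eq _)); last exact/sub_kermxP.
  rewrite mxrank_ker mxrank_tr (eqP fB) (eqP fD).
  by rewrite -{1}rk addKn.
split; last first.
  split => // x /perpB/submxP[y ->]; by exists y.
have BB := mulmxV (gram_unit fB); have DD := mulmxV (gram_unit fD).
split; rewrite ?mulmxA ?BB ?DD ?BD ?DB ?mul0mx//.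
(* The rows of the error [M] are orthogonal to [B], hence combinations of the rows of [D]; being
   orthogonal to [D] as well, they vanish because the Gram matrix of [D] is invertible. *)
apply/eqP; rewrite -subr_eq0 -opprB oppr_eq0; set M := (X in X == 0).
have MB : M *m B^T = 0.
  rewrite /M mulmxBl mul1mx mulmxDl -!mulmxA DB !mulmx0 addr0.
  by rewrite (mulVmx (gram_unit fB)) mulmx1 subrr.
have MD : M *m D^T = 0.
  rewrite /M mulmxBl mul1mx mulmxDl -!mulmxA BD !mulmx0 add0r.
  by rewrite (mulVmx (gram_unit fD)) mulmx1 subrr.
have /submxP[W WE] := perpB _ _ MB.
move: MD; rewrite WE -mulmxA => /(congr1 (mulmx^~ (invmx (D *m D^T)))).
by rewrite -mulmxA DD mulmx1 !mul0mx => ->; rewrite mul0mx.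
Qed.

Lemma dotvE n (u x : 'rV[R]_n) : dotv u x = (u *m x^T) ord0 ord0.
Proof. by rewrite /dotv mxE; apply: eq_bigr => i _; rewrite mxE. Qed.

Lemma mulmx_tr_dotv n (u x : 'rV[R]_n) : u *m x^T = (dotv u x)%:M.
Proof. by rewrite dotvE -mx11_scalar. Qed.

Lemma dotvC n (u x : 'rV[R]_n) : dotv u x = dotv x u.
Proof. by apply: eq_bigr => i _; rewrite mulrC. Qed.

Lemma dotvDr n (u x y : 'rV[R]_n) : dotv u (x + y) = dotv u x + dotv u y.
Proof. by rewrite !dotvE linearD mulmxDr mxE. Qed.

Lemma dotvZr n (u x : 'rV[R]_n) c : dotv u (c *: x) = c * dotv u x.
Proof. by rewrite !dotvE linearZ -scalemxAr mxE. Qed.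

Lemma dotvDl n (u x y : 'rV[R]_n) : dotv (x + y) u = dotv x u + dotv y u.
Proof. by rewrite dotvC dotvDr !(dotvC u). Qed.

Lemma dotvZl n (u x : 'rV[R]_n) c : dotv (c *: x) u = c * dotv x u.
Proof. by rewrite dotvC dotvZr (dotvC u). Qed.

Lemma dotv0 n (u : 'rV[R]_n) : dotv u 0 = 0.
Proof. by rewrite dotvE trmx0 mulmx0 mxE. Qed.

Lemma dotvNr n (u x : 'rV[R]_n) : dotv u (- x) = - dotv u x.
Proof. by rewrite -scaleN1r dotvZr mulN1r. Qed.

Lemma dotv_mulmx m n (u : 'rV[R]_n) (B : 'M[R]_(m, n)) z :
  dotv u (z *m B) = dotv (u *m B^T) z.
Proof. by rewrite !dotvE trmx_mul mulmxA. Qed.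

Lemma dotv_eq0 n (u : 'rV[R]_n) : dotv u u = 0 -> u = 0.
Proof.
move=> u0; apply: row_mul_tr_eq0; rewrite mulmx_tr_dotv u0.
by rewrite scalemx1 scale0r || rewrite raddf0.
Qed.

Lemma vspace_matrix n (L : {vspace 'rV[R]_n}) :
  exists2 D : 'M[R]_(\dim L, n), row_free D &
  forall x, x \in L <-> exists y, x = y *m D.
Proof.
pose D := \matrix_(i < \dim L) (vbasis L)`_i.
have yD (y : 'rV[R]_(\dim L)) : y *m D = \sum_i y ord0 i *: (vbasis L)`_i.
  by rewrite mulmx_sum_row; apply: eq_bigr => i _; rewrite rowK.
exists D.
  apply: inj_row_free => v; rewrite yD.
  have /freeP fr := basis_free (vbasisP L).
  by move=> /(fr (fun i => v ord0 i)) v0; apply/rowP => i; rewrite v0 mxE.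
move=> x; split => [xL|[y ->]].
  exists (\row_i coord (vbasis L) i x); rewrite yD {1}(coord_vbasis xL).
  by apply: eq_bigr => i _; rewrite mxE.
rewrite yD; apply: memv_suml => i _; apply: memvZ; apply: vbasis_mem.
by apply: mem_nth; rewrite size_tuple.
Qed.

End linear_algebra.

(** * Half-spaces, bounded sets, null hyperplanes and the layer-cake formula *)

Section lebesgue_sets.
Context {R : realType}.
Local Open Scope ereal_scope.

Lemma measurable_halfspace n (u : 'rV[R]_n) (h : R) :
  measurable [set x | (dotv u x <= h)%R].
Proof.
rewrite (_ : mkset _ = dotv u @^-1` `]-oo, h]%classic).
  exact: (measurable_preimage (measurable_dotv u)).
by apply/seteqP; split => x/=; rewrite in_itv.
Qed.

Lemma measurable_hyperplane n (u : 'rV[R]_n) (h : R) :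
  measurable [set x | dotv u x = h].
Proof.
rewrite (_ : mkset _ = dotv u @^-1` [set h])//.
exact: (measurable_preimage (measurable_dotv u)).
Qed.

Definition bdd n (N : R) (A : set 'rV[R]_n) :=
  forall x, A x -> forall i, (`|x ord0 i| <= N)%R.

Lemma bddW n (N N' : R) (A : set 'rV[R]_n) : (N <= N')%R -> bdd N A -> bdd N' A.
Proof. by move=> NN bA x Ax i; rewrite (le_trans (bA _ Ax _)). Qed.

Lemma dotv_bdd n (N : R) (P : set 'rV[R]_n) (u x : 'rV[R]_n) : bdd N P -> P x ->
  (`|dotv u x| <= N * \sum_i `|u ord0 i|)%R.
Proof.
move=> bP Px; apply: (le_trans (ler_norm_sum _ _ _)).
rewrite mulr_sumr; apply: ler_sum => i _.
by rewrite normrM mulrC ler_wpM2r// bP.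
Qed.

Lemma bdd_cube n (N : R) (A : set 'rV[R]_n) : bdd N A -> A `<=` cube (- N)%R N.
Proof. by move=> bA x Ax i /=; rewrite in_itv/= -ler_norml bA. Qed.

Lemma bdd_le n (N : R) (A : set 'rV[R]_n) : (0 <= N)%R -> measurable A -> bdd N A ->
  lebesgue_rV n A <= ((N + N) ^+ n)%:E.
Proof.
move=> N0 mA bA; have := lebesgue_cube n (a := (- N)%R) (b := N); rewrite opprK => <-.
  by apply: le_measure; rewrite ?inE//; [exact: measurable_cube|exact: bdd_cube].
by rewrite (le_trans _ N0)// oppr_le0.
Qed.

Lemma bdd_fin_num n (N : R) (A : set 'rV[R]_n) : measurable A -> bdd N A ->
  lebesgue_rV n A \is a fin_num.
Proof.
move=> mA bA; rewrite ge0_fin_numE//.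
have bA' : bdd `|N|%R A by apply: bddW bA; exact: ler_norm.
exact: (le_lt_trans (bdd_le (normr_ge0 _) mA bA') (ltry _)).
Qed.

(** In the decomposition along the orthogonal complement of [u], the remaining direction is
    one-dimensional and each fibre of the hyperplane is a single point. *)
Lemma lebesgue_rV_hyperplane n (u : 'rV[R]_n) (h : R) : u != 0%R ->
  lebesgue_rV n [set x | dotv u x = h] = 0.
Proof.
move=> u0.
have n0 : (0 < n)%N.
  by case: n u u0 => // u; rewrite (thinmx0 u) eqxx.
have fD := row_base_free (kermx u^T).
have [r [B [B' [D' [[BD1 BB DD BD DB] [rk _ perp]]]]]] := orth_split fD.
have [c c0 ->] := lebesgue_rV_decomp BD1 BB DD BD DB; last exact: measurable_hyperplane.
have r1 : r = 1%N.
  have /= := mxrank_ker u^T; rewrite mxrank_tr rank_rV u0 => rkE.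
  by apply/eqP; rewrite -(eqn_add2r (\rank (kermx u^T))) rk rkE addnC subnK.
subst r; rewrite [X in _ * X](_ : _ = 0) ?mule0//.
apply: integral0_eq => y _ /=; rewrite xsectionE.
have uD : row_base (kermx u^T) *m u^T = 0%R.
  by apply/sub_kermxP; rewrite eq_row_base.
pose b := dotv u (1%:M *m B).
have uDy y' : dotv u (y' *m row_base (kermx u^T)) = 0%R.
  by rewrite dotvC dotvE -mulmxA uD mulmx0 mxE.
have b0 : b != 0%R.
  apply: contraNneq u0 => b0; apply/eqP; apply: dotv_eq0.
  have uB : u *m B^T = 0%R.
    rewrite -[B]mul1mx mulmx_tr_dotv -/b b0; exact: raddf0.
  by have [w {2}->] := perp _ uB; rewrite uDy.
have zE (z : 'rV[R]_1) : dotv u (glue_rV B (row_base (kermx u^T)) (y, z)) = (z ord0 ord0 * b)%R.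
  rewrite /glue_rV/= dotvDr uDy addr0 {1}[z]mx11_scalar -[z _ _]mulr1 -scale_scalar_mx.
  by rewrite -scalemxAl dotvZr mulr1.
rewrite (_ : _ @^-1` _ = [set z : 'rV_1 | forall i, [set h / b]%R (z ord0 i)]).
  rewrite (lebesgue_rV_box (A := fun=> [set h / b]%R))// big_ord1.
  exact: lebesgue_measure_set1.
apply/seteqP; split => z /=; rewrite zE.
  by move=> <- i; rewrite (ord1 i) mulfK.
by move=> /(_ ord0) ->; rewrite divfK.
Qed.

Lemma lebesgue_rV_cube_gt0 n (A : set 'rV[R]_n) (x : 'rV[R]_n) (e : R) : (0 < e)%R ->
  measurable A -> (forall y : 'rV[R]_n, (forall i, `|y ord0 i - x ord0 i| < e)%R -> A y) ->
  0 < lebesgue_rV n A.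
Proof.
move=> e0 mA eA.
have e2 : (0 <= e / 2)%R by rewrite divr_ge0// ltW.
have mc : measurable (cube 0%R (e / 2)%R : set 'rV[R]_n) by exact: measurable_cube.
apply: (@lt_le_trans _ _ (lebesgue_rV n ((fun y => y + - x)%R @^-1` cube 0%R (e / 2)%R))).
  rewrite lebesgue_rV_translation// lebesgue_cube// subr0 lte_fin exprn_gt0//.
  by rewrite divr_gt0.
apply: le_measure; rewrite ?inE//.
  apply: (@measurable_preimage _ _ _ _ (fun y : 'rV[R]_n => y - x)%R) => //.
  exact: measurable_fun_rVD.
move=> y yc; apply: eA => i; have := yc i; rewrite /= !mxE in_itv/= => /andP[y0 y1].
by rewrite ger0_norm// (le_lt_trans y1)// ltr_pdivrMr// mulr_natr mulr2n ltrDl.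
Qed.

(** Cavalieri's principle for the region [0 < t < g x] under the graph. *)
Lemma layer_cake d (T : measurableType d) (m : {sigma_finite_measure set T -> \bar R})
  (g : T -> R) : measurable_fun setT g -> (forall x, (0 <= g x)%R) ->
  \int[m]_x (g x)%:E =
  \int[@lebesgue_measure R]_(u in `]0%R, +oo[) m [set x | (u < g x)%R].
Proof.
move=> mg g0.
pose C := [set p : T * measurableTypeR R | (0 < p.2)%R /\ (p.2 < g p.1)%R].
have mC : measurable C.
  rewrite (_ : C = (snd @^-1` `]0%R, +oo[%classic) `&`
      ((fun p => (p.2 < g p.1)%R) @^-1` [set true])).
    apply: measurableI; first exact: (@measurable_preimage _ _ _ _ snd).
    apply: (@measurable_preimage _ _ _ _ (fun p : T * measurableTypeR R => (p.2 < g p.1)%R)) => //.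
    by apply: measurable_fun_ltr => //; exact: measurableT_comp.
  by apply/seteqP; split => p; rewrite /C/= in_itv/= andbT.
transitivity (\int[m]_x lebesgue_measure [set u | C (x, u)]).
  apply: eq_integral => x _; rewrite (_ : mkset _ = `]0%R, g x[%classic).
    by rewrite lebesgue_measure_itv/= lte_fin sube0; case: ltgtP (g0 x) => // <- _.
  by apply/seteqP; split => u/=; rewrite in_itv/= => /andP.
rewrite (cavalieri m (@lebesgue_measure R) mC) [RHS]integral_mkcond.
apply: eq_integral => u _; rewrite patchE; case: ifPn => [|/negP u0].
  rewrite inE/= in_itv/= andbT => u0; congr (m _).
  by apply/seteqP; split => x [].
rewrite (_ : mkset _ = set0) ?measure0//; apply/seteqP; split => // x [/= u1 _].
by apply: u0; rewrite inE/= in_itv/= u1.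
Qed.

End lebesgue_sets.

Lemma bdd_integrable_dotv (R : realType) (r : nat) (A : set 'rV[R]_r) (N : R) u : measurable A -> bdd N A ->
  (lebesgue_rV r).-integrable A (EFin \o dotv u).
Proof.
move=> mA bA; apply: measurable_bounded_integrable => //.
- by have := bdd_fin_num mA bA; rewrite fin_numElt => /andP[].
- by apply: measurable_funTS; exact: measurable_dotv.
- exists (N * \sum_i `|u ord0 i|); split; first exact: num_real.
  by move=> M NM x Ax; apply: (le_trans _ (ltW NM)); exact: (dotv_bdd _ bA Ax).
Qed.

(** * The Brunn-Minkowski inequality *)

Section brunn_minkowski.
Context {R : realType}.
Local Open Scope ereal_scope.

(** Brunn-Minkowski on the line, in additive form: [C] contains the open interval between the
    combined infima and the combined suprema. *)
Lemma interval_sum_measure (I J C : set (measurableTypeR R)) (K l : R) :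
  (0 < l)%R -> (l < 1)%R -> is_interval I -> is_interval J ->
  I !=set0 -> J !=set0 ->
  (forall s, I s -> `|s| <= K)%R -> (forall s, J s -> `|s| <= K)%R ->
  measurable I -> measurable J -> measurable C ->
  (forall s t, I s -> J t -> C ((1 - l) * s + l * t)%R) ->
  (1 - l)%:E * lebesgue_measure I + l%:E * lebesgue_measure J <= lebesgue_measure C.
Proof.
move=> l0 l1 iI iJ I0 J0 IK JK mI mJ mC IJC.
have l1' : (0 < 1 - l)%R by rewrite subr_gt0.
have hs (A : set R) : A !=set0 -> (forall s, A s -> `|s| <= K)%R -> has_sup A /\ has_inf A.
  move=> A0 AK; split; split => //.
    by exists K => s /AK; rewrite ler_norml => /andP[].
  by exists (- K)%R => s /AK; rewrite ler_norml => /andP[].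
have [sI fI] := hs I I0 IK; have [sJ fJ] := hs J J0 JK.
have up (A : set (measurableTypeR R)) : measurable A -> has_sup A -> has_inf A ->
    lebesgue_measure A <= (sup A - inf A)%:E.
  move=> mA sA fA.
  have fs : (inf A <= sup A)%R.
    have [[x Ax] _] := sA.
    by rewrite (le_trans (ge_inf fA.2 Ax))//; apply: ub_le_sup => //; exact: sA.2.
  rewrite (@le_trans _ _ (lebesgue_measure `[inf A, sup A]%classic))//.
    apply: le_measure; rewrite ?inE//.
    move=> x Ax /=; rewrite in_itv/= (ge_inf fA.2 Ax)/=.
    by apply: ub_le_sup => //; exact: sA.2.
  by rewrite lebesgue_measure_itv/= lte_fin; case: ltgtP fs => // ->; rewrite subrr.
set p0 := ((1 - l) * inf I + l * inf J)%R; set p1 := ((1 - l) * sup I + l * sup J)%R.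
have sub : `]p0, p1[%classic `<=` C.
  move=> p; rewrite /= in_itv/= => /andP[pp0 pp1].
  have [s0 Is0 [t0 Jt0 st0]] : exists2 s, I s & exists2 t, J t & ((1 - l) * s + l * t < p)%R.
    have e0 : (0 < p - p0)%R by rewrite subr_gt0.
    have [s Is s1] := inf_adherent e0 fI; have [t Jt t1] := inf_adherent e0 fJ.
    exists s => //; exists t => //; rewrite /p0 in s1 t1 pp0 *; nra.
  have [s1 Is1 [t1 Jt1 st1]] : exists2 s, I s & exists2 t, J t & (p < (1 - l) * s + l * t)%R.
    have e0 : (0 < p1 - p)%R by rewrite subr_gt0.
    have [s Is s1] := sup_adherent e0 sI; have [t Jt t1] := sup_adherent e0 sJ.
    exists s => //; exists t => //; rewrite /p1 in s1 t1 pp1 *; nra.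
  set q0 := ((1 - l) * s0 + l * t0)%R in st0.
  set q1 := ((1 - l) * s1 + l * t1)%R in st1.
  (* Moving in [I] and in [J] by the same ratio [th] makes the combination run linearly from [q0] to
     [q1], so it hits [p]. *)
  pose th := ((p - q0) / (q1 - q0))%R.
  have q01 : (0 < q1 - q0)%R by rewrite subr_gt0 (lt_trans st0).
  have th0 : (0 <= th)%R by rewrite divr_ge0// ltW// subr_gt0.
  have th1 : (th <= 1)%R by rewrite ler_pdivrMr// mul1r lerD2r ltW.
  have iv (A : set R) x y : is_interval A -> A x -> A y -> A (x + th * (y - x))%R.
    move=> iA Ax Ay; have [xy|/ltW yx] := leP x y.
      by apply: (iA x y) => //; nra.
    by apply: (iA y x) => //; nra.
  have -> : p = ((1 - l) * (s0 + th * (s1 - s0)) + l * (t0 + th * (t1 - t0)))%R.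
    rewrite [RHS](_ : _ = q0 + th * (q1 - q0))%R; last by rewrite /q0 /q1; ring.
    by rewrite /th divfK ?gt_eqF// addrC subrK.
  by apply: IJC; exact: iv.
apply: (@le_trans _ _ (p1 - p0)%:E).
  apply: (@le_trans _ _ (((1 - l) * (sup I - inf I))%:E + (l * (sup J - inf J))%:E)).
    apply: leeD; rewrite EFinM; apply: lee_wpmul2l;
      by [rewrite lee_fin ltW|exact: up].
  by rewrite -EFinD lee_fin /p1 /p0; lra.
apply: (@le_trans _ _ (lebesgue_measure `]p0, p1[%classic)); last first.
  by apply: le_measure; rewrite ?inE.
rewrite lebesgue_measure_itv/= lte_fin; case: ifPn => //.
by rewrite -leNgt => p10; rewrite lee_fin subr_le0.
Qed.

(** By the layer-cake formula the claim reduces to superlevel sets. Supremum 1 for both [f] and [g]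
    makes these nonempty for the same levels [u < 1], which the additive inequality on the line
    requires; in return the conclusion has an arithmetic mean in place of a geometric one. *)
Lemma prekopa_leindler_sup1 (f g h : measurableTypeR R -> R) (l K : R) :
  (0 < l)%R -> (l < 1)%R ->
  measurable_fun setT f -> measurable_fun setT g -> measurable_fun setT h ->
  (forall x, 0 <= f x)%R -> (forall x, 0 <= g x)%R -> (forall x, 0 <= h x)%R ->
  (forall x, f x <= 1)%R -> (forall x, g x <= 1)%R ->
  (forall u, u < 1 -> exists x, u < f x)%R -> (forall u, u < 1 -> exists x, u < g x)%R ->
  (forall u, 0 < u -> is_interval [set x | u < f x])%R ->
  (forall u, 0 < u -> is_interval [set x | u < g x])%R ->
  (forall x, 0 < f x -> `|x| <= K)%R -> (forall x, 0 < g x -> `|x| <= K)%R ->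
  (forall u x y, 0 < u -> u < f x -> u < g y -> u < h ((1 - l) * x + l * y))%R ->
  (1 - l)%:E * \int[lebesgue_measure]_x (f x)%:E +
    l%:E * \int[lebesgue_measure]_x (g x)%:E
  <= \int[lebesgue_measure]_x (h x)%:E.
Proof.
move=> l0 l1 mf mg mh f0 g0 h0 f1 g1 f1' g1' fi gi fK gK fgh.
rewrite !(layer_cake (@lebesgue_measure R))//.
have mlev (k : measurableTypeR R -> R) : measurable_fun setT k ->
    forall u, measurable [set x | (u < k x)%R].
  move=> mk u; rewrite (_ : mkset _ = k @^-1` `]u, +oo[%classic).
    exact: measurable_preimage.
  by apply/seteqP; split => x/=; rewrite in_itv/= andbT.
have mlev' (k : measurableTypeR R -> R) : measurable_fun setT k ->
    measurable_fun setT (fun u : R => lebesgue_measure [set x | (u < k x)%R]).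
  move=> mk.
  pose C := (fun p : measurableTypeR R * measurableTypeR R => (p.2 < k p.1)%R) @^-1` [set true].
  have mC : measurable C.
    apply: (@measurable_preimage _ _ _ _
      (fun p : measurableTypeR R * measurableTypeR R => (p.2 < k p.1)%R)) => //.
    by apply: measurable_fun_ltr => //; exact: measurableT_comp.
  have := measurable_fun_ysection (@lebesgue_measure R) mC.
  by apply: eq_measurable_fun => u _; rewrite /= ysectionE.
have l0' : (0 <= l)%R by exact: ltW.
have l1' : (0 <= 1 - l)%R by rewrite subr_ge0 ltW.
rewrite -!ge0_integralZl_EFin//.
rewrite -ge0_integralD//; try (by move=> *; apply: mule_ge0 => //; rewrite lee_fin);
  try (by apply: measurable_funTS; apply: measurable_funeM; exact: mlev').
apply: ge0_le_integral => //.
- by move=> u _; apply: adde_ge0; apply: mule_ge0 => //; rewrite lee_fin.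
- by apply: measurable_funTS; apply: emeasurable_funD; apply: measurable_funeM; exact: mlev'.
- by apply: measurable_funTS; exact: mlev'.
move=> u; rewrite /= in_itv/= andbT => u0.
have [u1|u1] := ltP u 1%R; last first.
  rewrite [X in _ * lebesgue_measure X + _](_ : _ = set0); last first.
    by apply/seteqP; split => // x/= ux; have := lt_le_trans ux (f1 x); rewrite ltNge u1.
  rewrite [X in _ + _ * lebesgue_measure X](_ : _ = set0); last first.
    by apply/seteqP; split => // x/= ux; have := lt_le_trans ux (g1 x); rewrite ltNge u1.
  by rewrite !measure0 !mule0 adde0.
apply: (@interval_sum_measure _ _ _ K) => //.
- exact: fi.
- exact: gi.
- exact: f1'.
- exact: g1'.
- by move=> s us; apply: fK; exact: lt_trans us.
- by move=> s us; apply: gK; exact: lt_trans us.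
- exact: mlev.
- exact: mlev.
- exact: mlev.
- by move=> s t; exact: fgh.
all: by apply: measurable_funTS; exact: mlev'.
Qed.

End brunn_minkowski.

Section brunn_minkowski.
Context {R : realType}.

Definition cvx n (A : set 'rV[R]_n) := forall x y t, A x -> A y -> 0 <= t -> t <= 1 ->
  A ((1 - t) *: x + t *: y).

Definition slice n (A : set 'rV[R]_n.+1) (s : measurableTypeR R) : set 'rV[R]_n :=
  [set v | A (rV_cons (s, v))].

Lemma rV_consDZ n (a b s t : R) (u v : 'rV[R]_n) :
  rV_cons (a * s + b * t, a *: u + b *: v) =
  a *: rV_cons (s : measurableTypeR R, u) + b *: rV_cons (t : measurableTypeR R, v).
Proof.
have E m (x y : 'rV[R]_m) j : (a *: x + b *: y) ord0 j = a * x ord0 j + b * y ord0 j.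
  by rewrite !mxE.
apply/rowP => i; rewrite E; case: (unliftP ord0 i) => [j ->|->].
  by rewrite !rV_consS E.
by rewrite !rV_cons0.
Qed.

Lemma measurable_slice n (A : set 'rV[R]_n.+1) s : measurable A -> measurable (slice A s).
Proof.
move=> mA; have := measurable_xsection s
  (measurable_preimage (@measurable_rV_cons R n) mA).
by rewrite xsectionE.
Qed.

Lemma measurable_fun_slice n (A : set 'rV[R]_n.+1) : measurable A ->
  measurable_fun setT (fun s => lebesgue_rV n (slice A s)).
Proof.
move=> mA; have := measurable_fun_xsection (lebesgue_rV n)
  (measurable_preimage (@measurable_rV_cons R n) mA).
by apply: eq_measurable_fun => s _; rewrite /= xsectionE.
Qed.

Lemma lebesgue_rV_slice n (A : set 'rV[R]_n.+1) : measurable A ->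
  lebesgue_rV n.+1 A = (\int[@lebesgue_measure R]_s lebesgue_rV n (slice A s))%E.
Proof.
move=> mA; apply: eq_integral => s _; by rewrite /= xsectionE.
Qed.

Lemma bdd_slice n (A : set 'rV[R]_n.+1) s (N : R) : bdd N A -> bdd N (slice A s).
Proof. by move=> bA v Av i; have := bA _ Av (lift ord0 i); rewrite rV_consS. Qed.

Lemma bdd_slice0 n (A : set 'rV[R]_n.+1) s (N : R) : bdd N A -> slice A s !=set0 -> `|s| <= N.
Proof. by move=> bA [v Av]; have := bA _ Av ord0; rewrite rV_cons0. Qed.

Lemma expR_convex (l x y : R) : 0 <= l -> l <= 1 ->
  expR ((1 - l) * x + l * y) <= (1 - l) * expR x + l * expR y.
Proof.
move=> l0 l1; set m := (1 - l) * x + l * y.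
have bd z : expR m * (1 + (z - m)) <= expR z.
  have -> : expR z = expR m * expR (z - m) by rewrite -expRD subrKC.
  by rewrite ler_pM2l ?expR_gt0// expR_ge1Dx.
have := ler_wpM2l l0 (bd y).
have l1' : 0 <= 1 - l by rewrite subr_ge0.
have := ler_wpM2l l1' (bd x).
set E := expR m => h1 h2; apply: le_trans (lerD h1 h2).
by rewrite le_eqVlt; apply/orP; left; apply/eqP; rewrite /m; ring.
Qed.

(** Multiplicative form; passing the volumes as [expR] of lower bounds avoids logarithms of 0. In
    the induction on the dimension, the hypothesis applied to slices shows that the slice volumes
    satisfy the assumptions of [prekopa_leindler_sup1]. *)
Theorem brunn_minkowski n (A B C : set 'rV[R]_n) (N l a b : R) :
  0 < l -> l < 1 -> cvx A -> cvx B ->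
  measurable A -> measurable B -> measurable C ->
  bdd N A -> bdd N B -> bdd N C ->
  (forall x y, A x -> B y -> C ((1 - l) *: x + l *: y)) ->
  ((expR a)%:E <= lebesgue_rV n A)%E -> ((expR b)%:E <= lebesgue_rV n B)%E ->
  ((expR ((1 - l) * a + l * b))%:E <= lebesgue_rV n C)%E.
Proof.
elim: n A B C l a b => [|n IH] A B C l a b l0 l1 cA cB mA mB mC bA bB bC ABC Aa Bb.
  (* In dimension 0 the measure is the Dirac mass at the only point. *)
  have H (D : set 'rV[R]_0) c : ((expR c)%:E <= lebesgue_rV 0 D)%E -> D 0 /\ c <= 0.
    rewrite /= diracE; have [D0|nD0] := pselect (D 0).
      rewrite mem_set//= lee_fin => c1; split => //.
      by rewrite -(@ler_expR R) expR0.
    by rewrite memNset//= lee_fin leNgt expR_gt0.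
  have [A0 a0] := H _ _ Aa; have [B0 b0] := H _ _ Bb.
  have C0 : C 0 by have := ABC _ _ A0 B0; rewrite !scaler0 addr0.
  rewrite /= diracE mem_set//= lee_fin expR_le1.
  have l1' : 0 <= 1 - l by rewrite subr_ge0 ltW.
  have := mulr_ge0_le0 l1' a0; have := mulr_ge0_le0 (ltW l0) b0.
  by move=> h1 h2; lra.
pose phi (D : set 'rV[R]_n.+1) s := fine (lebesgue_rV n (slice D s)).
have phiE D s : measurable D -> bdd N D -> lebesgue_rV n (slice D s) = (phi D s)%:E.
  move=> mD bD; rewrite /phi fineK//.
  by apply: (@bdd_fin_num _ _ N); [exact: measurable_slice|exact: bdd_slice].
have mphi D : measurable D -> measurable_fun setT (phi D).
  by move=> mD; apply: measurableT_comp => //; exact: measurable_fun_slice.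
have phi0 D s : 0 <= phi D s by rewrite fine_ge0.
have intphi D : measurable D -> bdd N D ->
    lebesgue_rV n.+1 D = (\int[@lebesgue_measure R]_s (phi D s)%:E)%E.
  by move=> mD bD; rewrite lebesgue_rV_slice//; apply: eq_integral => s _; rewrite phiE.
have phiN D s : measurable D -> bdd N D -> 0 < phi D s -> `|s| <= N.
  move=> mD bD phis; apply: (@bdd_slice0 _ D) => //; apply/set0P/eqP => Ds.
  by move: phis; rewrite /phi Ds measure0/= ltxx.
(* The induction hypothesis inside a single convex set: the smaller of two slice volumes bounds
   every slice volume in between. *)
have phiI D : cvx D -> measurable D -> bdd N D ->
    forall u, 0 < u -> is_interval [set s | u < phi D s].
  move=> cD mD bD u u0 x y /= ux uy z /andP[xz zy].
  have [->//|xz'] := eqVneq z x.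
  have [->//|zy'] := eqVneq z y.
  have xz1 : x < z by rewrite lt_neqAle eq_sym xz'.
  have zy1 : z < y by rewrite lt_neqAle zy'.
  pose t := (z - x) / (y - x).
  have yx : 0 < y - x by rewrite subr_gt0 (lt_trans xz1).
  have t0 : 0 < t by rewrite divr_gt0// subr_gt0.
  have t1 : t < 1 by rewrite ltr_pdivrMr// mul1r ltrD2r.
  have zE : z = (1 - t) * x + t * y.
    by rewrite /t; field; rewrite gt_eqF.
  set c := ln (Num.min (phi D x) (phi D y)).
  have m0 : 0 < Num.min (phi D x) (phi D y) by rewrite lt_min !(lt_trans u0).
  have := IH (slice D x) (slice D y) (slice D z) t c c t0 t1.
  rewrite -mulrDl subrK mul1r (phiE _ z)// !phiE// !lee_fin lnK ?posrE// => /(_ _ _ _ _ _ _ _ _ _ _ _).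
  move=> H; apply: (@lt_le_trans _ _ (Num.min (phi D x) (phi D y))); first by rewrite lt_min ux uy.
  apply: H; rewrite ?ge_min ?lexx ?orbT//; try exact: measurable_slice; try exact: bdd_slice.
  - move=> v w s Dv Dw s0 s1; rewrite /slice/=.
    have := cD _ _ s Dv Dw s0 s1; rewrite -rV_consDZ.
    by rewrite -mulrDl subrK mul1r.
  - move=> v w s Dv Dw s0 s1; rewrite /slice/=.
    have := cD _ _ s Dv Dw s0 s1; rewrite -rV_consDZ.
    by rewrite -mulrDl subrK mul1r.
  - move=> v w Dv Dw; rewrite /slice/= zE rV_consDZ.
    by apply: cD => //; exact: ltW.
have phiS D c : measurable D -> bdd N D -> ((expR c)%:E <= lebesgue_rV n.+1 D)%E ->
    exists2 M, 0 < M & (forall s, phi D s <= M) /\ (forall u, u < M -> exists s, u < phi D s).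
  move=> mD bD Dc; have [s phis] : exists s, 0 < phi D s.
    apply: contrapT => /forallNP nphi.
    have := Dc; rewrite (intphi D)// integral0_eq ?lee_fin ?leNgt ?expR_gt0// => s _.
    by congr EFin; apply/eqP; rewrite eq_le phi0 leNgt andbT; apply/negP; exact: nphi.
  have bd t : phi D t <= (`|N| + `|N|) ^+ n.
    rewrite -lee_fin -phiE//; apply: bdd_le => //; first exact: measurable_slice.
    by apply: bdd_slice; apply: bddW bD; exact: ler_norm.
  have sD : has_sup (range (phi D)).
    by split; [exists (phi D s), s|exists ((`|N| + `|N|) ^+ n) => _ [t _ <-]].
  have ubD t : phi D t <= sup (range (phi D)) by apply: ub_le_sup; [exact: sD.2|exists t].
  exists (sup (range (phi D))); first exact: lt_le_trans (ubD s).
  split => // u /(sup_gt sD.1)[_ [t _ <-] ut]; by exists t.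
have [M M0 [AM AM']] := phiS _ _ mA bA Aa.
have [M' M'0 [BM BM']] := phiS _ _ mB bB Bb.
(* Division by [M] and [M'] normalises the slice volumes of [A] and [B] to supremum 1; their
   weighted geometric mean [W] is the matching factor for [C]. *)
pose W := expR ((1 - l) * ln M + l * ln M').
have W0 : 0 < W := expR_gt0 _.
have l1' : 0 < 1 - l by rewrite subr_gt0.
have scal D c : 0 < c -> measurable D -> bdd N D ->
    lebesgue_rV n.+1 D = (c%:E * \int[@lebesgue_measure R]_s (phi D s / c)%:E)%E.
  move=> c0 mD bD; rewrite -ge0_integralZl_EFin//; last 3 first.
  - by move=> s _; rewrite lee_fin divr_ge0// ltW.
  - by apply/measurable_EFinP; apply: measurable_funM => //; exact: mphi.
  - exact: ltW.
  rewrite (intphi D)//; apply: eq_integral => s _.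
  by rewrite -EFinM mulrC divfK// gt_eqF.
have key : ((1 - l)%:E * \int[@lebesgue_measure R]_s (phi A s / M)%:E +
    l%:E * \int[@lebesgue_measure R]_s (phi B s / M')%:E <=
    \int[@lebesgue_measure R]_s (phi C s / W)%:E)%E.
  have mdiv D c : measurable D -> measurable_fun setT (fun s => phi D s / c).
    by move=> mD; apply: measurable_funM => //; exact: mphi.
  have lev D c u : 0 < c -> [set s | u < phi D s / c] = [set s | u * c < phi D s].
    by move=> c0; apply/seteqP; split => s /=; rewrite ltr_pdivlMr.
  have supp D c : 0 < c -> measurable D -> bdd N D -> forall s, 0 < phi D s / c -> `|s| <= N.
    move=> c0 mD bD s; rewrite pmulr_lgt0 ?invr_gt0//; exact: phiN.
  have sup1 D c : 0 < c -> (forall u, u < c -> exists s, u < phi D s) ->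
      forall u, u < 1 -> exists s, u < phi D s / c.
    move=> c0 H u u1; have [s us] : exists s, u * c < phi D s.
      by apply: H; rewrite gtr_pMl.
    by exists s; rewrite ltr_pdivlMr.
  apply: (@prekopa_leindler_sup1 _ _ _ _ _ N) => //; try exact: mdiv; try exact: supp; try exact: sup1.
  - by move=> s; rewrite divr_ge0// ltW.
  - by move=> s; rewrite divr_ge0// ltW.
  - by move=> s; rewrite divr_ge0// ltW.
  - by move=> s; rewrite ler_pdivrMr// mul1r.
  - by move=> s; rewrite ler_pdivrMr// mul1r.
  - by move=> u u0; rewrite lev//; apply: phiI => //; rewrite mulr_gt0.
  - by move=> u u0; rewrite lev//; apply: phiI => //; rewrite mulr_gt0.
  move=> u s t u0; rewrite !ltr_pdivlMr// => us ut.
  have phis : 0 < phi A s by rewrite (lt_trans _ us)// mulr_gt0.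
  have phit : 0 < phi B t by rewrite (lt_trans _ ut)// mulr_gt0.
  apply: (@lt_le_trans _ _ (expR ((1 - l) * ln (phi A s) + l * ln (phi B t)))).
    rewrite -(lnK u0) -expRD ltr_expR.
    have h1 : ln u + ln M < ln (phi A s) by rewrite -lnM ?posrE// ltr_ln ?posrE ?mulr_gt0.
    have h2 : ln u + ln M' < ln (phi B t) by rewrite -lnM ?posrE// ltr_ln ?posrE ?mulr_gt0.
    have := ltrD (_ : (1 - l) * (ln u + ln M) < (1 - l) * ln (phi A s))
      (_ : l * (ln u + ln M') < l * ln (phi B t)).
    rewrite !ltr_pM2l// => /(_ h1 h2); apply: le_lt_trans.
    by rewrite le_eqVlt; apply/orP; left; apply/eqP; ring.
  rewrite -lee_fin -phiE//.
  apply: (IH (slice A s) (slice B t) (slice C _)) => //; try exact: measurable_slice; try exact: bdd_slice.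
  - move=> v w x Dv Dw x0 x1; rewrite /slice/=.
    by have := cA _ _ x Dv Dw x0 x1; rewrite -rV_consDZ -mulrDl subrK mul1r.
  - move=> v w x Dv Dw x0 x1; rewrite /slice/=.
    by have := cB _ _ x Dv Dw x0 x1; rewrite -rV_consDZ -mulrDl subrK mul1r.
  - by move=> v w Av Bw; rewrite /slice/= rV_consDZ; exact: ABC.
  - by rewrite phiE// lnK.
  - by rewrite phiE// lnK.
have divle D c d : 0 < c -> measurable D -> bdd N D -> ((expR d)%:E <= lebesgue_rV n.+1 D)%E ->
    ((expR (d - ln c))%:E <= \int[@lebesgue_measure R]_s (phi D s / c)%:E)%E.
  move=> c0 mD bD; rewrite (scal D c)// => h.
  rewrite -(@lee_pmul2l _ c%:E)// ?lte_fin// -EFinM (_ : (c * _)%R = expR d)//.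
  by rewrite expRB lnK ?posrE// mulrC divfK// gt_eqF.
rewrite (scal C W)//.
(* Once [W] is split off, convexity of the exponential leads from the arithmetic mean back to the
   geometric one. *)
apply: (@le_trans _ _ (W%:E * ((1 - l) * expR (a - ln M) + l * expR (b - ln M'))%:E)%E).
  have -> : (1 - l) * a + l * b = ((1 - l) * ln M + l * ln M') +
      ((1 - l) * (a - ln M) + l * (b - ln M')) by ring.
  by rewrite (expRD (_ * ln M + _)) -/W -EFinM lee_fin  ler_pM2l//; apply: expR_convex; exact: ltW.
apply: lee_wpmul2l; first by rewrite lee_fin ltW.
apply: le_trans key; rewrite EFinD !EFinM; apply: leeD;
  by apply: lee_wpmul2l; [rewrite lee_fin ltW|exact: divle].
Qed.

End brunn_minkowski.

(** * Subgradients *)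

Section subgradient.
Context {R : realType}.

Lemma dotv_cons n (a s : R) (u v : 'rV[R]_n) :
  dotv (rV_cons (a : measurableTypeR R, u)) (rV_cons (s : measurableTypeR R, v)) = a * s + dotv u v.
Proof.
rewrite /dotv big_ord_recl !rV_cons0; congr (_ + _).
by apply: eq_bigr => i _; rewrite !rV_consS.
Qed.

Lemma rV_consE n (s : R) (v : 'rV[R]_n) : rV_cons (s : measurableTypeR R, v) =
  rV_cons (0 : measurableTypeR R, v) + s *: rV_cons (1 : measurableTypeR R, 0).
Proof.
rewrite -[X in X + _]scale1r -rV_consDZ.
by rewrite mulr1 mul1r add0r scale1r scaler0 addr0.
Qed.

(** Induction on the dimension: a functional [u'] dominated on a hyperplane extends to the direction
    [e] as soon as some slope lies above all lower bounds coming from [- e] and below all upper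
    bounds coming from [+ e]. *)
Lemma hahn_banach n (p : 'rV[R]_n -> R) :
  (forall x y, p (x + y) <= p x + p y) ->
  (forall c x, 0 < c -> p (c *: x) = c * p x) ->
  exists u, forall x, dotv u x <= p x.
Proof.
elim: n p => [|n IH] p pD pZ.
  have p0 : p 0 = 0.
    have := pZ 2 0 (ltr0n _ 2); rewrite scaler0 => h; lra.
  by exists 0 => x; rewrite (thinmx0 x) dotv0 p0.
pose j (v : 'rV[R]_n) := rV_cons (0 : measurableTypeR R, v).
pose e := rV_cons (1 : measurableTypeR R, 0 : 'rV[R]_n).
have jDZ a b v w : j (a *: v + b *: w) = a *: j v + b *: j w.
  by rewrite -rV_consDZ !mulr0 addr0.
have jD v w : j (v + w) = j v + j w.
  by have := jDZ 1 1 v w; rewrite !scale1r.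
have jZ c v : j (c *: v) = c *: j v.
  by have := jDZ c 0 v 0; rewrite !scale0r !addr0.
have [|c x c0|u' u'P] := IH (p \o j).
- by move=> x y /=; rewrite jD pD.
- by rewrite /= jZ pZ.
pose S := range (fun v => dotv u' v - p (j v - e)).
have key v w : dotv u' v - p (j v - e) <= p (j w + e) - dotv u' w.
  have : dotv u' v + dotv u' w <= p (j v - e) + p (j w + e).
    rewrite -dotvDr; apply: (le_trans (u'P _)) => /=.
    rewrite (_ : j (v + w) = (j v - e) + (j w + e)); first exact: pD.
    by rewrite jD addrACA addNr addr0.
  lra.
have hS : has_sup S.
  split; first by exists (dotv u' 0 - p (j 0 - e)), 0.
  by exists (p (j 0 + e) - dotv u' 0) => _ [v _ <-]; exact: key.
pose a := sup S.
have aS v : dotv u' v - p (j v - e) <= a by apply: ub_le_sup; [exact: hS.2|exists v].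
have Sa w : a <= p (j w + e) - dotv u' w.
  by apply: ge_sup; [exact: hS.1|move=> _ [v _ <-]; exact: key].
exists (rV_cons (a : measurableTypeR R, u')) => x.
have [s [v ->]] : exists s v, x = rV_cons (s : measurableTypeR R, v).
  exists (x ord0 ord0), (\row_i x ord0 (lift ord0 i)); apply/rowP => i.
  by case: (unliftP ord0 i) => [k ->|->]; rewrite ?rV_consS ?rV_cons0//= mxE.
rewrite dotv_cons rV_consE -/(j v) -/e.
(* Homogeneity rescales the [e]-component to -1 or 1, where the two families of bounds on [a]
   apply. *)
have [s0|s0|->] := ltgtP s 0; last by rewrite mulr0 add0r scale0r addr0; exact: u'P.
  have s1 : 0 < - s by rewrite oppr_gt0.
  have -> : j v + s *: e = (- s) *: (j ((- s)^-1 *: v) - e).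
    by rewrite jZ scalerBr scalerA mulfV ?gt_eqF// scale1r scaleNr opprK.
  rewrite pZ//; have := ler_wpM2l (ltW s1) (aS ((- s)^-1 *: v)).
  rewrite dotvZr mulrBr mulrA mulfV ?gt_eqF// mul1r => h; lra.
have -> : j v + s *: e = s *: (j (s^-1 *: v) + e).
  by rewrite jZ scalerDr scalerA mulfV ?gt_eqF// scale1r.
rewrite pZ//; have := ler_wpM2l (ltW s0) (Sa (s^-1 *: v)).
rewrite dotvZr mulrBr [X in _ - X]mulrA mulfV ?gt_eqF// mul1r => h; lra.
Qed.

(** The infimum [q w] of the difference quotients along [w] is the directional derivative of [f] at
    0, obtained without a limit. It is sublinear by convexity, so Hahn-Banach yields a linear
    minorant. *)
Lemma subgradient n (O : set 'rV[R]_n) (f : 'rV[R]_n -> R) :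
  (forall x, exists2 e, 0 < e & O (e *: x)) -> O 0 -> cvx O ->
  (forall x y t, O x -> O y -> 0 <= t -> t <= 1 ->
     f ((1 - t) *: x + t *: y) <= (1 - t) * f x + t * f y) ->
  exists u, forall y, O y -> f 0 + dotv u y <= f y.
Proof.
move=> absO O0 cO cf.
pose Q w := [set (f (t *: w) - f 0) / t | t in [set t | 0 < t /\ O (t *: w)]].
have Q0 w : Q w !=set0.
  by have [e e0 Oe] := absO w; exists ((f (e *: w) - f 0) / e), e.
have conv s t x y : 0 < s -> 0 < t -> O x -> O y ->
    f ((s / (s + t)) *: x + (t / (s + t)) *: y) <= (s * f x + t * f y) / (s + t).
  move=> s0 t0 Ox Oy; have st : s + t != 0 by rewrite gt_eqF// addr_gt0.
  have -> : s / (s + t) = 1 - t / (s + t) by field.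
  have := cf x y (t / (s + t)) Ox Oy; rewrite divr_ge0 ?ler_pdivrMr ?addr_gt0//; try lra.
  move=> /(_ isT) H; apply: le_trans (H _) _; first lra.
  by rewrite le_eqVlt; apply/orP; left; apply/eqP; field.
have lbQ w : has_lbound (Q w).
  (* A quotient in the opposite direction bounds those along [w] from below, by convexity through
     0. *)
  have [s s0 Os] := absO (- w); exists (- ((f (s *: - w) - f 0) / s)).
  move=> _ [t [t0 Ot] <-].
  have := conv s t _ _ s0 t0 Ot Os.
  rewrite scalerN scalerN !scalerA (_ : s / (s + t) * t = t / (s + t) * s); last by ring.
  rewrite subrr ler_pdivlMr ?addr_gt0// => H.
  rewrite -mulNr ler_pdivrMr// mulrAC ler_pdivlMr//; lra.
pose q w := inf (Q w).
have qle w y : Q w y -> q w <= y by move=> Qy; apply: ge_inf.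
have lbq w z : (forall y, Q w y -> z <= y) -> z <= q w.
  by move=> H; apply: lb_le_inf.
have [| |u uP] := @hahn_banach n q.
- move=> x y; rewrite -lerBlDr; apply: (lbq) => _ [s [s0 Os] <-].
  rewrite lerBlDr -lerBlDl; apply: (lbq) => _ [t [t0 Ot] <-].
  (* With this [r] the point [r (x + y)] is the convex combination of [s x] and [t y] with weights
     [t / (s + t)] and [s / (s + t)]. *)
  rewrite lerBlDr; pose r := (s * t) / (s + t).
  have st0 : 0 < s + t by rewrite addr_gt0.
  have stn : s + t != 0 by rewrite gt_eqF.
  have r0 : 0 < r by rewrite divr_gt0 ?mulr_gt0.
  have rE : r *: (x + y) = (t / (t + s)) *: (s *: x) + (s / (t + s)) *: (t *: y).
    by rewrite scalerDr !scalerA /r; congr (_ *: _ + _ *: _); rewrite (addrC t); ring.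
  have Or : O (r *: (x + y)).
    rewrite rE (_ : t / (t + s) = 1 - s / (t + s)); last by field; rewrite addrC.
    apply: cO => //; first by rewrite divr_ge0// ltW// addrC.
    by rewrite ler_pdivrMr ?addr_gt0// mul1r lerDr ltW.
  apply: (@le_trans _ _ ((f (r *: (x + y)) - f 0) / r)).
    by apply: qle; exists r.
  have := conv t s _ _ t0 s0 Os Ot; rewrite -rE ler_pdivlMr ?addr_gt0// => H.
  rewrite ler_pdivrMr//.
  have -> : ((f (t *: y) - f 0) / t + (f (s *: x) - f 0) / s) * r =
      (t * (f (s *: x) - f 0) + s * (f (t *: y) - f 0)) / (s + t).
    by rewrite /r; field; rewrite !gt_eqF.
  by rewrite ler_pdivlMr//; lra.
- have qZ c x : 0 < c -> q (c *: x) <= c * q x.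
    move=> c0; rewrite mulrC -ler_pdivrMr//; apply: (lbq) => _ [t [t0 Ot] <-].
    rewrite ler_pdivrMr//; apply: qle; exists (t / c).
      by split; [rewrite divr_gt0|rewrite scalerA divfK// gt_eqF].
    by rewrite scalerA divfK ?gt_eqF//; field; rewrite !gt_eqF.
  move=> c x c0; apply/eqP; rewrite eq_le qZ//=.
  have := qZ c^-1 (c *: x); rewrite invr_gt0 scalerA mulVf ?gt_eqF// scale1r => /(_ c0).
  by rewrite ler_pdivlMl.
exists u => y Oy; rewrite -lerBrDl; apply: (le_trans (uP y)).
by apply: qle; exists 1; [split; rewrite ?scale1r|rewrite scale1r divr1].
Qed.

End subgradient.

(** * Polytopes and their facets *)

Section polytopes.
Context {R : realType}.

Lemma convex_setP n (A : set 'rV[R]_n) : @convex_set R 'rV[R]_n A <-> cvx A.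
Proof.
split=> [cA x y t Ax Ay t0 t1|cA x y l].
  have := cA y x (Itv01 t0 t1); rewrite !inE => /(_ Ay Ax).
  by rewrite /conv/= addrC.
rewrite !inE => Ax Ay; rewrite /conv/= addrC.
by apply: cA; rewrite ?ge0 ?le1.
Qed.

Lemma cvx_sum n (A : set 'rV[R]_n) : cvx A -> forall m (x : 'I_m -> 'rV[R]_n) (w : 'I_m -> R),
  (forall i, A (x i)) -> (forall i, 0 <= w i) -> \sum_i w i = 1 ->
  A (\sum_i w i *: x i).
Proof.
move=> cA; elim => [|m IH] x w Ax w0.
  by rewrite big_ord0 => /eqP; rewrite eq_sym oner_eq0.
rewrite !big_ord_recl; set s := \sum_(i < m) _ => ws.
have s0 : 0 <= s by apply: sumr_ge0.
have [sE|sn0] := eqVneq s 0.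
  have wi0 i : w (lift ord0 i) = 0.
    have /eqP := sE; rewrite psumr_eq0// => /allP/(_ i (mem_index_enum _))/eqP; exact.
  move: ws; rewrite sE addr0 => ->; rewrite scale1r big1 ?addr0// => i _.
  by rewrite wi0 scale0r.
have -> : \sum_(i < m) w (lift ord0 i) *: x (lift ord0 i) =
    s *: \sum_(i < m) (w (lift ord0 i) / s) *: x (lift ord0 i).
  rewrite scaler_sumr; apply: eq_bigr => i _.
  by rewrite scalerA mulrC divfK.
have -> : w ord0 = 1 - s by rewrite -ws addrK.
apply: cA => //; last by rewrite -ws lerDr.
apply: (IH (fun i => x (lift ord0 i)) (fun i => w (lift ord0 i) / s)) => //.
  by move=> i; rewrite divr_ge0.
by rewrite -mulr_suml divff.
Qed.

Definition simplex m := [set w : 'rV[R]_m | (forall i, 0 <= w ord0 i) /\ \sum_i w ord0 i = 1].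

(** With the points stored as the rows of a matrix, the hull is a linear image of the simplex;
    compactness of polytopes rests on this. *)
Lemma conv_hull_rows m n (s : 'M[R]_(m, n)) :
  conv_hull (range (fun i => row i s)) = [set w *m s | w in @simplex m].
Proof.
apply/seteqP; split.
  apply: smallest_sub.
    apply/(convex_setP _).2 => _ _ t [v [v0 v1] <-] [w [w0 w1] <-] t0 t1.
    exists ((1 - t) *: v + t *: w); last by rewrite mulmxDl !scalemxAl.
    split => [i|]; first by rewrite !mxE addr_ge0// mulr_ge0// subr_ge0.
    under eq_bigr do rewrite !mxE.
    by rewrite big_split/= -!mulr_sumr v1 w1 !mulr1 subrK.
  move=> _ [i _ <-]; exists (delta_mx 0 i); last by rewrite rowE.
  split => [j|]; first by rewrite mxE ler0n.
  rewrite (bigD1 i)//= mxE !eqxx big1 ?addr0// => j ji.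
  by rewrite mxE (negbTE ji) andbF.
move=> _ [w [w0 w1] <-] A [cA sA]; rewrite mulmx_sum_row.
have {}cA := (convex_setP A).1 cA.
by apply: cvx_sum => // i; apply: sA; exists i.
Qed.

Lemma continuous_sum (T : topologicalType) (V : normedModType R) (I : Type) (r : seq I)
  (f : I -> T -> V) : (forall i, continuous (f i)) ->
  continuous (fun x => \sum_(i <- r) f i x).
Proof.
move=> cf; elim: r => [|i r IH] x.
  by under eq_fun do rewrite big_nil; exact: cvg_cst.
by under eq_fun do rewrite big_cons; apply: continuousD; [exact: cf|exact: IH].
Qed.

Lemma continuous_mulmx m n (s : 'M[R]_(m, n)) :
  continuous (fun w : 'rV[R]_m => w *m s).
Proof.
under eq_fun do rewrite mulmx_sum_row.
apply: continuous_sum => i x; apply: cvgZr_tmp.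
  exact: (nbhs_filter x).
exact: coord_continuous.
Qed.

Lemma continuous_dotv n (u : 'rV[R]_n) : continuous (dotv u : 'rV[R]_n -> R).
Proof.
apply: (@continuous_sum _ R^o) => i x; apply: (@cvgZl_tmp _ R^o).
  exact: (nbhs_filter x).
exact: coord_continuous.
Qed.

Lemma closed_preimage n (f : 'rV[R]_n -> R) (D : set R) : continuous f -> closed D ->
  closed (f @^-1` D).
Proof. by move=> cf cD; apply: preimage_closed => // x _; exact: cf. Qed.

Lemma simplex_compact m : compact (@simplex m).
Proof.
pose K := [set v : 'rV[R]_m | forall i, v ord0 i \in `[(0 : R), (1 : R)]].
have cK : compact K.
  apply: (@rV_compact _ _ (fun=> `[(0 : R), (1 : R)]%classic)) => _.
  exact: segment_compact.
apply: (@subclosed_compact _ _ K) => //; last first.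
  move=> w [w0 w1] i; rewrite in_itv/= w0 -w1 (bigD1 i)//= lerDl.
  exact: sumr_ge0.
rewrite (_ : @simplex m = (\bigcap_(i in [set: 'I_m])
    ((fun w : 'rV[R]_m => w ord0 i : R) @^-1` [set x | 0 <= x])) `&`
   ((fun w : 'rV[R]_m => \sum_i w ord0 i : R) @^-1` [set x | x = 1])).
  apply: closedI.
    apply: closed_bigI => i _; apply: closed_preimage; last exact: closed_ge.
    exact: coord_continuous.
  apply: closed_preimage; last exact: closed_eq.
  apply: (@continuous_sum _ R^o) => i; exact: coord_continuous.
by apply/seteqP; split => w [h1 h2]; split => //= i; [move=> _|]; exact: h1.
Qed.

Lemma polytope_rows n (P : set 'rV[R]_n) : polytope P ->
  exists m (s : 'M[R]_(m, n)), P = [set w *m s | w in @simplex m].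
Proof.
move=> [S /finite_seqP[r ->] ->].
exists (size r), (\matrix_(i < size r) r`_i); rewrite -conv_hull_rows; congr conv_hull.
apply/seteqP; split => x /=.
  by move=> xr; have ir := xr; rewrite -index_mem in ir; exists (Ordinal ir) => //; rewrite rowK nth_index.
by move=> [i _ <-]; rewrite rowK mem_nth.
Qed.

Lemma polytope_compact n (P : set 'rV[R]_n) : polytope P -> compact P.
Proof.
move=> /polytope_rows[m [s ->]]; apply: continuous_compact; last exact: simplex_compact.
apply: continuous_subspaceT; exact: continuous_mulmx.
Qed.

Lemma closed_measurable_rV n (A : set 'rV[R]_n) : closed A -> measurable A.
Proof.
by move=> cA; rewrite -[A]setCK; apply: measurableC; apply: open_measurable_rV; exact: closed_openC.
Qed.

Lemma compact_closed_rV n (A : set 'rV[R]_n) : compact A -> closed A.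
Proof. by apply: compact_closed; exact: norm_hausdorff. Qed.

Lemma compact_bdd n (A : set 'rV[R]_n) : compact A -> exists N, bdd N A.
Proof.
move=> /compact_bounded[N [Nreal NA]]; exists (N + 1) => x Ax i.
have N1 : N < N + 1 by rewrite ltrDl.
apply: le_trans (NA _ N1 x Ax).
rewrite [leRHS]/Num.norm /= mx_normrE; apply/bigmax_geP; right => /=.
by exists (ord0, i).
Qed.

Lemma polytope_cvx n (P : set 'rV[R]_n) : polytope P -> cvx P.
Proof.
by move=> [S _ ->]; apply/convex_setP => x y t; rewrite !inE => Px Py A [cA SA];
  have := cA x y t; rewrite !inE; apply; [exact: Px|exact: Py].
Qed.

Lemma interior_cube n (P : set 'rV[R]_n) : interior P 0 ->
  exists2 e, 0 < e & forall x : 'rV[R]_n, (forall i, `|x ord0 i| < e) -> P x.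
Proof.
move=> /nbhs_ballP[e /= e0 eP]; exists e => // x xe; apply: eP; split => // i j.
by rewrite ord1 /ball/= mxE sub0r normrN.
Qed.

End polytopes.

(** * Finite unions with null overlaps *)

Section finite_sums.
Local Open Scope ereal_scope.
Context {d} {T : measurableType d} {R : realType} (mu : {measure set T -> \bar R}).

Lemma measure_le_sum m (C : 'I_m -> set T) (A : set T) :
  measurable A -> (forall i, measurable (C i)) -> A `<=` \bigcup_i C i ->
  mu A <= \sum_(i < m) mu (C i).
Proof.
move=> mA mC AC.
have sub (r : seq 'I_m) : mu (\big[setU/set0]_(i <- r) C i) <= \sum_(i <- r) mu (C i).
  elim: r => [|i r IH]; first by rewrite !big_nil measure0.
  rewrite !big_cons; apply: (le_trans (measureU2 _ _ _)) => //.
    by apply: bigsetU_measurable.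
  exact: leeD.
apply: le_trans (sub _); apply: le_measure; rewrite ?inE//.
  by apply: bigsetU_measurable.
move=> x /AC[i _ Cx]; rewrite -bigcup_seq; exists i => //=.
exact: mem_index_enum.
Qed.

(** Removing from [C i] its overlap [U i] with the other sets changes no measure and leaves disjoint
    sets. *)
Lemma measure_sum_le m (Q : pred 'I_m) (C : 'I_m -> set T) (A : set T) :
  measurable A -> (forall i, measurable (C i)) -> (forall i, Q i -> C i `<=` A) ->
  (forall i j, i != j -> mu (C i `&` C j) = 0) ->
  \sum_(i < m | Q i) mu (C i) <= mu A.
Proof.
move=> mA mC CA C0.
pose U i := \bigcup_(j in [set j | j != i]) C j.
have mU i : measurable (U i) by apply: fin_bigcup_measurable => //; exact: finite_finset.
have DE i : mu (C i) = mu (C i `\` U i).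
  rewrite (measureDI mu (mC i) (mU i)) [X in _ + X](_ : _ = 0) ?adde0//.
  apply/eqP; rewrite -measure_le0.
  pose G j := if j != i then C i `&` C j else set0.
  apply: (le_trans (@measure_le_sum _ G _ _ _ _)).
  - exact: measurableI.
  - by move=> j; rewrite /G; case: ifP => // _; exact: measurableI.
  - by move=> x [Cix [j /= ji Cjx]]; exists j => //; rewrite /G ji.
  rewrite big1// => j _; rewrite /G; case: ifP => [ji|_]; last exact: measure0.
  by rewrite C0// eq_sym.
under eq_bigr do rewrite DE.
rewrite -measure_bigsetU_ord_cond.
- apply: le_measure; rewrite ?inE//.
    by apply: bigsetU_measurable => i _; exact: measurableD.
  elim/big_ind : _ => [|B B' BA B'A x [/BA|/B'A]|i Qi x [Cx _]] //.
  exact: CA Cx.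
- by move=> i _; exact: measurableD.
apply/trivIsetP => i j _ _ ij; apply/seteqP; split => // x [[Cix nU] [Cjx _]].
by apply: nU; exists j => //=; rewrite eq_sym.
Qed.

End finite_sums.

Section perp.
Context {R : realType} {n : nat}.
Implicit Types u v : 'rV[R]_n.

Definition perp u : {vspace 'rV[R]_n} := lker (linfun (mulmxr u^T : 'rV[R]_n -> 'rV[R]_1)).

Lemma mem_perp u v : (v \in perp u) = (dotv u v == 0).
Proof.
rewrite memv_ker lfunE/= dotvC mulmx_tr_dotv; apply/eqP/eqP => [|->].
  by move=> /matrixP/(_ 0 0); rewrite !mxE eqxx mulr1n.
by apply/matrixP => i j; rewrite !mxE mul0rn.
Qed.

Lemma dim_perp u : u != 0 -> (\dim (perp u)).+1 = n.
Proof.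
move=> u0.
have := limg_ker_dim (linfun (mulmxr u^T : 'rV[R]_n -> 'rV[R]_1)) fullv.
rewrite capfv dimvf dim_matrix mul1r -/(perp u); apply: etrans.
rewrite -addn1; congr (_ + _)%N; apply/esym/eqP; rewrite eqn_leq; apply/andP; split; last first.
  rewrite lt0n dimv_eq0; apply: contraNneq u0 => im0; apply/eqP/dotv_eq0/eqP.
  by rewrite -mem_perp memv_ker -memv0 -im0 memv_img// memvf.
by apply: leq_trans (dimvS (subvf _)) _; rewrite dimvf dim_matrix.
Qed.

End perp.

Section facets.
Context {R : realType} {n : nat}.
Implicit Types (P F : set 'rV[R]_n) (a u x y : 'rV[R]_n).

Lemma affine_hyperplane u (h : R) : affine_set [set x | dotv u x = h].
Proof. by move=> x y t /= xh yh; rewrite dotvDr !dotvZr xh yh; ring. Qed.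

Lemma affine_hull_sub F A : affine_set A -> F `<=` A -> affine_hull F `<=` A.
Proof. exact: smallest_sub. Qed.

(** The face comes with some functional [u] that need not be related to [a]. Dimension n - 1 forces
    its direction space to be all of [perp a], so the supporting hyperplane of [a] is the affine
    hull of [F] and meets [P] in [F] only. Positivity of [h] comes from a small multiple of [a]
    inside [P]. *)
Lemma facet_normal P F a : interior P 0 -> facets P F -> outer_unit_normal P F a ->
  exists h, [/\ 0 < h, P `<=` [set x | dotv a x <= h], a != 0, F !=set0 &
    F = P `&` [set x | dotv a x = h]].
Proof.
move=> /interior_cube[e e0 eP] [[u [h' [Ph' FE]]] [k kn [x0 [L [aff dL]]]]] [sa [h [Ph Fh]]].
have a0 : a != 0.
  apply/eqP => a0; move: sa; rewrite /sphere/= a0 /enorm dotv0 sqrtr0 => /eqP.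
  by rewrite eq_sym oner_eq0.
have aa : 0 < dotv a a.
  rewrite lt_neqAle eq_sym; apply/andP; split; first exact: contra_neq (@dotv_eq0 _ _ a) a0.
  by apply: sumr_ge0 => i _; rewrite -expr2 sqr_ge0.
have h0 : 0 < h.
  pose t := e / (1 + \sum_i `|a ord0 i|).
  have s0 : 0 < 1 + \sum_i `|a ord0 i| by rewrite ltr_pwDl// sumr_ge0.
  have t0 : 0 < t by rewrite divr_gt0.
  have Pta : P (t *: a).
    apply: eP => i; rewrite mxE normrM gtr0_norm// /t mulrAC ltr_pdivrMr// ltr_pM2l//.
    by rewrite (bigD1 i)//= addrCA ltrDl ltr_pwDl// sumr_ge0.
  by have := Ph _ Pta; rewrite /= dotvZr; apply: lt_le_trans; rewrite mulr_gt0.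
have F0 : F !=set0.
  apply/set0P/eqP => FE0; move: aff; rewrite FE0 => aff.
  have : affine_hull (set0 : set 'rV[R]_n) x0.
    by rewrite aff; exists 0; rewrite ?addr0//= mem0v.
  by move=> /(_ set0); apply; split => // ? ? ?.
exists h; split => //.
have x0h : dotv a x0 = h.
  have : affine_hull F x0 by rewrite aff; exists 0; rewrite ?addr0//= mem0v.
  by move=> /(affine_hull_sub (@affine_hyperplane a h) Fh).
have LE : L = perp a.
  apply/eqP; rewrite eqEdim; apply/andP; split.
    apply/subvP => v vL; rewrite mem_perp.
    have : affine_hull F (x0 + v) by rewrite aff; exists v.
    move=> /(affine_hull_sub (@affine_hyperplane a h) Fh)/=.
    by rewrite dotvDr x0h => /eqP; rewrite -subr_eq0 addrAC subrr add0r.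
  by rewrite -ltnS dim_perp// dL kn.
apply/seteqP; split => x.
  by move=> Fx; split; [move: Fx; rewrite FE => -[]|exact: Fh].
move=> [Px ax]; rewrite FE; split => //.
have : affine_hull F x.
  rewrite aff; exists (x - x0); last by rewrite addrC subrK.
  by rewrite /= LE mem_perp dotvDr dotvNr x0h ax subrr.
by apply: affine_hull_sub; [exact: affine_hyperplane|rewrite FE => ? []].
Qed.

Lemma facet_coneE F : cvx F -> F !=set0 ->
  facet_cone F = [set x | exists t y, [/\ 0 <= t, t <= 1, F y & x = t *: y]].
Proof.
move=> cF [y0 Fy0]; apply/seteqP; split.
  apply: smallest_sub; last first.
    move=> x [->|Fx]; first by exists 0, y0; rewrite scale0r.
    by exists 1, x; rewrite scale1r.
  apply/convex_setP => _ _ s [t [y [t0 t1 Fy ->]]] [t' [y' [t'0 t'1 Fy' ->]]] s0 s1.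
  have s1' : 0 <= 1 - s by rewrite subr_ge0.
  pose c := (1 - s) * t + s * t'.
  have c0 : 0 <= c by rewrite addr_ge0// mulr_ge0.
  have c1 : c <= 1.
    by rewrite (_ : 1 = (1 - s) * 1 + s * 1) ?lerD ?ler_wpM2l//; ring.
  have [cE|cn0] := eqVneq c 0.
    have /eqP := cE; rewrite paddr_eq0 ?mulr_ge0// => /andP[/eqP h1 /eqP h2].
    by exists 0, y0; rewrite !scalerA h1 h2 !scale0r addr0.
  exists c, ((1 - s * t' / c) *: y + (s * t' / c) *: y'); split => //.
    apply: cF => //; first by rewrite divr_ge0 ?mulr_ge0.
    by rewrite ler_pdivrMr ?lt_neqAle ?(eq_sym 0) ?cn0// mul1r lerDr mulr_ge0.
  rewrite scalerDr !scalerA; congr (_ *: _ + _ *: _); rewrite /c; field.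
    by rewrite -/c.
  by rewrite -/c.
move=> _ [t [y [t0 t1 Fy ->]]] A [cA FA]; have {}cA := (convex_setP A).1 cA.
have := cA 0 y t (FA _ (or_introl erefl)) (FA _ (or_intror Fy)) t0 t1.
by rewrite scaler0 add0r.
Qed.

Lemma facet_cone_compact F : cvx F -> F !=set0 -> compact F -> compact (facet_cone F).
Proof.
move=> cF F0 coF; rewrite facet_coneE//.
rewrite (_ : mkset _ = (fun z : R^o * 'rV[R]_n => z.1 *: z.2) @` (`[0, 1]%classic `*` F)).
  apply: continuous_compact; first exact/continuous_subspaceT/scale_continuous.
  by apply: compact_setX => //; exact: segment_compact.
apply/seteqP; split => x.
  by move=> [t [y [t0 t1 Fy ->]]]; exists (t, y) => //; split => //=; rewrite in_itv/= t0.
by move=> [[t y] [/= + Fy] <-]; rewrite in_itv/= => /andP[t0 t1]; exists t, y.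
Qed.

End facets.

(** * Decomposition into facet cones *)

Section facets_cover.
Context {R : realType} {n : nat}.
Implicit Types (P F A : set 'rV[R]_n) (a u x y z : 'rV[R]_n).

(** The directions [v] with [p + v] in [A] form a linear space: scaling is a combination with [p],
    and a sum is twice a midpoint. *)
Lemma affine_comb A m (s : 'I_m -> 'rV[R]_n) (c : 'I_m -> R) :
  affine_set A -> (forall i, c i != 0 -> A (s i)) -> \sum_i c i = 1 ->
  A (\sum_i c i *: s i).
Proof.
move=> aA sA c1.
have [p Ap] : exists p, A p.
  have [i ci] : exists i, c i != 0.
    apply: contrapT => /forallNP nc; move: c1; rewrite big1 => [/eqP|i _].
      by rewrite eq_sym oner_eq0.
    by apply/eqP/negPn/negP; exact: nc.
  by exists (s i); exact: sA.
have WZ t v : A (p + v) -> A (p + t *: v).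
  move=> Av; rewrite (_ : p + _ = t *: (p + v) + (1 - t) *: p); first exact: aA.
  by rewrite scalerDr scalerBl scale1r [RHS]addrC addrA subrK.
have WD v w : A (p + v) -> A (p + w) -> A (p + (v + w)).
  move=> Av Aw; rewrite -[v + w](@scalerK _ _ (2^-1)); last by rewrite invr_eq0 pnatr_eq0.
  rewrite invrK; apply: WZ.
  rewrite (_ : p + _ = 2^-1 *: (p + v) + (1 - 2^-1) *: (p + w)); first exact: aA.
  have -> : (1 - 2^-1 : R) = 2^-1 by field.
  rewrite -scalerDr addrACA [RHS]scalerDr; congr (_ + _).
  by rewrite -mulr2n -(scaler_nat 2 p) scalerA mulVf ?scale1r ?pnatr_eq0.
have -> : \sum_i c i *: s i = p + \sum_i c i *: (s i - p).
  under [X in p + X]eq_bigr do rewrite scalerBr.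
  by rewrite sumrB -scaler_suml c1 scale1r addrC subrK.
elim/big_ind : _ => [|v w|i _]; [by rewrite addr0|exact: WD|].
have [->|ci] := eqVneq (c i) 0; first by rewrite scale0r addr0.
by apply: WZ; rewrite addrC subrK; exact: sA.
Qed.

Section gauge.
Variables (P : set 'rV[R]_n) (e N : R).
Hypotheses (cP : cvx P) (closedP : closed P) (bP : bdd N P) (e0 : 0 < e)
  (eP : forall x : 'rV[R]_n, (forall i, `|x ord0 i| < e) -> P x).

Let G x := [set t | 0 < t /\ P (t^-1 *: x)].
Definition gauge x := inf (G x).

Let G0 x : G x !=set0.
Proof.
have s0 : 0 < 1 + \sum_i `|x ord0 i| by rewrite ltr_pwDl// sumr_ge0.
exists ((1 + \sum_i `|x ord0 i|) / e); split; first by rewrite divr_gt0.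
apply: eP => i; rewrite mxE normrM invf_div gtr0_norm ?divr_gt0//.
rewrite mulrAC ltr_pdivrMr// ltr_pM2l//.
by rewrite (bigD1 i)//= addrCA ltrDl ltr_pwDl// sumr_ge0.
Qed.

Let gauge_le x t : 0 < t -> P (t^-1 *: x) -> gauge x <= t.
Proof. by move=> t0 Pt; apply: ge_inf; [exists 0 => s [/ltW]|]. Qed.

Let le_gauge x s : (forall t, 0 < t -> P (t^-1 *: x) -> s <= t) -> s <= gauge x.
Proof. by move=> H; apply: lb_le_inf => // t [t0 Pt]; exact: H. Qed.

Lemma gauge_le1 x : P x -> gauge x <= 1.
Proof. by move=> Px; apply: gauge_le => //; rewrite invr1 scale1r. Qed.

Lemma gaugeZ c x : 0 < c -> gauge (c *: x) = c * gauge x.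
Proof.
have H b y : 0 < b -> gauge (b *: y) <= b * gauge y.
  move=> b0; rewrite mulrC -ler_pdivrMr//; apply: le_gauge => t t0 Pt.
  rewrite ler_pdivrMr// mulrC; apply: gauge_le; first by rewrite mulr_gt0.
  by rewrite scalerA invfM mulrAC mulVf ?gt_eqF// mul1r.
move=> c0; apply/eqP; rewrite eq_le H//=.
have := H c^-1 (c *: x); rewrite invr_gt0 scalerA mulVf ?gt_eqF// scale1r => /(_ c0).
by rewrite ler_pdivlMl.
Qed.

Lemma gaugeD x y : gauge (x + y) <= gauge x + gauge y.
Proof.
rewrite -lerBlDr; apply: le_gauge => s s0 Ps; rewrite lerBlDr -lerBlDl.
apply: le_gauge => t t0 Pt; rewrite lerBlDr.
apply: gauge_le; first by rewrite addr_gt0.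
have st : s + t != 0 by rewrite gt_eqF// addr_gt0.
rewrite (_ : _ *: _ = (1 - t / (s + t)) *: (s^-1 *: x) + (t / (s + t)) *: (t^-1 *: y)).
  have st0 : 0 < s + t by rewrite addr_gt0.
  apply: cP => //; first by rewrite divr_ge0 ?ltW.
  by rewrite ler_pdivrMr// mul1r lerDr ltW.
by rewrite scalerDr !scalerA; congr (_ *: _ + _ *: _); field; rewrite st gt_eqF.
Qed.

(** As [P] is compact there is a largest [tau] with [tau x] in [P], and the gauge is its inverse. *)
Lemma gauge_attained x : x != 0 -> 0 < gauge x /\ P ((gauge x)^-1 *: x).
Proof.
move=> x0.
have [i xi] : exists i, x ord0 i != 0.
  apply: contrapT => /forallNP nx; move/eqP : x0; apply; apply/rowP => i.
  by rewrite mxE; apply/eqP/negPn/negP; exact: nx.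
have xi0 : 0 < `|x ord0 i| by rewrite normr_gt0.
pose K := [set s : R | P (s *: x)] `&` `[0, N / `|x ord0 i|].
have cK : compact K.
  apply: (@subclosed_compact _ _ `[0, N / `|x ord0 i|]%classic).
  - apply: closedI; last exact: interval_closed.
    apply: (@preimage_closed _ _ (fun s : R => s *: x) P) => // s _.
    by apply: cvgZr_tmp; exact: cvg_id.
  - exact: segment_compact.
  - by move=> ? [].
have KN s : 0 <= s -> P (s *: x) -> K s.
  move=> s0 Ps; split => //=; rewrite in_itv/= s0/= ler_pdivlMr//.
  by have := bP Ps i; rewrite mxE normrM (ger0_norm s0).
have [t [t0 Pt]] := G0 x.
have Kt : K t^-1 by apply: KN => //; rewrite invr_ge0 ltW.
have [tau [Ktau max]] : exists tau, K tau /\ forall s, K s -> s <= tau.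
  have [tau Kt' max] := @compact_EVT_max _ _ (id : R -> R) K (ex_intro _ _ Kt) cK
    (continuous_subspaceT (fun _ => cvg_id)).
  by exists tau; split=> [|s Ks]; [exact: set_mem|apply: max; exact: mem_set].
have tau0 : 0 < tau by apply: lt_le_trans (max _ Kt); rewrite invr_gt0.
have -> : gauge x = tau^-1.
  apply/eqP; rewrite eq_le; apply/andP; split.
    by apply: gauge_le; [rewrite invr_gt0|rewrite invrK; case: Ktau].
  apply: le_gauge => s s0 Ps; rewrite -[s]invrK lef_pV2 ?posrE ?invr_gt0//.
  by apply: max; apply: KN => //; rewrite invr_ge0 ltW.
by rewrite invr_gt0 invrK; split => //; case: Ktau.
Qed.

(** [u] is a subgradient of the gauge at [x], that is, of the shifted gauge at 0; testing it on
    [- x] and [x] gives equality by homogeneity. *)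
Lemma support_gauge x : exists2 u, dotv u x = gauge x & forall z, dotv u z <= gauge z.
Proof.
have g0 : gauge 0 = 0.
  have := @gaugeZ 2 0 (ltr0n _ 2); rewrite scaler0 => h; lra.
have gZ c y : 0 <= c -> gauge (c *: y) = c * gauge y.
  rewrite le_eqVlt => /orP[/eqP<-|]; last exact: gaugeZ.
  by rewrite scale0r mul0r g0.
have [| | | |u uP] := @subgradient R n setT (fun y => gauge (x + y)).
- by move=> y; exists 1.
- by [].
- by [].
- move=> y z t _ _ t0 t1.
  rewrite -!gZ ?subr_ge0//; apply: le_trans (gaugeD _ _).
  rewrite le_eqVlt; apply/orP; left; apply/eqP; congr gauge.
  by rewrite !scalerDr addrACA -scalerDl subrK scale1r.
rewrite addr0 in uP; exists u.
  have := uP (- x) I; rewrite subrr g0 dotvNr => h1.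
  have := uP x I; rewrite -mulr2n -(scaler_nat 2 x) gZ// => h2.
  by apply/eqP; rewrite eq_le; apply/andP; split; lra.
move=> z; have := uP z I; have := gaugeD x z; lra.
Qed.

End gauge.

End facets_cover.

Section cone_volumes.
Context {R : realType} {n : nat}.
Implicit Types (P F A : set 'rV[R]_n) (a u x y z : 'rV[R]_n).

Lemma dotv_sumr (I : Type) (r : seq I) (Q : pred I) u (f : I -> 'rV[R]_n) :
  dotv u (\sum_(i <- r | Q i) f i) = \sum_(i <- r | Q i) dotv u (f i).
Proof.
elim/big_ind2 : _ => [|x s y t <- <-|//]; first exact: dotv0.
by rewrite dotvDr.
Qed.

(** After zeroing the rows outside [T], the assumption says that the transposed matrix is injective,
    so the row space is everything. *)
Lemma row_span m (s : 'M[R]_(m, n)) (T : pred 'I_m) :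
  (forall u, (forall i, T i -> dotv u (row i s) = 0) -> u = 0) ->
  forall z, exists c : 'I_m -> R, z = \sum_(i | T i) c i *: row i s.
Proof.
move=> nT z; pose M := \matrix_i (if T i then row i s else 0).
have fM : row_free M^T.
  apply: inj_row_free => v vM; apply: nT => i Ti.
  have := congr1 (fun w : 'rV_m => w ord0 i) vM.
  rewrite !mxE => /(etrans _); apply; apply: eq_bigr => j _.
  by rewrite !mxE Ti !mxE.
have : row_full M by rewrite /row_full -mxrank_tr.
move=> fullM; have /submxP[c ->] : (z <= M)%MS by exact: submx_full.
exists (fun i => c ord0 i).
rewrite mulmx_sum_row [RHS]big_mkcond; apply: eq_bigr => i _.
by rewrite rowK; case: ifP => // _; rewrite scaler0.
Qed.

(* Off the finitely many hyperplanes containing the vertices of a lower dimensional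
   face, a ray from the origin leaves the polytope through a facet. *)
Lemma facets_cover P : (0 < n)%N -> polytope P -> interior P 0 ->
  exists (m : nat) (U : {set 'I_m} -> 'rV[R]_n), (forall T, U T != 0) /\
  forall x, P x -> (forall T, dotv (U T) x != 0) ->
    exists2 F, facets P F & facet_cone F x.
Proof.
move=> n0 polyP intP.
have [m [s PE]] := polytope_rows polyP; exists m.
have one0 : (const_mx 1 : 'rV[R]_n) != 0.
  apply/eqP => /rowP/(_ (Ordinal n0)); rewrite !mxE => /eqP.
  by rewrite oner_eq0.
pose orth u (T : {set 'I_m}) := forall i, i \in T -> dotv u (row i s) = 0.
(* [U T] is orthogonal to the vertices in [T] whenever a nonzero vector with this property exists;
   otherwise the constant vector is a placeholder. *)
have /choice[U UP] : forall T, exists u, u != 0 /\ ((exists2 v, v != 0 & orth v T) -> orth u T).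
  move=> T; have [[v v0 vT]|nv] := pselect (exists2 v, v != 0 & orth v T).
    by exists v.
  by exists (const_mx 1).
exists U; split => [T|x Px Ux]; first by case: (UP T).
have coP := polytope_compact polyP.
have [N bP] := compact_bdd coP; have cP := polytope_cvx polyP.
have clP := compact_closed_rV coP.
have [e e0 eP] := interior_cube intP.
have x0 : x != 0.
  by apply/eqP => x0; have := Ux finset.set0; rewrite x0 dotv0 eqxx.
have [g0 Pg] := gauge_attained clP bP e0 eP x0.
have [u ux uz] := support_gauge cP e0 eP x.
have uP z : P z -> dotv u z <= 1 by move=> Pz; apply: (le_trans (uz z)); exact: gauge_le1.
set y := (gauge P x)^-1 *: x in Pg.
have uy : dotv u y = 1 by rewrite /y dotvZr ux mulVf// gt_eqF.
have xE : x = gauge P x *: y by rewrite /y scalerA mulfV ?scale1r// gt_eqF.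
pose F := P `&` [set z | dotv u z = 1].
have Fy : F y by [].
have cF : cvx F.
  move=> z z' t [Pz uz1] [Pz' uz'1] t0 t1; split; first exact: cP.
  by rewrite /= dotvDr !dotvZr uz1 uz'1; ring.
have u0 : u != 0.
  by apply/eqP => u0; move: uy; rewrite u0 dotvC dotv0 => /eqP; rewrite eq_sym oner_eq0.
have Ps i : P (row i s).
  rewrite PE; exists (delta_mx 0 i); last by rewrite rowE.
  split => [j|]; first by rewrite mxE ler0n.
  rewrite (bigD1 i)//= mxE !eqxx big1 ?addr0// => j ji.
  by rewrite mxE (negbTE ji) andbF.
pose T := [set i | dotv u (row i s) == 1]%SET.
(* If the vertices on the face [F] did not span, [U T] would be orthogonal to all of them. As [y] is
   a convex combination of these vertices alone, [x] would lie on an excluded hyperplane. *)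
have span v : orth v T -> v = 0.
  move=> vT; apply: contrapT => /eqP v0.
  have UT : orth (U T) T by have [_] := UP T; apply; exists v.
  have := Ux T; rewrite xE dotvZr mulf_eq0 (gt_eqF g0)/=.
  have [w [w0 w1] wy] : [set w *m s | w in @simplex R m] y by rewrite -PE.
  have : \sum_i w ord0 i * (1 - dotv u (row i s)) = 0.
    under eq_bigr do rewrite mulrBr mulr1.
    rewrite sumrB w1 -[X in X - _]uy -wy mulmx_sum_row dotv_sumr.
    by under [X in X - _]eq_bigr do rewrite dotvZr; rewrite subrr.
  move=> /eqP; rewrite psumr_eq0 => [/allP wu|i _]; last first.
    by rewrite mulr_ge0// subr_ge0 uP.
  apply/negP; rewrite negbK -wy mulmx_sum_row dotv_sumr big1// => i _.
  rewrite dotvZr; have := wu i (mem_index_enum _).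
  rewrite /= mulf_eq0 => /orP[/eqP->|]; first by rewrite mul0r.
  by rewrite subr_eq0 eq_sym => ui; rewrite UT ?mulr0// inE.
exists F.
  split; first by exists u, 1.
  exists (\dim (perp u)); first exact: dim_perp.
  exists y, (perp u); split => //; apply/seteqP; split => z.
    move=> /(affine_hull_sub (@affine_hyperplane _ _ u 1)) uz1; exists (z - y); last by rewrite addrC subrK.
    by rewrite /= mem_perp dotvDr dotvNr uy uz1 ?subrr// => ? [].
  move=> [v /=]; rewrite mem_perp => /eqP vu <- A [aA FA].
  (* Pairing a linear combination of the vertices on [F] with [u] shows that its coefficients sum to
     1, so it is an affine combination. *)
  have [c zE] := row_span (T := fun i => i \in T) span (y + v).
  rewrite zE big_mkcond/=.
  rewrite (eq_bigr (fun i => (if i \in T then c i else 0) *: row i s)); last first.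
    by move=> i _; case: ifP; rewrite ?scale0r.
  apply: affine_comb => // [i|].
    case: ifP => [iT _|]; last by rewrite eqxx.
    by apply: FA; split => //; apply/eqP; move: iT; rewrite inE.
  rewrite -big_mkcond/=; have := congr1 (dotv u) zE.
  rewrite dotvDr uy vu addr0 dotv_sumr => ->; apply: eq_bigr => i.
  by rewrite inE dotvZr => /eqP ->; rewrite mulr1.
rewrite facet_coneE//; last by exists y.
exists (gauge P x), y; split => //; [exact: ltW|exact: gauge_le1].
Qed.

End cone_volumes.

Section cones.
Context {R : realType} {n m : nat}.
Variables (P : set 'rV[R]_n) (a : 'I_m -> 'rV[R]_n) (h : 'I_m -> R) (F : 'I_m -> set 'rV[R]_n).
Hypotheses (coP : compact P) (cP : cvx P) (P0 : P 0) (h0 : forall i, 0 < h i)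
  (Pa : forall i x, P x -> dotv (a i) x <= h i)
  (FE : forall i, F i = P `&` [set x | dotv (a i) x = h i])
  (F0 : forall i, F i !=set0) (injF : injective F).

Lemma facet_cvx i : cvx (F i).
Proof.
rewrite FE => x y t [Px hx] [Py hy] t0 t1; split; first exact: cP.
by rewrite /= dotvDr !dotvZr hx hy; ring.
Qed.

Lemma facet_compact i : compact (F i).
Proof.
apply: (subclosed_compact _ coP); last by rewrite FE => x [].
rewrite FE; apply: closedI; first exact: compact_closed_rV.
rewrite (_ : mkset _ = dotv (a i) @^-1` [set t | t = h i])//.
by apply: closed_preimage; [exact: continuous_dotv|exact: closed_eq].
Qed.

Lemma coneP i x : facet_cone (F i) x <->
  exists t y, [/\ 0 <= t, t <= 1, P y, dotv (a i) y = h i & x = t *: y].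
Proof.
rewrite (facet_coneE (@facet_cvx i) (F0 i)); split => -[t [y]].
  by rewrite FE => -[t0 t1 [Py hy] ->]; exists t, y.
by move=> [t0 t1 Py hy ->]; exists t, y; rewrite FE.
Qed.

Lemma measurable_cone i : measurable (facet_cone (F i)).
Proof.
apply: closed_measurable_rV; apply: compact_closed_rV.
by apply: facet_cone_compact; [exact: facet_cvx|exact: F0|exact: facet_compact].
Qed.

Lemma cone_sub i : facet_cone (F i) `<=` P.
Proof.
move=> x /coneP[t [y [t0 t1 Py _ ->]]].
by have := cP P0 Py t0 t1; rewrite scaler0 add0r.
Qed.

Lemma cone_scale i s x : 0 < s -> s <= 1 -> facet_cone (F i) x -> dotv (a i) x <= s * h i ->
  facet_cone (F i) (s^-1 *: x).
Proof.
move=> s0 s1 /coneP[t [y [t0 t1 Py hy ->]]]; rewrite dotvZr hy ler_pM2r// => ts.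
apply/coneP; exists (t / s), y; split => //; first by rewrite divr_ge0// ltW.
  by rewrite ler_pdivrMr// mul1r.
by rewrite scalerA mulrC.
Qed.

(** If [x = t y = s z] with [y], [z] on the two facets, the supporting inequalities give [t = s], so
    [x] lies on the hyperplane orthogonal to [u]. Here [u] is nonzero since otherwise both normals
    would cut out the same facet. *)
Lemma cone_null i j : i != j -> lebesgue_rV n (facet_cone (F i) `&` facet_cone (F j)) = 0%E.
Proof.
move=> ij; pose u := h j *: a i - h i *: a j.
have u0 : u != 0.
  apply: contra ij; rewrite subr_eq0 => /eqP uE; apply/eqP; apply: injF.
  rewrite !FE; apply/seteqP; split => x [Px hx]; split => //=; move: hx => /= hx.
    have := congr1 (dotv ^~ x) uE; rewrite !dotvZl hx mulrC => /(mulfI _) <- //.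
    by rewrite gt_eqF.
  have := congr1 (dotv ^~ x) uE; rewrite !dotvZl hx [RHS]mulrC => /(mulfI _) -> //.
  by rewrite gt_eqF.
apply/eqP; rewrite -measure_le0 -(lebesgue_rV_hyperplane 0 u0).
apply: le_measure; rewrite ?inE.
- by apply: measurableI; exact: measurable_cone.
- exact: measurable_hyperplane.
move=> x [/coneP[t [y [t0 t1 Py hy ->]]] /coneP[s [z [s0 s1 Pz hz xE]]]].
have st : s = t.
  have h1 : t * h i <= s * h i.
    by rewrite -{1}hy -dotvZr xE dotvZr ler_wpM2l// Pa.
  have h2 : s * h j <= t * h j.
    by rewrite -{1}hz -dotvZr -xE dotvZr ler_wpM2l// Pa.
  move: h1 h2; rewrite !ler_pM2r// => h1 h2; apply/eqP; by rewrite eq_le h1 h2.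
rewrite /= dotvDl -scaleNr !dotvZl {2}xE !dotvZr hy hz st; ring.
Qed.

Definition slab (Q : pred 'I_m) (s : R) : set 'rV[R]_n :=
  P `&` [set x | forall i, Q i -> dotv (a i) x <= s * h i].

Lemma measurable_slab Q s : measurable (slab Q s).
Proof.
rewrite (_ : slab Q s = P `&` \bigcap_(i in [set i | Q i]) [set x | dotv (a i) x <= s * h i]).
  apply: measurableI; first exact: closed_measurable_rV (compact_closed_rV coP).
  apply: fin_bigcap_measurable => [|i _]; first exact: finite_finset.
  exact: measurable_halfspace.
by apply/seteqP; split => x [Px H]; split => // i; exact: H.
Qed.

(** The part of a facet cone below height [s * h i] lies in the cone shrunk by [s], so the cut
    removes at least the fraction [1 - s ^+ n] of the cone. The removed pieces overlap in null
    sets. *)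
Lemma slab_measure Q s : 0 < s -> s <= 1 ->
  (lebesgue_rV n (slab Q s) + (1 - s ^+ n)%:E * \sum_(i < m | Q i) lebesgue_rV n (facet_cone (F i))
   <= lebesgue_rV n P)%E.
Proof.
move=> s0 s1.
have mP : measurable P by exact: closed_measurable_rV (compact_closed_rV coP).
have [N bP] := compact_bdd coP.
have mC := measurable_cone.
pose H i := [set x | dotv (a i) x <= s * h i].
have mH i : measurable (H i) by exact: measurable_halfspace.
rewrite (measureDI _ mP (measurable_slab Q s)) addeC; apply: leeD; last first.
  by rewrite setIidr// => x [].
apply: (@le_trans _ _ (\sum_(i < m | Q i) lebesgue_rV n (facet_cone (F i) `\` H i))%E); last first.
  apply: measure_sum_le => [|i|i Qi x [Cx nH]|i j ij].
  - by apply: measurableD => //; exact: measurable_slab.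
  - exact: measurableD.
  - by split; [exact: (@cone_sub i)|move=> [_ /(_ i Qi)]].
  - apply/eqP; rewrite -measure_le0 -(cone_null ij); apply: le_measure; rewrite ?inE.
    + by apply: measurableI; exact: measurableD.
    + exact: measurableI.
    + by move=> x [[? _] [? _]].
rewrite ge0_sume_distrr//.
apply: lee_sum => i _.
have fC : lebesgue_rV n (facet_cone (F i)) \is a fin_num.
  by apply: (@bdd_fin_num _ _ N) => // x /cone_sub; exact: bP.
have fD : lebesgue_rV n (facet_cone (F i) `\` H i) \is a fin_num.
  by apply: (@bdd_fin_num _ _ N); [exact: measurableD|move=> x [/cone_sub + _]; exact: bP].
have hC : (lebesgue_rV n (facet_cone (F i)) = lebesgue_rV n (facet_cone (F i) `\` H i) +
    lebesgue_rV n (facet_cone (F i) `&` H i))%E by exact: measureDI.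
have : (lebesgue_rV n (facet_cone (F i) `&` H i) <= (s ^+ n)%:E * lebesgue_rV n (facet_cone (F i)))%E.
  have si0 : 0 < s^-1 by rewrite invr_gt0.
  have := lebesgue_rV_dilation (0 : 'rV[R]_n) si0 (mC i).
  rewrite exprVn invrK => <-; apply: le_measure; rewrite ?inE; first exact: measurableI.
    by apply: measurable_preimage => //; apply: measurable_fun_rVD => //; exact: measurable_fun_rVZ.
  by move=> x [Cx Hx] /=; rewrite addr0; exact: cone_scale.
have fI : lebesgue_rV n (facet_cone (F i) `&` H i) \is a fin_num.
  by apply: (@bdd_fin_num _ _ N); [exact: measurableI|move=> x [/cone_sub + _]; exact: bP].
move: hC; rewrite -(fineK fC) -(fineK fD) -(fineK fI) -EFinD -!EFinM !lee_fin => -[hC] hI.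
rewrite mulrBl mul1r; lra.
Qed.

Lemma cone_volume_total : (0 < n)%N -> polytope P -> interior P 0 -> range F = facets P ->
  lebesgue_rV n P = (\sum_(i < m) lebesgue_rV n (facet_cone (F i)))%E.
Proof.
move=> n0 polyP intP rF.
have mP : measurable P by exact: closed_measurable_rV (compact_closed_rV coP).
have mC := measurable_cone.
apply/eqP; rewrite eq_le; apply/andP; split; last first.
  by apply: measure_sum_le => // [i _|]; [exact: cone_sub|exact: cone_null].
have [k [U [U0 UP]]] := facets_cover n0 polyP intP.
pose Nn := \bigcup_(T in [set: {set 'I_k}]) [set x | dotv (U T) x = 0].
have mN : measurable Nn.
  by apply: fin_bigcup_measurable => [|T _]; [exact: finite_finset|exact: measurable_hyperplane].
have N0 : lebesgue_rV n Nn = 0%E.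
  pose C (i : 'I_#|{set 'I_k}|) := [set x : 'rV[R]_n | dotv (U (enum_val i)) x = 0].
  apply/eqP; rewrite -measure_le0; apply: le_trans (@measure_le_sum _ _ _ _ _ C _ mN _ _) _.
  - by move=> i; exact: measurable_hyperplane.
  - by move=> x [T _ UT]; exists (enum_rank T) => //; rewrite /C/= enum_rankK.
  - by rewrite big1// => i _; exact: lebesgue_rV_hyperplane.
apply: (@le_trans _ _ (lebesgue_rV n (P `\` Nn))).
  rewrite (measureDI _ mP mN) [X in (_ + X)%E](_ : _ = 0%E) ?adde0//.
  apply/eqP; rewrite -measure_le0 -N0; exact: measureIr.
apply: measure_le_sum => //; first exact: measurableD.
move=> x [Px nN].
have [T|G fG Gx] := UP x Px.
  by apply/eqP => Ux; apply: nN; exists T.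
have : (range F) G by rewrite rF.
by move=> [i _ FG]; exists i => //; rewrite FG.
Qed.

End cones.

(** * The subspace inequality *)

Section fibres.
Context {R : realType} {n r k : nat}.
Variables (B : 'M[R]_(r, n)) (D : 'M[R]_(k, n)) (B' : 'M[R]_(n, r)) (D' : 'M[R]_(n, k)).
Hypotheses (BD1 : B' *m B + D' *m D = 1%:M) (BB : B *m B' = 1%:M)
  (DD : D *m D' = 1%:M) (BD : B *m D' = 0) (DB : D *m B' = 0).
Variable (P : set 'rV[R]_n).
Hypotheses (coP : compact P) (cP : cvx P) (intP : interior P 0).

Local Notation gl := (glue_rV B D).

Definition fib (A : set 'rV[R]_n) (y : 'rV[R]_k) := [set z : 'rV[R]_r | A (gl (y, z))].

Lemma glueDZ (a b : R) (y y' : 'rV[R]_k) z z' :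
  gl (a *: y + b *: y', a *: z + b *: z') = a *: gl (y, z) + b *: gl (y', z').
Proof.
rewrite /glue_rV/= !mulmxDl -!scalemxAl [in RHS]scalerDr [in RHS]scalerDr.
by rewrite addrACA.
Qed.

Lemma glue_unglue x : gl (x *m D', x *m B') = x.
Proof. by rewrite /glue_rV/= -!mulmxA -mulmxDr BD1 mulmx1. Qed.

Lemma unglue_glue1 y z : gl (y, z) *m D' = y.
Proof. by rewrite /glue_rV/= mulmxDl -!mulmxA BD DD mulmx0 mulmx1 add0r. Qed.

Lemma unglue_glue2 y z : gl (y, z) *m B' = z.
Proof. by rewrite /glue_rV/= mulmxDl -!mulmxA BB DB mulmx0 mulmx1 addr0. Qed.

Lemma measurable_fib A y : measurable A -> measurable (fib A y).
Proof.
move=> mA; have := measurable_xsection y (measurable_preimage (measurable_glue B D) mA).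
by rewrite xsectionE.
Qed.

Lemma fib_cvx A y y' z z' t : cvx A -> fib A y z -> fib A y' z' -> 0 <= t -> t <= 1 ->
  fib A ((1 - t) *: y + t *: y') ((1 - t) *: z + t *: z').
Proof. by move=> cA Az Az' t0 t1; rewrite /fib/= glueDZ; exact: cA. Qed.

Lemma fib_cvx1 A y : cvx A -> cvx (fib A y).
Proof.
move=> cA z z' t Az Az' t0 t1; have := fib_cvx cA Az Az' t0 t1.
by rewrite -scalerDl subrK scale1r.
Qed.

Lemma fib_bdd : exists N, forall y, bdd N (fib P y).
Proof.
have [N bP] := compact_bdd coP.
exists (`|N| * \sum_i \sum_j `|B' j i|) => y z Pz i.
rewrite -[z in leLHS](unglue_glue2 y).
have -> : (gl (y, z) *m B') ord0 i = dotv (\row_j B' j i) (gl (y, z)).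
  by rewrite mxE /dotv; apply: eq_bigr => j _; rewrite mxE mulrC.
apply: (le_trans (dotv_bdd _ (bddW (ler_norm N) bP) Pz)).
apply: ler_wpM2l => //; under eq_bigr do rewrite mxE.
by rewrite [leRHS](bigD1 i)//= lerDl; apply: sumr_ge0 => j _; apply: sumr_ge0.
Qed.

Lemma fib_cube : exists2 e, 0 < e & forall (y : 'rV[R]_k) (z : 'rV[R]_r), (forall i, `|y ord0 i| < e) ->
  (forall i, `|z ord0 i| < e) -> fib P y z.
Proof.
have [e e0 eP] := interior_cube intP.
pose S := 1 + (\sum_i \sum_j `|B j i| + \sum_i \sum_j `|D j i|).
have S0 : 0 < S.
  by rewrite ltr_pwDl// addr_ge0//; apply: sumr_ge0 => i _; apply: sumr_ge0.
exists (e / S); first by rewrite divr_gt0.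
move=> y z yS zS; apply: eP => i; rewrite /glue_rV/= !mxE.
have bound m (v : 'rV[R]_m) (M : 'M[R]_(m, n)) : (forall i, `|v ord0 i| < e / S) ->
    `|\sum_j v ord0 j * M j i| <= e / S * \sum_i \sum_j `|M j i|.
  move=> vS; apply: (le_trans (ler_norm_sum _ _ _)).
  apply: (@le_trans _ _ (e / S * \sum_j `|M j i|)).
    by rewrite mulr_sumr; apply: ler_sum => j _; rewrite normrM ler_wpM2r// ltW.
  rewrite ler_pM2l ?divr_gt0// [leRHS](bigD1 i)//= lerDl.
  by apply: sumr_ge0 => j _; apply: sumr_ge0.
apply: (le_lt_trans (ler_normD _ _)).
apply: (le_lt_trans (lerD (bound _ _ B zS) (bound _ _ D yS))).
by rewrite -mulrDr mulrAC ltr_pdivrMr// ltr_pM2l// /S ltrDr.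
Qed.

Definition fvol y : R := fine (lebesgue_rV r (fib P y)).

Lemma measurable_P : measurable P.
Proof. exact: closed_measurable_rV (compact_closed_rV coP). Qed.

Lemma fvolE y : lebesgue_rV r (fib P y) = (fvol y)%:E.
Proof.
have [N bN] := fib_bdd; rewrite fineK//.
by apply: (@bdd_fin_num _ _ N) => //; apply: measurable_fib; exact: measurable_P.
Qed.

Lemma fvol_ge0 y : 0 <= fvol y.
Proof. by rewrite fine_ge0. Qed.

Lemma measurable_fvol : measurable_fun setT fvol.
Proof.
apply: measurableT_comp => //.
have := measurable_fun_xsection (lebesgue_rV r) (measurable_preimage (measurable_glue B D) measurable_P).
by apply: eq_measurable_fun => y _; rewrite /= xsectionE.
Qed.

(** The target [A] is left free: [A = P] gives log-concavity of the fibre volume, and a slab gives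
    the lower bound for the trimmed polytope. *)
Lemma fvol_log_concave (A : set 'rV[R]_n) y y' l : 0 < l -> l < 1 ->
  measurable A -> A `<=` P -> 0 < fvol y -> 0 < fvol y' ->
  (forall z z', fib P y z -> fib P y' z' ->
     fib A ((1 - l) *: y + l *: y') ((1 - l) *: z + l *: z')) ->
  ((expR ((1 - l) * ln (fvol y) + l * ln (fvol y')))%:E <=
    lebesgue_rV r (fib A ((1 - l) *: y + l *: y')))%E.
Proof.
move=> l0 l1 mA AP fy fy' H.
have [N bN] := fib_bdd; have mP := measurable_P.
apply: (@brunn_minkowski _ _ (fib P y) (fib P y') _ N) => //; try exact: fib_cvx1; try exact: measurable_fib.
- by move=> z /AP; exact: bN.
- by rewrite fvolE lnK.
- by rewrite fvolE lnK.
Qed.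

Lemma fvol_concave y y' l : 0 < l -> l < 1 -> 0 < fvol y -> 0 < fvol y' ->
  0 < fvol ((1 - l) *: y + l *: y') /\
  (1 - l) * ln (fvol y) + l * ln (fvol y') <= ln (fvol ((1 - l) *: y + l *: y')).
Proof.
move=> l0 l1 fy fy'.
have := fvol_log_concave l0 l1 measurable_P (@subset_refl _ P) fy fy' _.
rewrite fvolE lee_fin => /(_ _) H.
have {}H : expR ((1 - l) * ln (fvol y) + l * ln (fvol y')) <= fvol ((1 - l) *: y + l *: y').
  by apply: H => z z' Pz Pz'; apply: fib_cvx => //; exact: ltW.
have f0 := lt_le_trans (expR_gt0 _) H; split => //.
by rewrite -ler_expR lnK.
Qed.

Lemma fvol_gt0_nbhs : exists2 e, 0 < e & forall y : 'rV[R]_k, (forall i, `|y ord0 i| < e) -> 0 < fvol y.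
Proof.
have [e e0 eP] := fib_cube; exists e => // y ye.
rewrite -lte_fin -fvolE; apply: (@lebesgue_rV_cube_gt0 _ _ _ 0 e) => //.
  by apply: measurable_fib; exact: measurable_P.
by move=> z ze; apply: eP => // i; have := ze i; rewrite mxE subr0.
Qed.

Lemma fvol0_gt0 : 0 < fvol 0.
Proof. by have [e e0] := fvol_gt0_nbhs; apply => i; rewrite mxE normr0. Qed.

Lemma fvol_supergradient : exists p, forall y, 0 < fvol y -> ln (fvol y) <= ln (fvol 0) + dotv p y.
Proof.
pose O := [set y | 0 < fvol y].
have [| | | |u uP] := @subgradient R k O (fun y => - ln (fvol y)).
- move=> y; have [e e0 eP] := fvol_gt0_nbhs.
  have s0 : 0 < 1 + \sum_i `|y ord0 i| by rewrite ltr_pwDl// sumr_ge0.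
  exists (e / (1 + \sum_i `|y ord0 i|)); first by rewrite divr_gt0.
  apply: eP => i; rewrite mxE normrM gtr0_norm ?divr_gt0//.
  rewrite mulrAC ltr_pdivrMr// ltr_pM2l//.
  by rewrite (bigD1 i)//= addrCA ltrDl ltr_pwDl// sumr_ge0.
- exact: fvol0_gt0.
- move=> y y' t Oy Oy'; rewrite le_eqVlt => /orP[/eqP<-|t0].
    by rewrite subr0 scale1r scale0r addr0.
  rewrite le_eqVlt => /orP[/eqP->|t1]; first by rewrite subrr scale1r scale0r add0r.
  by have [] := fvol_concave t0 t1 Oy Oy'.
- move=> y y' t Oy Oy'; rewrite le_eqVlt => /orP[/eqP<-|t0].
    by rewrite subr0 scale1r scale0r addr0 mul1r mul0r addr0.
  rewrite le_eqVlt => /orP[/eqP->|t1].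
    by rewrite subrr scale1r scale0r add0r mul1r mul0r add0r.
  have [_] := fvol_concave t0 t1 Oy Oy'; lra.
exists (- u) => y Oy; have := uP y Oy.
rewrite [dotv (- u) y]dotvC dotvNr [dotv y u]dotvC; lra.
Qed.

Lemma fib_decomp : exists2 c : R, 0 < c &
  (forall g : 'rV[R]_n -> \bar R, measurable_fun setT g -> (forall x, 0 <= g x)%E ->
    (\int[lebesgue_rV n]_x g x =
      c%:E * \int[lebesgue_rV k]_y \int[lebesgue_rV r]_z g (gl (y, z)))%E) /\
  (forall A, measurable A ->
    (lebesgue_rV n A = c%:E * \int[lebesgue_rV k]_y lebesgue_rV r (fib A y))%E).
Proof.
have [c c0 cE] := ge0_integral_decomp BD1 BB DD BD DB; exists c => //.
split=> [g mg g0|A mA]; first exact: cE.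
have -> : lebesgue_rV n A = (\int[lebesgue_rV n]_x (\1_A x)%:E)%E.
  by rewrite integral_indic// setIT.
rewrite cE; last by move=> x; rewrite lee_fin.
  congr (_ * _)%E; apply: eq_integral => y _.
  transitivity (\int[lebesgue_rV r]_z (\1_(fib A y) z)%:E)%E.
    apply: eq_integral => z _; rewrite !indicE.
    by have -> : (gl (y, z) \in A) = (z \in fib A y) by apply/idP/idP; rewrite !inE.
  by rewrite integral_indic ?setIT//; exact: measurable_fib.
exact/measurable_EFinP/measurable_indic.
Qed.

Hypothesis centroidP : forall u, (\int[lebesgue_rV n]_(x in P) (dotv u x)%:E = 0)%E.

(** This is where the centroid enters: the linear part integrates to 0 over [P]. The factor has to
    be nonnegative on [P] because the decomposition is available for nonnegative functions. *)
Lemma tilted_volume c p l : 0 < c ->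
  (forall g : 'rV[R]_n -> \bar R, measurable_fun setT g -> (forall x, 0 <= g x)%E ->
    (\int[lebesgue_rV n]_x g x =
      c%:E * \int[lebesgue_rV k]_y \int[lebesgue_rV r]_z g (gl (y, z)))%E) ->
  (forall x, P x -> 0 <= 1 - l * dotv p (x *m D')) ->
  (lebesgue_rV n P = c%:E * \int[lebesgue_rV k]_y (fvol y * (1 - l * dotv p y))%:E)%E.
Proof.
move=> c0 cE pos; have mP := measurable_P.
pose u := p *m D'^T.
have uE x : dotv p (x *m D') = dotv u x by rewrite dotv_mulmx.
pose g x := ((1 - l * dotv u x) * \1_P x)%:E.
have mg : measurable_fun setT g.
  apply/measurable_EFinP; apply: measurable_funM; last exact: measurable_indic.
  apply: measurable_funB => //; apply: measurable_funM => //; exact: measurable_dotv.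
have g0 x : (0 <= g x)%E.
  rewrite /g indicE; have [Px|nPx] := pselect (P x).
    by rewrite mem_set// mulr1 lee_fin -uE pos.
  by rewrite memNset// mulr0.
have <- : (\int[lebesgue_rV n]_x g x = lebesgue_rV n P)%E.
  have -> : (\int[lebesgue_rV n]_x g x = \int[lebesgue_rV n]_(x in P) (1 - l * dotv u x)%:E)%E.
    rewrite [RHS]integral_mkcond; apply: eq_integral => x _; rewrite patchE /g indicE.
    by case: ifPn; rewrite ?mulr1 ?mulr0.
  have [N bN] := compact_bdd coP.
  under eq_integral do rewrite EFinB EFinM.
  rewrite integralB//; last 2 first.
  - apply: measurable_bounded_integrable => //.
      by have := bdd_fin_num mP bN; rewrite fin_numElt => /andP[].
    exact: bounded_cst.
  - by apply: integrableZl => //; exact: (bdd_integrable_dotv _ mP bN).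
  rewrite integral_cst// mul1e integralZl//; last exact: (bdd_integrable_dotv _ mP bN).
  by rewrite centroidP mule0 sube0.
rewrite cE//; congr (_ * _)%E; apply: eq_integral => y _.
transitivity (\int[lebesgue_rV r]_z ((1 - l * dotv p y) * \1_(fib P y) z)%:E)%E.
  apply: eq_integral => z _; rewrite /g -uE (unglue_glue1 y z) !indicE.
  by have -> : (gl (y, z) \in P) = (z \in fib P y) by apply/idP/idP; rewrite !inE.
(* Over points [y] with a negative factor the fibre is empty. *)
have [py|npy] := leP 0 (1 - l * dotv p y); last first.
  have fib0 : fib P y = set0.
    apply/seteqP; split => // z Pz; have := pos _ Pz.
    by rewrite (unglue_glue1 y z) leNgt npy.
  rewrite /fvol fib0 measure0 mul0r integral0_eq// => z _.
  by rewrite indicE in_set0 mulr0.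
have mf := measurable_fib y mP.
under eq_integral do rewrite EFinM.
rewrite ge0_integralZl_EFin//; last exact/measurable_EFinP/measurable_indic.
rewrite integral_indic// setIT [X in (_ * X)%E](_ : _ = (fvol y)%:E) -?EFinM 1?mulrC//.
exact: fvolE.
Qed.

(** Where the fibre has volume 0 the prefactor makes this 0, whatever the default value of [ln]
    there. *)
Definition defect p y := fvol y * (ln (fvol 0) + dotv p y - ln (fvol y)).

Lemma defect_ge0 p y : (forall y, 0 < fvol y -> ln (fvol y) <= ln (fvol 0) + dotv p y) ->
  0 <= defect p y.
Proof.
move=> pP; have := fvol_ge0 y; rewrite /defect le_eqVlt => /orP[/eqP<-|f0].
  by rewrite mul0r.
by rewrite mulr_ge0 ?fvol_ge0// subr_ge0 pP.
Qed.

Lemma measurable_defect p : measurable_fun setT (defect p).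
Proof.
apply: measurable_funM; first exact: measurable_fvol.
apply: measurable_funB.
  by apply: measurable_funD => //; exact: measurable_dotv.
by apply: measurableT_comp => //; exact: measurable_fvol.
Qed.

(* By log-concavity the fibre of the slab over [s *: y] has volume at least
   [f y ^ s * f 0 ^ (1 - s)], which is bounded below through [expR x >= 1 + x]. *)
Lemma slab_lower_bound m (a : 'I_m -> 'rV[R]_n) (h : 'I_m -> R) (Q : pred 'I_m) p c l :
  (forall i x, P x -> dotv (a i) x <= h i) -> (forall i, 0 < h i) ->
  (forall i, Q i -> B *m (a i)^T = 0) ->
  (forall y, 0 < fvol y -> ln (fvol y) <= ln (fvol 0) + dotv p y) ->
  0 < c ->
  (forall g : 'rV[R]_n -> \bar R, measurable_fun setT g -> (forall x, 0 <= g x)%E ->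
    (\int[lebesgue_rV n]_x g x =
      c%:E * \int[lebesgue_rV k]_y \int[lebesgue_rV r]_z g (gl (y, z)))%E) ->
  (forall A, measurable A ->
    (lebesgue_rV n A = c%:E * \int[lebesgue_rV k]_y lebesgue_rV r (fib A y))%E) ->
  0 < l -> l < 1 ->
  (forall x, P x -> 0 <= 1 - l * dotv p (x *m D')) ->
  (((1 - l) ^+ k)%:E * (lebesgue_rV n P + l%:E * (c%:E * \int[lebesgue_rV k]_y (defect p y)%:E)) <=
    lebesgue_rV n (slab P a h Q (1 - l)))%E.
Proof.
move=> Pa h0 Qa pP c0 cE cA l0 l1 pos; have mP := measurable_P.
have s0 : 0 < 1 - l by rewrite subr_gt0.
set X := slab P a h Q (1 - l).
have mX : measurable X by exact: measurable_slab.
have XP : X `<=` P by move=> x [].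
have dotB i z : Q i -> dotv (a i) (z *m B) = 0.
  by move=> Qi; rewrite dotvC dotvE -mulmxA Qa// mulmx0 mxE.
have low y : ((fvol y * (1 - l * dotv p y) + l * defect p y)%:E <=
    lebesgue_rV r (fib X ((1 - l) *: y)))%E.
  have := fvol_ge0 y; rewrite le_eqVlt => /orP[/eqP f0|f0].
    by rewrite /defect -f0 !mul0r mulr0 addr0.
  have := fvol_log_concave l0 l1 mX XP f0 fvol0_gt0 _; rewrite scaler0 addr0 => /(_ _)/(le_trans _); apply.
    rewrite lee_fin.
    have -> : (1 - l) * ln (fvol y) + l * ln (fvol 0) = ln (fvol y) + l * (ln (fvol 0) - ln (fvol y)) by ring.
    rewrite expRD lnK// /defect.
    have := ler_wpM2l (ltW f0) (expR_ge1Dx (l * (ln (fvol 0) - ln (fvol y)))).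
    apply: le_trans; rewrite le_eqVlt; apply/orP; left; apply/eqP; ring.
  move=> z z' Pz Pz'; split.
    by have := fib_cvx cP Pz Pz' (ltW l0) (ltW l1); rewrite scaler0 addr0.
  (* A normal in L does not see the coordinate along [B], so over [(1 - l) y] its value is [1 - l]
     times the value over [y], independently of the point mixed in from the fibre over 0. *)
  move=> i Qi; rewrite /glue_rV/= dotvDr dotB// add0r -scalemxAl dotvZr.
  apply: ler_wpM2l; first exact: ltW.
  by have := Pa i _ Pz; rewrite /glue_rV/= dotvDr dotB// add0r.
have mfX : measurable_fun setT (fun y => lebesgue_rV r (fib X y)).
  have := measurable_fun_xsection (lebesgue_rV r) (measurable_preimage (measurable_glue B D) mX).
  by apply: eq_measurable_fun => y _; rewrite /= xsectionE.
have fpos y : 0 <= fvol y * (1 - l * dotv p y).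
  have [<-|f0] := eqVneq 0 (fvol y); first by rewrite mul0r.
  have [z Pz] : exists z, fib P y z.
    apply: contrapT => /forallNP nz; move: f0; rewrite /fvol (_ : fib P y = set0) ?measure0 ?eqxx//.
    by apply/seteqP; split => // z /nz.
  by rewrite mulr_ge0 ?fvol_ge0//; have := pos _ Pz; rewrite unglue_glue1.
(* Substituting [(1 - l) y] for [y] costs [(1 - l) ^- k], the origin of the factor [k] in the final
   inequality. *)
have main : ((\int[lebesgue_rV k]_y (fvol y * (1 - l * dotv p y))%:E +
   l%:E * \int[lebesgue_rV k]_y (defect p y)%:E <=
   ((1 - l) ^- k)%:E * \int[lebesgue_rV k]_y lebesgue_rV r (fib X y)))%E.
  have si : 0 <= (1 - l) ^- k by rewrite invr_ge0 exprn_ge0// ltW.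
  have dil (A : set 'rV[R]_k) : measurable A ->
      lebesgue_rV k ((fun y : 'rV[R]_k => (1 - l) *: y) @^-1` A) =
      ((NngNum si)%:num%:E * lebesgue_rV k A)%E.
    move=> mA; have := lebesgue_rV_dilation (0 : 'rV[R]_k) s0 mA.
    move=> <-; congr (lebesgue_rV k (_ @^-1` A)).
    by apply/funext => y; rewrite addr0.
  have ms : measurable_fun setT (fun y : 'rV[R]_k => (1 - l) *: y) by exact: measurable_fun_rVZ.
  rewrite -(ge0_integral_dilation ms dil mfX)//.
  have mfp : measurable_fun setT (fun y => fvol y * (1 - l * dotv p y)).
    apply: measurable_funM; first exact: measurable_fvol.
    by apply: measurable_funB => //; apply: measurable_funM => //; exact: measurable_dotv.
  have md := measurable_defect p.
  have d0 y := defect_ge0 y pP.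
  rewrite -ge0_integralZl_EFin//; last 3 first.
  - by move=> y _; rewrite lee_fin.
  - exact/measurable_EFinP.
  - exact: ltW.
  rewrite -ge0_integralD//; last 4 first.
  - by move=> y _; rewrite lee_fin.
  - exact/measurable_EFinP.
  - by move=> y _; rewrite mule_ge0// lee_fin// ltW.
  - by apply: measurable_funeM; exact/measurable_EFinP.
  apply: ge0_le_integral => //.
  - by move=> y _; rewrite adde_ge0// ?mule_ge0// lee_fin// ltW.
  - by apply: emeasurable_funD; [|apply: measurable_funeM]; exact/measurable_EFinP.
  - exact: (measurableT_comp mfX).
  move=> y _; rewrite -EFinM -EFinD; exact: low.
rewrite (tilted_volume c0 cE pos) (cA X mX).
set I1 := (\int[_]_y (fvol y * _)%:E)%E in main *; set I2 := (\int[_]_y _%:E)%E in main *.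
set J := (\int[_]_y _)%E in main *.
have I20 : (0 <= l%:E * I2)%E.
  apply: mule_ge0; first by rewrite lee_fin ltW.
  by apply: integral_ge0 => y _; rewrite lee_fin defect_ge0.
have I10 : (0 <= I1)%E.
  apply: integral_ge0 => y _; rewrite lee_fin.
  exact: fpos.
rewrite [(l%:E * _)%E]muleCA -ge0_muleDr// muleCA.
apply: lee_wpmul2l; first by rewrite lee_fin ltW.
have sk : 0 < (1 - l) ^+ k by rewrite exprn_gt0.
apply: (@le_trans _ _ (((1 - l) ^+ k)%:E * (((1 - l) ^- k)%:E * J))%E).
  by apply: lee_wpmul2l; rewrite // lee_fin ltW.
by rewrite muleA -EFinM mulfV ?mul1e// gt_eqF.
Qed.

Lemma pos_tilt p : exists2 l0, 0 < l0 & forall l, 0 < l -> l <= l0 ->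
  forall x, P x -> 0 <= 1 - l * dotv p (x *m D').
Proof.
have [N bN] := compact_bdd coP.
pose M := 1 + `|N| * \sum_i `|(p *m D'^T) ord0 i|.
have M0 : 0 < M by rewrite ltr_pwDl// mulr_ge0// sumr_ge0.
exists M^-1; first by rewrite invr_gt0.
move=> l l0 lM x Px; rewrite dotv_mulmx subr_ge0.
have := dotv_bdd (p *m D'^T) (bddW (ler_norm N) bN) Px => /(le_trans (ler_norm _)) H.
have H' : dotv (p *m D'^T) x <= M by apply: (le_trans H); rewrite lerDr.
apply: (@le_trans _ _ (l * M)); first by rewrite ler_pM2l.
by rewrite -ler_pdivlMr// mul1r.
Qed.

(** The upper and lower estimates of the slab volume agree at [l = 0], so their linear coefficients
    in [l] are ordered. The defect integral is kept on the left because the equality case needs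
    it. *)
Lemma main_inequality m (a : 'I_m -> 'rV[R]_n) (h : 'I_m -> R) (F : 'I_m -> set 'rV[R]_n)
    (Q : pred 'I_m) :
  (forall i, 0 < h i) -> (forall i x, P x -> dotv (a i) x <= h i) ->
  (forall i, F i = P `&` [set x | dotv (a i) x = h i]) ->
  (forall i, F i !=set0) -> injective F ->
  (forall i, Q i -> B *m (a i)^T = 0) ->
  exists2 p, (forall y, 0 < fvol y -> ln (fvol y) <= ln (fvol 0) + dotv p y) &
  exists2 c, 0 < c &
  (n%:R%:E * \sum_(i < m | Q i) lebesgue_rV n (facet_cone (F i)) +
    c%:E * \int[lebesgue_rV k]_y (defect p y)%:E <= k%:R%:E * lebesgue_rV n P)%E.
Proof.
move=> h0 Pa FE F0 injF Qa.
have [p pP] := fvol_supergradient; exists p => //.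
have [c c0 [cE cA]] := fib_decomp; exists c => //.
have P0 : P 0 by exact: nbhs_singleton.
have [l0 l00 pos] := pos_tilt p.
have [N bN] := compact_bdd coP; have mP := measurable_P.
set S := (\sum_(i < m | Q i) _)%E; set I2 := (c%:E * _)%E.
have Sfin : S \is a fin_num.
  apply/sum_fin_numP => i _ Qi.
  apply: (@bdd_fin_num _ _ N); first exact: (measurable_cone coP cP FE F0 i).
  by move=> x Cx; apply: bN; exact: (cone_sub cP P0 FE F0 Cx).
have Pfin : lebesgue_rV n P \is a fin_num by exact: (bdd_fin_num mP bN).
have I20 : (0 <= I2)%E.
  apply: mule_ge0; first by rewrite lee_fin ltW.
  by apply: integral_ge0 => y _; rewrite lee_fin defect_ge0.
have key l : 0 < l -> l < 1 -> l <= l0 ->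
    (((1 - l) ^+ k)%:E * (lebesgue_rV n P + l%:E * I2) + (1 - (1 - l) ^+ n)%:E * S <= lebesgue_rV n P)%E.
  move=> lp l1 ll0.
  have s0 : 0 < 1 - l by rewrite subr_gt0.
  have s1 : 1 - l <= 1 by rewrite lerBlDr lerDl ltW.
  apply: le_trans (slab_measure coP cP P0 h0 Pa FE F0 injF Q s0 s1).
  apply: leeD => //; apply: slab_lower_bound => //.
  by move=> x Px; exact: pos.
(* A single admissible [l] suffices: an infinite [I2] would make the left side of [key] infinite. *)
have I2fin : I2 \is a fin_num.
  rewrite ge0_fin_numE// ltey; apply/eqP => I2oo.
  pose l := Num.min (1 / 2) l0.
  have lp : 0 < l by rewrite lt_min divr_gt0//=.
  have l1 : l < 1 by rewrite gt_min ltr_pdivrMr// mul1r ltr1n.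
  have ll0 : l <= l0 by rewrite ge_min lexx orbT.
  have s0 : 0 < 1 - l by rewrite subr_gt0.
  have := key l lp l1 ll0; rewrite I2oo gt0_muley ?lte_fin//.
  rewrite addey; last by rewrite -(fineK Pfin).
  rewrite gt0_muley ?lte_fin ?exprn_gt0// addye; last by rewrite -(fineK Sfin).
  by rewrite leye_eq -(fineK Pfin).
move: key; rewrite -(fineK Sfin) -(fineK Pfin) -(fineK I2fin).
set v := fine _; set s := fine S; set d := fine I2.
move=> key.
have {}key l : 0 < l -> l < 1 -> l <= l0 ->
    (1 - l) ^+ k * (v + l * d) + (1 - (1 - l) ^+ n) * s <= v.
  by move=> ? ? ?; rewrite -lee_fin; exact: key.
rewrite -!EFinM -EFinD lee_fin.
have v0 : 0 <= v by rewrite fine_ge0.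
have sp : 0 <= s by apply: fine_ge0; apply: sume_ge0.
have d0 : 0 <= d by rewrite fine_ge0.
have up j (l : R) : 0 < l -> l < 1 -> (1 - l) ^+ j <= 1 - j%:R * l + j%:R ^+ 2 * l ^+ 2.
  move=> lp l1; elim: j => [|j IH]; first by rewrite expr0 mul0r expr0n/= mul0r subr0 addr0.
  have l1' : 0 <= 1 - l by rewrite subr_ge0 ltW.
  rewrite exprS; apply: (le_trans (ler_wpM2l l1' IH)).
  rewrite -natr1; have := ler0n R j; set t := j%:R => t0; have := mulr_ge0 t0 t0 => tt0.
  have := mulr_ge0 tt0 (@exprn_ge0 R 3 l (ltW lp)) => h3.
  have := mulr_ge0 t0 (@exprn_ge0 R 2 l (ltW lp)) => h2.
  have := @exprn_ge0 R 2 l (ltW lp) => h1.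
  rewrite -subr_ge0 (_ : _ - _ = t * l ^+ 2 + l ^+ 2 + t * t * l ^+ 3); last by ring.
  by rewrite !addr_ge0.
have low j (l : R) : 0 < l -> l < 1 -> 1 - j%:R * l <= (1 - l) ^+ j.
  move=> lp l1; elim: j => [|j IH]; first by rewrite expr0 mul0r subr0.
  have l1' : 0 <= 1 - l by rewrite subr_ge0 ltW.
  rewrite exprS; apply: le_trans (ler_wpM2l l1' IH).
  rewrite -natr1; have := ler0n R j; set t := j%:R => t0.
  have := mulr_ge0 t0 (@exprn_ge0 R 2 l (ltW lp)) => h2.
  by rewrite -subr_ge0 (_ : _ - _ = t * l ^+ 2)//; ring.
rewrite leNgt; apply/negP => gap.
pose g := n%:R * s + d - k%:R * v; have g0 : 0 < g by rewrite subr_gt0.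
(* [C] collects the coefficients of [l ^+ 2]. The bound [l <= g / (2 (C + 1))] makes [l * C] smaller
   than [g], against [g <= l * C]. *)
pose C := k%:R * d + n%:R ^+ 2 * s.
have C0 : 0 <= C by rewrite addr_ge0// mulr_ge0// exprn_ge0.
pose l := Num.min (Num.min (1 / 2) l0) (g / (2 * (C + 1))).
have C1 : 0 < C + 1 by rewrite ltr_wpDl.
have lp : 0 < l by rewrite !lt_min divr_gt0//= l00 divr_gt0// mulr_gt0.
have l1 : l < 1 by rewrite !gt_min ltr_pdivrMr// mul1r ltr1n.
have ll0 : l <= l0 by rewrite !ge_min lexx orbT.
have lg : l * (2 * (C + 1)) <= g by rewrite -ler_pdivlMr ?mulr_gt0// !ge_min lexx !orbT.
have := key l lp l1 ll0.
have vld : 0 <= v + l * d by rewrite addr_ge0// mulr_ge0// ltW.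
have := ler_wpM2r vld (low k l lp l1).
have := ler_wpM2r sp (up n l lp l1).
set X := (1 - l) ^+ k * _; set Y := (1 - l) ^+ n * s.
move=> hY hX; rewrite mulrBl mul1r -/Y => hK.
have : l * g <= l * (l * C).
  have E : l * (l * C) - l * g = (v - (X + (s - Y))) + (X - (1 - k%:R * l) * (v + l * d)) + ((1 - n%:R * l + n%:R ^+ 2 * l ^+ 2) * s - Y).
    by rewrite /g /C; ring.
  by rewrite -subr_ge0 E; apply: addr_ge0; [apply: addr_ge0|]; rewrite subr_ge0.
rewrite ler_pM2l// => gC.
have : l * C <= l * (C + 1) by rewrite ler_pM2l// lerDl.
have := mulr_gt0 lp C1; lra.
Qed.

End fibres.

(** * Families of convex sets of constant volume *)

Section convex_family.
Context {R : realType} {r k : nat}.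
Variables (K : 'rV[R]_k -> set 'rV[R]_r) (N e : R).
Hypotheses (mK : forall y, measurable (K y)) (bK : forall y, bdd N (K y))
  (cK : forall y y' z z' t, K y z -> K y' z' -> 0 <= t -> t <= 1 ->
    K ((1 - t) *: y + t *: y') ((1 - t) *: z + t *: z'))
  (e0 : 0 < e) (eK : forall (y : 'rV[R]_k) (z : 'rV[R]_r), (forall i, `|y ord0 i| < e) ->
    (forall i, `|z ord0 i| < e) -> K y z).

Lemma family_cvx y : cvx (K y).
Proof.
move=> z z' t Kz Kz' t0 t1; have := cK Kz Kz' t0 t1.
by rewrite -scalerDl subrK scale1r.
Qed.

Definition vol y := fine (lebesgue_rV r (K y)).

Lemma volE y : lebesgue_rV r (K y) = (vol y)%:E.
Proof. by rewrite /vol fineK//; apply: (@bdd_fin_num _ _ N). Qed.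

(** As the family contains a cube around 0, this is the interior of the base, described by shrinking
    towards 0. Over such points the fibres contain cubes and have positive volume. *)
Definition inner y := exists t y', [/\ 0 <= t, t < 1, K y' !=set0 & y = t *: y'].

Lemma inner0 : inner 0.
Proof.
exists 0, 0; split; rewrite ?scaler0//.
by exists 0; apply: eK => i; rewrite mxE normr0.
Qed.

Lemma inner_near y : inner y -> exists2 d, 0 < d &
  forall w : 'rV[R]_k, (forall i, `|w ord0 i| < d) -> inner (y + w).
Proof.
move=> [t [y' [t0 t1 [z' Kz'] ->]]].
(* The room [s - t] left below 1 is filled with a multiple of the cube at 0, which absorbs the
   perturbation [w]. *)
pose s := (1 + t) / 2.
have ts : t < s by rewrite /s ltr_pdivlMr//; lra.
have s1 : s < 1 by rewrite /s ltr_pdivrMr//; lra.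
have s0 : 0 < s := le_lt_trans t0 ts.
exists (e * (s - t)); first by rewrite mulr_gt0// subr_gt0.
move=> w we; exists s, ((1 - (s - t) / s) *: y' + ((s - t) / s) *: ((s - t)^-1 *: w)).
have st : 0 < s - t by rewrite subr_gt0.
split => //; first exact: ltW.
  exists ((1 - (s - t) / s) *: z' + ((s - t) / s) *: 0); apply: cK => //.
  - apply: eK => i; last by rewrite mxE normr0.
    by rewrite mxE normrM gtr0_norm ?invr_gt0// mulrC ltr_pdivrMr.
  - by rewrite divr_ge0 ?ltW.
  - by rewrite ler_pdivrMr// mul1r lerBlDr lerDl.
have sn : s != 0 by rewrite gt_eqF.
have stn : s - t != 0 by rewrite gt_eqF.
rewrite scalerDr !scalerA.
have -> : s * (1 - (s - t) / s) = t by field.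
have -> : s * ((s - t) / s) / (s - t) = 1 by field; rewrite sn stn.
by rewrite scale1r.
Qed.

Lemma inner_cvx y y' t : inner y -> inner y' -> 0 <= t -> t <= 1 ->
  inner ((1 - t) *: y + t *: y').
Proof.
move=> [s [x [s0 s1 [z Kz] ->]]] [s' [x' [s'0 s'1 [z' Kz'] ->]]] t0 t1.
pose c := (1 - t) * s + t * s'.
have t1' : 0 <= 1 - t by rewrite subr_ge0.
have c0 : 0 <= c by rewrite addr_ge0// mulr_ge0.
have c1 : c < 1.
  rewrite /c; have [->|tn0] := eqVneq t 0; first by rewrite subr0 mul0r mul1r addr0.
  have h1 := ler_wpM2l t1' (ltW s1).
  have tp : 0 < t by rewrite lt_neqAle eq_sym tn0.
  have h2 : t * s' < t * 1 by rewrite ltr_pM2l.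
  lra.
have [cE|cn0] := eqVneq c 0.
  have /eqP := cE; rewrite paddr_eq0 ?mulr_ge0// => /andP[/eqP h1 /eqP h2].
  by rewrite !scalerA h1 h2 !scale0r addr0; exact: inner0.
exists c, ((1 - t * s' / c) *: x + (t * s' / c) *: x'); split => //.
  exists ((1 - t * s' / c) *: z + (t * s' / c) *: z'); apply: cK => //.
    by rewrite divr_ge0// mulr_ge0.
  by rewrite ler_pdivrMr ?mul1r ?lerDr ?mulr_ge0// lt_neqAle eq_sym cn0.
rewrite scalerDr !scalerA; congr (_ *: _ + _ *: _); rewrite /c; field; by rewrite -/c.
Qed.

Lemma inner_cube y : inner y -> exists2 d, 0 < d & exists z0 : 'rV[R]_r,
  forall z : 'rV[R]_r, (forall i, `|z ord0 i - z0 ord0 i| < d) -> K y z.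
Proof.
move=> [t [y' [t0 t1 [z' Kz'] ->]]].
have s0 : 0 < 1 - t by rewrite subr_gt0.
exists (e * (1 - t)); first by rewrite mulr_gt0.
exists (t *: z') => z ze.
have K0 : K 0 ((1 - t)^-1 *: (z - t *: z')).
  apply: eK => i; first by rewrite mxE normr0.
  rewrite mxE normrM gtr0_norm ?invr_gt0// mulrC ltr_pdivrMr//.
  by have := ze i; rewrite !mxE.
have := cK K0 Kz' t0 (ltW t1).
by rewrite scaler0 add0r scalerA mulfV ?gt_eqF// scale1r subrK.
Qed.

Lemma vol_gt0 y : inner y -> 0 < vol y.
Proof.
move=> /inner_cube[d d0 [z0 H]]; rewrite -lte_fin -volE.
exact: (lebesgue_rV_cube_gt0 d0 (mK y) H).
Qed.

Lemma vol_concave y y' l : 0 < l -> l < 1 -> inner y -> inner y' ->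
  (1 - l) * ln (vol y) + l * ln (vol y') <= ln (vol ((1 - l) *: y + l *: y')).
Proof.
move=> l0 l1 Oy Oy'.
have Om := inner_cvx Oy Oy' (ltW l0) (ltW l1).
rewrite -ler_expR lnK ?posrE ?vol_gt0// -lee_fin -volE.
apply: (@brunn_minkowski _ _ (K y) (K y') _ N) => //; try exact: family_cvx.
- by move=> z z' Kz Kz'; apply: cK => //; exact: ltW.
- by rewrite volE lnK// posrE vol_gt0.
- by rewrite volE lnK// posrE vol_gt0.
Qed.

Section constant_volume.
Variables (p : 'rV[R]_k) (Z : set 'rV[R]_k).
Hypotheses (r0 : (0 < r)%N) (mZ : measurable Z) (Z0 : lebesgue_rV k Z = 0%E)
  (volp : forall y, 0 < vol y -> ln (vol y) <= ln (vol 0) + dotv p y)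
  (volZ : forall y, ~ Z y -> 0 < vol y -> ln (vol y) = ln (vol 0) + dotv p y).

(** Only [>=] is missing. Since [Z] and its reflection in [y] are null, some small [w] has both
    [y + w] and [y - w] outside [Z]; concavity at their midpoint [y] gives the bound. *)
Let vol_exp y : inner y -> ln (vol y) = ln (vol 0) + dotv p y.
Proof.
move=> Oy; apply/eqP; rewrite eq_le volp ?vol_gt0//=.
have [d d0 Od] := inner_near Oy.
pose C := [set w : 'rV[R]_k | forall i, `]-d, d[%classic (w ord0 i)].
have mC : measurable C.
  rewrite (_ : C = \bigcap_(i in [set: 'I_k]) (rV_coord i @^-1` `]-d, d[%classic)).
    apply: fin_bigcap_measurable => // i _.
    by apply: measurable_preimage => //; exact: measurable_rV_coord.
  by apply/seteqP; split => [w h i _|w h i]; exact: h.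
have VC : (0 < lebesgue_rV k C)%E.
  apply: (lebesgue_rV_cube_gt0 (x := 0) d0 mC) => w wd i /=.
  by have := wd i; rewrite mxE subr0 in_itv/= ltr_norml.
have [w [Cw [nZ1 nZ2]]] : exists w, C w /\ ~ Z (y + w) /\ ~ Z (y - w).
  apply: contrapT => /forallNP nw.
  have sub : C `<=` ((fun w => w + y) @^-1` Z) `|` ((fun w => - w) @^-1` ((fun w => w + y) @^-1` Z)).
    move=> w Cw; apply: contrapT => /not_orP[h1 h2]; apply: (nw w); split => //; split.
      by rewrite addrC.
    by rewrite addrC.
  have mZy : measurable ((fun w : 'rV[R]_k => w + y) @^-1` Z).
    by apply: measurable_preimage => //; exact: measurable_fun_rVD.
  have mZy' : measurable ((fun w : 'rV[R]_k => - w) @^-1` ((fun w => w + y) @^-1` Z)).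
    apply: measurable_preimage => //.
    rewrite (_ : (fun w => _) = (fun w => (-1) *: w)); first exact: measurable_fun_rVZ.
    by apply/funext => w; rewrite scaleN1r.
  have := le_measure (lebesgue_rV k) _ _ sub; rewrite !inE => /(_ mC (measurableU _ _ mZy mZy')).
  rewrite leNgt => /negP; apply; apply: (le_lt_trans _ VC).
  apply: (@le_trans _ _ (lebesgue_rV k ((fun w => w + y)%R @^-1` Z) +
    lebesgue_rV k ((fun w => - w)%R @^-1` ((fun w => w + y)%R @^-1` Z)))%E).
    exact: measureU2.
  by rewrite lebesgue_rV_opp// lebesgue_rV_translation// Z0 adde0.
have wd i : `|w ord0 i| < d by have := Cw i; rewrite /= in_itv/= -ltr_norml.
have O1 : inner (y + w) by exact: Od.
have O2 : inner (y - w) by apply: Od => i; rewrite mxE normrN.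
have h2 : (0 : R) < 2^-1 by rewrite invr_gt0.
have h21 : 2^-1 < 1 :> R by rewrite invf_lt1// ltr1n.
have := vol_concave h2 h21 O1 O2.
rewrite (volZ nZ1 (vol_gt0 O1)) (volZ nZ2 (vol_gt0 O2)).
have -> : (1 - 2^-1) *: (y + w) + 2^-1 *: (y - w) = y.
  rewrite (_ : 1 - 2^-1 = 2^-1 :> R); last by field.
  by rewrite -scalerDr addrACA subrr addr0 -mulr2n -(scaler_nat 2 y) scalerA mulVf ?scale1r ?pnatr_eq0.
rewrite !dotvDr dotvNr; lra.
Qed.

(* Brunn-Minkowski for [K 0] and [K y] rescaled to the volume of [K 0] bounds the volume over
   [y / 2] from below; log-affinity of [vol] allows this only if the scaling factor is 1. *)
Let tilt0 y : inner y -> dotv p y = 0.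
Proof.
move=> Oy.
have rn : r%:R != 0 :> R by rewrite pnatr_eq0 -lt0n.
(* [x ^+ (2 r)] is the ratio of the volumes over [y] and over 0, so [A], which is [K y] shrunk by
   [x ^+ 2], has the volume of [K 0]. *)
pose u := dotv p y; pose x := expR (u / (2 * r%:R)).
have x0 : 0 < x := expR_gt0 _.
pose M := (x ^+ 2 + 1) / 2.
have M0 : 0 < M by rewrite divr_gt0// addr_gt0// exprn_gt0.
pose A := (fun z : 'rV[R]_r => (x ^+ 2) *: z + 0) @^-1` K y.
pose C := (fun z : 'rV[R]_r => M *: z + 0) @^-1` K (2^-1 *: y).
have x20 : 0 < x ^+ 2 by rewrite exprn_gt0.
have h2 : (0 : R) < 2^-1 by rewrite invr_gt0.
have h21 : 2^-1 < 1 :> R by rewrite invf_lt1// ltr1n.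
have Oy2 : inner (2^-1 *: y).
  have := inner_cvx inner0 Oy (ltW h2) (ltW h21).
  by rewrite scaler0 add0r.
have VA : lebesgue_rV r A = (vol 0)%:E.
  rewrite /A lebesgue_rV_dilation// volE -EFinM; congr EFin.
  rewrite -(lnK (vol_gt0 Oy)) vol_exp// expRD lnK ?posrE ?vol_gt0//; last exact: inner0.
  have -> : expR (dotv p y) = x ^+ 2 ^+ r.
    rewrite -exprM -expRM_natl; congr expR; rewrite /u natrM; field.
    by rewrite rn.
  by rewrite mulrCA mulVf ?mulr1// expf_neq0// gt_eqF.
have VC : lebesgue_rV r C = (M ^- r * (vol 0 * x ^+ r))%:E.
  rewrite /C lebesgue_rV_dilation// volE -EFinM; congr (_ * _)%:E.
  rewrite -(lnK (vol_gt0 Oy2)) vol_exp// expRD lnK ?posrE ?vol_gt0//; last exact: inner0.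
  congr (_ * _); rewrite dotvZr -expRM_natl; congr expR; rewrite /u; field.
  by rewrite rn.
have mA : measurable A.
  by apply: measurable_preimage => //; apply: measurable_fun_rVD => //; exact: measurable_fun_rVZ.
have mC : measurable C.
  by apply: measurable_preimage => //; apply: measurable_fun_rVD => //; exact: measurable_fun_rVZ.
(* With this weight, [M] times the combination of [z] in [A] and [z'] in [K 0] is the midpoint of
   [x ^+ 2 z] and [z'], a point of the fibre over [y / 2]. The outcome is [M <= x], that is
   [(x - 1) ^+ 2 <= 0]. *)
pose l := (2 * M)^-1.
have l0 : 0 < l by rewrite invr_gt0 mulr_gt0.
have M2 : 2 * M = x ^+ 2 + 1 by rewrite /M mulrC divfK.
have l1 : l < 1.
  have M20 : 0 < 2 * M by rewrite mulr_gt0.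
  by rewrite /l invf_lt1// M2 ltrDr.
have v0 : 0 < vol 0 by apply: vol_gt0; exact: inner0.
have bd (s : R) (B : set 'rV[R]_r) : 0 < s -> bdd N B -> bdd (`|N| / s) ((fun z : 'rV[R]_r => s *: z + 0) @^-1` B).
  move=> s0 bB z Bz i; have := bB _ Bz i; rewrite !mxE addr0 normrM (gtr0_norm s0) => h.
  by rewrite ler_pdivlMr// mulrC (le_trans h)// ler_norm.
pose N' := `|N| + `|N| / x ^+ 2 + `|N| / M.
have : ((expR ((1 - l) * ln (vol 0) + l * ln (vol 0)))%:E <= lebesgue_rV r C)%E.
  apply: (@brunn_minkowski _ _ A (K 0) C N') => //.
  - move=> z z' t Az Az' t0 t1; rewrite /A/= !addr0 in Az Az' *.
    have := family_cvx Az Az' t0 t1; congr (K y _).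
    by rewrite scalerDr !scalerA !(mulrC (x ^+ 2)).
  - exact: family_cvx.
  - have bA : bdd (`|N| / x ^+ 2) A by exact (bd _ _ x20 (@bK y)).
    apply: bddW bA; rewrite /N' addrAC lerDr.
    by rewrite addr_ge0// divr_ge0// ltW.
  - have bB := @bK 0; apply: bddW bB; rewrite /N' -addrA (le_trans (ler_norm _))// lerDl.
    by rewrite addr_ge0// divr_ge0// ltW.
  - have bC : bdd (`|N| / M) C by exact (bd _ _ M0 (@bK _)).
    apply: bddW bC; rewrite /N' lerDr.
    by rewrite addr_ge0// divr_ge0// ltW.
  - move=> z z' Az Kz'; rewrite /C/=; rewrite /A/= addr0 in Az.
    have := cK Az Kz' (ltW h2) (ltW h21); rewrite scaler0 !addr0.
    rewrite (_ : 1 - 2^-1 = 2^-1 :> R); last by field.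
    congr (K _ _); rewrite scalerDr !scalerA; congr (_ *: _ + _ *: _); rewrite /l M2 /M; field.
      by rewrite gt_eqF// addr_gt0.
    by rewrite gt_eqF// addr_gt0.
  - by rewrite VA lnK.
  - by rewrite volE lnK.
rewrite -mulrDl subrK mul1r lnK// VC lee_fin mulrCA ler_pMr// mulrC ler_pdivlMr ?exprn_gt0// mul1r.
have xn := ltW x0; have Mn := ltW M0.
rewrite ler_pXn2r ?nnegrE// => Mx.
have x1 : x = 1.
  have : (x - 1) ^+ 2 <= 0 by rewrite /M ler_pdivrMr// in Mx; rewrite sqrrB1; lra.
  by rewrite le_eqVlt ltNge sqr_ge0 orbF sqrf_eq0 subr_eq0 => /eqP.
have /eqP : u / (2 * r%:R) = 0 by rewrite -(expRK (u / _)) -/x x1 ln1.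
by rewrite mulf_eq0 invr_eq0 mulf_eq0 (negbTE rn) pnatr_eq0/= orbF => /eqP.
Qed.

Lemma vol_const y : inner y -> vol y = vol 0.
Proof.
move=> Oy; have := vol_exp Oy; rewrite tilt0// addr0 => E.
by rewrite -(lnK (vol_gt0 Oy)) E lnK// posrE vol_gt0//; exact: inner0.
Qed.

End constant_volume.

End convex_family.

(* Both [a0 s + a1 t] and [a0 t + a1 s] dominate the midpoint value of [a0 + a1], so the
   increments of [a1 - a0] are bounded by second differences of [a0 + a1], which telescope. *)
Lemma const_diff (R : realType) (a0 a1 : R -> R) :
  (forall s t, s < 0 -> t < 0 -> a0 ((s + t) / 2) + a1 ((s + t) / 2) <= a0 s + a1 t) ->
  (forall s t, s <= t -> t < 0 -> a0 s <= a0 t) ->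
  (forall s t, s <= t -> t < 0 -> a1 s <= a1 t) ->
  forall s t, s < 0 -> t < 0 -> a1 s - a0 s = a1 t - a0 t.
Proof.
move=> mid m0 m1.
pose S (x : R) := a0 x + a1 x; pose D (x : R) := a1 x - a0 x.
have mS (s t : R) : s <= t -> t < 0 -> S s <= S t.
  by move=> st t0; rewrite lerD ?m0 ?m1.
have half (x h : R) : (x + (x + h + h)) / 2 = x + h by field.
have conv (x h : R) : 0 <= h -> x + h + h < 0 -> S (x + h) - S x <= S (x + h + h) - S (x + h).
  move=> h0 xh; have x0 : x < 0 by lra.
  have := mid x _ x0 xh; have := mid _ x xh x0; rewrite [_ + x]addrC half /S; lra.
have incr (x h : R) : 0 <= h -> x + h + h < 0 ->
    `|D (x + h + h) - D x| <= S (x + h + h) - S (x + h) - (S (x + h) - S x).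
  move=> h0 xh; have x0 : x < 0 by lra.
  have := mid x _ x0 xh; have := mid _ x xh x0; rewrite [_ + x]addrC half /S /D => h1 h2.
  by rewrite ler_norml; apply/andP; split; lra.
have tele (x h : R) (j : nat) : 0 <= h -> x + j%:R * (h + h) + h < 0 ->
    `|D (x + j%:R * (h + h)) - D x| <=
      (S (x + j%:R * (h + h) + h) - S (x + j%:R * (h + h))) - (S (x + h) - S x).
  move=> h0; elim: j => [|j IH]; first by rewrite mul0r addr0 !subrr normr0.
  have -> : x + j.+1%:R * (h + h) = x + j%:R * (h + h) + h + h by rewrite -natr1; ring.
  set y := x + j%:R * (h + h) => yh.
  have := IH _; rewrite -/y => /(_ _) IH'.
  have h1 : `|D y - D x| <= S (y + h) - S y - (S (x + h) - S x) by apply: IH'; lra.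
  have yh2 : y + h + h < 0 by lra.
  have h2 := incr y h h0 yh2.
  have h3 := conv (y + h) h h0 yh.
  have := ler_distD (D y) (D (y + h + h)) (D x); lra.
(* Right continuity of the convex function [S]: [J] increments of step [h] fit between [t] and
   [t / 2], each at least as large as the first, and their sum is at most [W]. *)
have small (t w : R) : t < 0 -> 0 < w -> exists2 h0, 0 < h0 & forall h, 0 <= h -> h <= h0 ->
    t + h < 0 /\ S (t + h) - S t <= w.
  move=> t0 w0; pose W := S (t / 2) - S t.
  have W0 : 0 <= W by rewrite subr_ge0 mS//; lra.
  have [J JW] : exists J : nat, W / w < J%:R.
    by exists (Num.bound (W / w)); apply: archi_boundP; rewrite divr_ge0// ltW.
  have J0 : 0 < J%:R :> R by apply: le_lt_trans JW; rewrite divr_ge0// ltW.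
  exists (- t / 2 / J%:R); first by rewrite !divr_gt0// oppr_gt0.
  move=> h h0 hJ; have Jh : J%:R * h <= - t / 2 by rewrite mulrC -ler_pdivlMr.
  have key i : (i <= J)%N -> i%:R * (S (t + h) - S t) <= S (t + i%:R * h) - S t /\
     ((0 < i)%N -> S (t + h) - S t <= S (t + i%:R * h) - S (t + i%:R * h - h)).
    elim: i => [|i IH] iJ; first by rewrite !mul0r addr0 subrr.
    have [IH1 IH2] := IH (ltnW iJ).
    have iJh : i.+1%:R * h <= - t / 2.
      by apply: le_trans Jh; rewrite ler_wpM2r// ler_nat.
    have E : t + i.+1%:R * h = t + i%:R * h + h by rewrite -natr1; ring.
    have st : S (t + h) - S t <= S (t + i.+1%:R * h) - S (t + i.+1%:R * h - h).
      rewrite E addrK; case: i iJ {IH} IH1 IH2 iJh E => [|i] iJ _ IH2 iJh E.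
        by rewrite mul0r addr0.
      apply: (le_trans (IH2 isT)).
      have := conv (t + i.+1%:R * h - h) h h0; rewrite subrK; apply.
      by rewrite -E; lra.
    split => //; rewrite -natr1 mulrDl mul1r.
    have : S (t + i.+1%:R * h - h) = S (t + i%:R * h) by rewrite E addrK.
    move=> E'; rewrite E' in st; rewrite natr1; lra.
  have J1 : (0 < J)%N by rewrite -(ltr0n R).
  have [k1 _] := key J (leqnn _).
  split.
    have : h <= J%:R * h by rewrite ler_peMl// ler1n.
    lra.
  have : J%:R * (S (t + h) - S t) <= W.
    apply: (le_trans k1); rewrite lerD2r; apply: mS; lra.
  move=> JS; rewrite -(ler_pM2l J0); apply: (le_trans JS).
  by rewrite -ler_pdivrMr// ltW.
(* [tele] bounds the difference by the increment of [S] at [t], which [small] makes at most half of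
   that same difference. *)
have main (s t : R) : s < t -> t < 0 -> D t = D s.
  move=> st t0; apply/eqP; rewrite -subr_eq0 -normr_le0 leNgt; apply/negP => dpos.
  have [h0 h00 hP] := small t _ t0 (divr_gt0 dpos (ltr0n R 2)).
  have [n nP] : exists n : nat, (t - s) / h0 < n%:R.
    by exists (Num.bound ((t - s) / h0)); apply: archi_boundP; rewrite divr_ge0 ?ltW// subr_gt0.
  have n0 : 0 < n%:R :> R by apply: le_lt_trans nP; rewrite divr_ge0 ?ltW// subr_gt0.
  pose h := (t - s) / n%:R / 2.
  have hp : 0 < h by rewrite !divr_gt0// subr_gt0.
  have tE : s + n%:R * (h + h) = t by rewrite /h; field; rewrite gt_eqF.
  have hh : h <= h0.
    have : (t - s) / n%:R <= h0.
      by rewrite ler_pdivrMr// mulrC -ler_pdivrMr// ltW.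
    by move=> hn; rewrite /h ler_pdivrMr// (le_trans hn)// ler_peMr ?ler1n// ltW.
  have ht : h <= (t - s) / 2.
    have n1 : (0 < n)%N by rewrite -(ltr0n R).
    by rewrite /h ler_pM2r ?invr_gt0// ler_pdivrMr// ler_peMr ?ler1n// subr_ge0 ltW.
  clearbody h.
  have [th Sth] := hP h (ltW hp) hh.
  have := tele s h n (ltW hp); rewrite tE => /(_ th).
  have sh : s + h < 0 by lra.
  have : S s <= S (s + h) by apply: mS => //; lra.
  move: Sth.
  lra.
move=> s t s0 t0; have [st|ts|->//] := ltgtP s t.
  by rewrite -/(D s) -/(D t) (main s t).
by rewrite -/(D s) -/(D t) (main t s).
Qed.

(** * Distribution of a linear functional on a convex set *)

Section sublevel.
Context {R : realType} {r : nat}.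
Variables (b : 'rV[R]_r) (N v : R).
Hypothesis v0 : 0 < v.

Definition low (A : set 'rV[R]_r) c := fine (lebesgue_rV r (A `&` [set x | dotv b x <= c])).

(** The level is logarithmic so that multiplicative Brunn-Minkowski becomes a statement on midpoints
    of [tau]; negative [tau] are exactly the levels strictly between 0 and the full volume [v]. *)
Definition quantile (A : set 'rV[R]_r) tau := inf [set c | v * expR tau <= low A c].

Lemma measurable_above c : measurable [set x : 'rV[R]_r | c < dotv b x].
Proof.
rewrite (_ : mkset _ = ~` [set x | dotv b x <= c]).
  by apply: measurableC; exact: measurable_halfspace.
by apply/seteqP; split => x /=; rewrite ltNge => /negP.
Qed.

Let M := `|N| * \sum_i `|b ord0 i|.

Section one_set.
Variable A : set 'rV[R]_r.
Hypotheses (mA : measurable A) (bA : bdd N A) (vA : lebesgue_rV r A = v%:E).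

Let AM x : A x -> - M <= dotv b x /\ dotv b x <= M.
Proof.
by move=> Ax; have := dotv_bdd b (bddW (ler_norm N) bA) Ax; rewrite ler_norml => /andP.
Qed.

Lemma measurable_low c : measurable (A `&` [set x | dotv b x <= c]).
Proof. by apply: measurableI => //; exact: measurable_halfspace. Qed.

Lemma lowE c : lebesgue_rV r (A `&` [set x | dotv b x <= c]) = (low A c)%:E.
Proof.
rewrite fineK//; apply: (@bdd_fin_num _ _ N); first exact: measurable_low.
by move=> x [/bA].
Qed.

Lemma aboveE c : lebesgue_rV r (A `&` [set x | c < dotv b x]) = (v - low A c)%:E.
Proof.
have mB : measurable (A `&` [set x | c < dotv b x]).
  by apply: measurableI => //; exact: measurable_above.
have : lebesgue_rV r A = (lebesgue_rV r (A `&` [set x | (dotv b x <= c)%R]) +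
    lebesgue_rV r (A `&` [set x | (c < dotv b x)%R]))%E.
  rewrite -measureU//; last 2 first.
  - exact: measurable_low.
  - by apply/seteqP; split => // x /= [[_ h] [_]]; rewrite ltNge h.
  congr (lebesgue_rV r _); rewrite -setIUr; apply/seteqP; split => [x Ax|x []//].
  by split => //; have [h|h] := leP (dotv b x) c; [left|right].
rewrite vA lowE => H.
have fB : lebesgue_rV r (A `&` [set x | c < dotv b x]) \is a fin_num.
  by apply: (@bdd_fin_num _ _ N) => // x [/bA].
move: H; rewrite -(fineK fB) -EFinD => -[->]; congr EFin; ring.
Qed.

Lemma low_mono c c' : c <= c' -> low A c <= low A c'.
Proof.
move=> cc; rewrite -lee_fin -!lowE; apply: le_measure; rewrite ?inE; try exact: measurable_low.
by apply: setIS => x /= /le_trans; apply.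
Qed.

Lemma low_le c : low A c <= v.
Proof. by rewrite -subr_ge0 -lee_fin -aboveE. Qed.

Lemma low_top c : M <= c -> low A c = v.
Proof.
move=> Mc; apply: EFin_inj; rewrite -lowE -vA; congr (lebesgue_rV r _).
by apply/seteqP; split => [x []//|x Ax]; split => //=; rewrite (le_trans (AM Ax).2).
Qed.

Lemma low_bot c : c < - M -> low A c = 0.
Proof.
move=> cM; apply: EFin_inj; rewrite -lowE (_ : _ `&` _ = set0) ?measure0//.
apply/seteqP; split => // x [Ax /= xc]; have := (AM Ax).1.
by rewrite leNgt (le_lt_trans xc cM).
Qed.

Let level tau : v * expR tau <= v -> [set c | v * expR tau <= low A c] !=set0 /\
  has_lbound [set c | v * expR tau <= low A c].
Proof.
move=> t0; split; first by exists M; rewrite /= low_top.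
exists (- M) => c /= h; rewrite leNgt; apply/negP => /low_bot cE.
by move: h; rewrite cE leNgt mulr_gt0 ?expR_gt0.
Qed.

Let tle tau : tau < 0 -> v * expR tau <= v.
Proof. by move=> t0; rewrite ger_pMr// -expR0 ler_expR ltW. Qed.

Lemma quantile_le tau c : tau < 0 -> v * expR tau <= low A c -> quantile A tau <= c.
Proof. by move=> t0 h; have [_ lb] := level (tle t0); exact: ge_inf. Qed.

Lemma quantile_lt tau c : tau < 0 -> quantile A tau < c -> v * expR tau <= low A c.
Proof.
move=> t0 h; have [n0 _] := level (tle t0).
have [c' h' /ltW cc] := inf_lt n0 h.
exact: le_trans h' (low_mono cc).
Qed.

Lemma le_quantile tau c : tau < 0 -> low A c < v * expR tau -> c <= quantile A tau.
Proof.
by move=> t0 h; rewrite leNgt; apply/negP => /(quantile_lt t0); rewrite leNgt h.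
Qed.

Lemma lt_quantile tau c : tau < 0 -> c < quantile A tau -> low A c < v * expR tau.
Proof.
by move=> t0 h; rewrite ltNge; apply/negP => /(quantile_le t0); rewrite leNgt h.
Qed.

Lemma quantile_mono s t : s <= t -> t < 0 -> quantile A s <= quantile A t.
Proof.
move=> st t0; apply/ler_addgt0Pr => e e0.
apply: quantile_le; first exact: le_lt_trans t0.
apply: (@le_trans _ _ (v * expR t)); first by rewrite ler_pM2l// ler_expR.
by apply: quantile_lt => //; rewrite ltrDl.
Qed.

End one_set.

(** The distribution of the functional on [A'] lies at most [D] to the right of that on [A]. The
    slack [e] dispenses with continuity of [low]. *)
Definition dominated (A A' : set 'rV[R]_r) D :=
  forall c e, 0 < e -> low A c <= low A' (c + D + e).

Lemma quantile_dominated A A' D :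
  measurable A -> bdd N A -> lebesgue_rV r A = v%:E ->
  measurable A' -> bdd N A' -> lebesgue_rV r A' = v%:E ->
  (forall tau, tau < 0 -> quantile A' tau <= quantile A tau + D) -> dominated A A' D.
Proof.
move=> mA bA vA mA' bA' vA' H c e e0.
have low0 : 0 <= low A' (c + D + e) by rewrite fine_ge0.
rewrite leNgt; apply/negP => ll.
have [w wE] : exists w, w = (low A' (c + D + e) + low A c) / 2 by eexists.
have w0 : 0 < w by rewrite wE; lra.
have wlow : w < low A c by rewrite wE; lra.
suff : w <= low A' (c + D + e) by rewrite wE; lra.
have wv : w < v := lt_le_trans wlow (low_le mA bA vA c).
have t0 : ln (w / v) < 0 by rewrite ln_lt0// divr_gt0//= ltr_pdivrMr// mul1r.
have vw : v * expR (ln (w / v)) = w by rewrite lnK ?posrE ?divr_gt0//= mulrC divfK// gt_eqF.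
rewrite -vw; apply: quantile_lt => //; apply: (le_lt_trans (H _ t0)).
rewrite (@le_lt_trans _ _ (c + D))// ?ltrDl// lerD2r.
by apply: quantile_le; rewrite // vw ltW.
Qed.

Section translates.
Variables A0 A1 Am : set 'rV[R]_r.
Hypotheses (m0 : measurable A0) (b0 : bdd N A0) (v0' : lebesgue_rV r A0 = v%:E) (c0 : cvx A0).
Hypotheses (m1 : measurable A1) (b1 : bdd N A1) (v1 : lebesgue_rV r A1 = v%:E) (c1 : cvx A1).
Hypotheses (mm : measurable Am) (bm : bdd N Am) (vm : lebesgue_rV r Am = v%:E).
Hypothesis mid : forall x y, A0 x -> A1 y -> Am ((1 - 2^-1) *: x + 2^-1 *: y).

Let h2 : (0 : R) < 2^-1. Proof. by rewrite invr_gt0. Qed.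
Let h21 : 2^-1 < 1 :> R. Proof. by rewrite invf_lt1// ltr1n. Qed.

Let mid_low c c' s t : s < 0 -> t < 0 ->
  v * expR s <= low A0 c -> v * expR t <= low A1 c' ->
  v * expR ((s + t) / 2) <= low Am ((c + c') / 2).
Proof.
move=> s0 t0 Hs Ht; rewrite -lee_fin -(lowE mm bm).
have -> : v * expR ((s + t) / 2) = expR ((1 - 2^-1) * (ln v + s) + 2^-1 * (ln v + t)).
  transitivity (expR (ln v + (s + t) / 2)); first by rewrite expRD lnK.
  by congr expR; field.
apply: (@brunn_minkowski _ _ (A0 `&` [set x | dotv b x <= c])
  (A1 `&` [set x | dotv b x <= c']) _ N) => //; try exact: measurable_low.
- move=> x y l [A0x xc] [A0y yc] l0 l1; split; first exact: c0.
  by rewrite /= dotvDr !dotvZr in xc yc *; nra.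
- move=> x y l [A0x xc] [A0y yc] l0 l1; split; first exact: c1.
  by rewrite /= dotvDr !dotvZr in xc yc *; nra.
- by move=> x [/b0].
- by move=> x [/b1].
- by move=> x [/bm].
- move=> x y [A0x xc] [A1y yc]; split; first exact: mid.
  by rewrite /= dotvDr !dotvZr in xc yc *; lra.
- by rewrite lowE// lee_fin expRD lnK.
- by rewrite lowE// lee_fin expRD lnK.
Qed.

Let lt_cvx (c x y l : R) : c < x -> c < y -> 0 <= l -> l <= 1 -> c < (1 - l) * x + l * y.
Proof.
move=> cx cy l0 l1; have [xy|yx] := leP x y.
  by apply: (lt_le_trans cx); have : 0 <= l * (y - x); [rewrite mulr_ge0// subr_ge0|lra].
apply: (lt_le_trans cy); have : 0 <= (1 - l) * (x - y); last by lra.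
by rewrite mulr_ge0// subr_ge0// ltW.
Qed.

Let mid_above c c' w : 0 < w -> w <= v - low A0 c -> w <= v - low A1 c' ->
  w <= v - low Am ((c + c') / 2).
Proof.
move=> w0 H0 H1; rewrite -lee_fin -(aboveE mm bm)//.
have -> : w = expR ((1 - 2^-1) * ln w + 2^-1 * ln w).
  by rewrite -mulrDl subrK mul1r lnK.
apply: (@brunn_minkowski _ _ (A0 `&` [set x | c < dotv b x])
  (A1 `&` [set x | c' < dotv b x]) _ N) => //;
  try (by apply: measurableI => //; exact: measurable_above).
- move=> x y l [A0x xc] [A0y yc] l0 l1; split; first exact: c0.
  by rewrite /= dotvDr !dotvZr; exact: lt_cvx.
- move=> x y l [A0x xc] [A0y yc] l0 l1; split; first exact: c1.
  by rewrite /= dotvDr !dotvZr; exact: lt_cvx.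
- by move=> x [/b0].
- by move=> x [/b1].
- by move=> x [/bm].
- move=> x y [A0x xc] [A1y yc]; split; first exact: mid.
  by rewrite /= dotvDr !dotvZr in xc yc *; lra.
- by rewrite aboveE// lee_fin lnK.
- by rewrite aboveE// lee_fin lnK.
Qed.

Let quantile_mid_le s t : s < 0 -> t < 0 ->
  quantile Am ((s + t) / 2) <= (quantile A0 s + quantile A1 t) / 2.
Proof.
move=> s0 t0; apply/ler_addgt0Pr => e e0.
rewrite (_ : _ + e = (quantile A0 s + e + (quantile A1 t + e)) / 2); last by field.
apply: quantile_le => //; first by lra.
by apply: mid_low => //; apply: quantile_lt => //; rewrite ltrDl.
Qed.

(** Brunn-Minkowski for the lower parts gives [<=]. All three sets have volume [v], so the upper
    parts have complementary volumes, and Brunn-Minkowski for them gives [>=]. *)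
Let quantile_mid t : t < 0 -> quantile Am t = (quantile A0 t + quantile A1 t) / 2.
Proof.
move=> t0; apply/eqP; rewrite eq_le; apply/andP; split.
  by have := quantile_mid_le t0 t0; rewrite (_ : (t + t) / 2 = t)//; field.
apply/ler_addgt0Pr => e e0; rewrite -lerBlDr.
rewrite (_ : _ - e = (quantile A0 t - e + (quantile A1 t - e)) / 2); last by field.
apply: le_quantile => //.
have Q0 : low A0 (quantile A0 t - e) < v * expR t by apply: lt_quantile => //; rewrite ltrBlDr ltrDl.
have Q1 : low A1 (quantile A1 t - e) < v * expR t by apply: lt_quantile => //; rewrite ltrBlDr ltrDl.
(* Just below the quantiles both upper parts have volume at least [w], and [w] exceeds the
   complementary level. *)
pose w := v - Num.max (low A0 (quantile A0 t - e)) (low A1 (quantile A1 t - e)).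
have wt : v - v * expR t < w by rewrite ltrD2l ltrN2 gt_max Q0.
have w0 : 0 < w.
  by apply: le_lt_trans wt; rewrite subr_ge0 ger_pMr// -expR0 ler_expR ltW.
have : w <= v - low Am ((quantile A0 t - e + (quantile A1 t - e)) / 2).
  by apply: mid_above => //; rewrite lerD2l lerN2 le_max lexx ?orbT.
lra.
Qed.

(** [const_diff] applies to the two quantile functions: at equal levels the midpoint set attains the
    mean, at unequal levels it is bounded by it. The constant difference [D] is read off at the
    arbitrary level -1. *)
Lemma dominated_translate : exists D, [/\ dominated A0 A1 D, dominated A1 A0 (- D),
  dominated A0 Am (D / 2) & dominated Am A0 (- (D / 2))].
Proof.
have H s t : s < 0 -> t < 0 -> quantile A1 s - quantile A0 s = quantile A1 t - quantile A0 t.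
  move=> s0 t0; apply: (@const_diff _ (quantile A0) (quantile A1)) => //.
  - move=> x y x0 y0; have xy : (x + y) / 2 < 0 by lra.
    have := quantile_mid_le x0 y0; rewrite quantile_mid//; lra.
  - exact: quantile_mono.
  - exact: quantile_mono.
have n1 : -1 < 0 :> R by rewrite oppr_lt0.
exists (quantile A1 (-1) - quantile A0 (-1)); split; apply: quantile_dominated => // t t0.
- by rewrite (H _ t)// addrC subrK.
- by rewrite (H _ t)//; lra.
- by rewrite (H _ t)// quantile_mid//; lra.
- by rewrite (H _ t)// quantile_mid//; lra.
Qed.

End translates.

End sublevel.

(** * Centroids and supports of sets with translated distributions *)

Section centroids.
Context {R : realType} {r : nat}.
Local Notation V := (lebesgue_rV r).

Lemma integral_dotv (A : set 'rV[R]_r) (N : R) u : measurable A -> bdd N A ->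
  0 < fine (V A) ->
  (\int[V]_(x in A) (dotv u x)%:E = (fine (V A) * dotv u (centroid A))%:E)%E.
Proof.
move=> mA bA A0.
have icoord i : V.-integrable A (EFin \o (fun x => x ord0 i)).
  have := bdd_integrable_dotv (delta_mx ord0 i) mA bA.
  rewrite (_ : dotv _ = (fun x => x ord0 i))//; apply/funext => x.
  rewrite /dotv (bigD1 i)//= mxE !eqxx mul1r big1 ?addr0// => j ji.
  by rewrite mxE (negbTE ji) andbF mul0r.
under eq_integral do rewrite /dotv -sumEFin.
rewrite (@integral_sum _ _ _ _ _ _ _ (fun i (x : 'rV[R]_r) => (u ord0 i * x ord0 i)%:E))//; last first.
  by move=> i; under eq_fun do rewrite EFinM; apply: integrableZl => //; exact: icoord.
rewrite /dotv mulr_sumr -sumEFin; apply: eq_bigr => i _.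
under eq_integral do rewrite EFinM.
rewrite integralZl//; last exact: icoord.
rewrite mxE mulrCA mulVKf ?gt_eqF// EFinM; congr (_ * _)%E.
by rewrite /Rintegral fineK//; apply: integrable_fin_num => //; exact: icoord.
Qed.

(** Shifted to be nonnegative, the functionals are compared by the layer-cake formula, level by
    level; equal volumes allow the shifts to be subtracted again. *)
Lemma dominated_centroid (A A' : set 'rV[R]_r) b (N v D : R) : 0 < v ->
  measurable A -> bdd N A -> V A = v%:E ->
  measurable A' -> bdd N A' -> V A' = v%:E ->
  dominated b A A' D -> dotv b (centroid A') <= dotv b (centroid A) + D.
Proof.
move=> v0 mA bA vA mA' bA' vA' dom; apply/ler_addgt0Pr => e e0.
(* The summand for [D] keeps the functional nonnegative after the second shift, by [M + D + e]. *)
pose M := `|N| * \sum_i `|b ord0 i| + `|D|.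
have AM B x : bdd N B -> B x -> 0 <= M - `|D| + dotv b x.
  move=> bB Bx; have := dotv_bdd b (bddW (ler_norm N) bB) Bx.
  by rewrite ler_norml => /andP[+ _]; rewrite /M addrK -lerBlDl sub0r.
pose g (B : set 'rV[R]_r) (c : R) x := (c + dotv b x) * \1_B x.
have mg B c : measurable B -> measurable_fun setT (g B c).
  move=> mB; apply: measurable_funM; last exact: measurable_indic.
  by apply: measurable_funD => //; exact: measurable_dotv.
have ig B c : measurable B -> bdd N B -> V B = v%:E ->
    (\int[V]_x (g B c x)%:E = (v * (c + dotv b (centroid B)))%:E)%E.
  move=> mB bB vB.
  have -> : (\int[V]_x (g B c x)%:E = \int[V]_(x in B) (c + dotv b x)%:E)%E.
    rewrite [RHS]integral_mkcond; apply: eq_integral => x _; rewrite patchE /g indicE.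
    by case: ifPn; rewrite ?mulr1 ?mulr0.
  under eq_integral do rewrite EFinD.
  rewrite integralD//; last 2 first.
  - apply: measurable_bounded_integrable => //; last exact: bounded_cst.
    by have := bdd_fin_num mB bB; rewrite fin_numElt => /andP[].
  - exact: (bdd_integrable_dotv _ mB bB).
  have fB : fine (V B) = v by rewrite vB.
  have -> : (\int[V]_(x in B) c%:E = (c * v)%:E)%E.
    by transitivity (c%:E * V B)%E; [exact: integral_cst|rewrite vB -EFinM].
  rewrite (integral_dotv _ mB bB) fB// -EFinD.
  by congr EFin; ring.
have g0 B c x : bdd N B -> M - `|D| <= c -> 0 <= g B c x.
  move=> bB cM; rewrite /g indicE; have [Bx|nBx] := pselect (B x).
    by rewrite mem_set// mulr1 (le_trans (AM _ _ bB Bx))// lerD2r.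
  by rewrite memNset// mulr0.
have lev B c u : 0 < u -> [set x | u < g B c x] = B `&` [set x | u - c < dotv b x].
  move=> u0; apply/seteqP; split => x; rewrite /g /= indicE.
    have [Bx|nBx] := pselect (B x); first by rewrite mem_set// mulr1 ltrBlDl.
    by rewrite memNset// mulr0 ltNge ltW.
  by move=> [Bx]; rewrite mem_set// mulr1 ltrBlDl.
have mlev (k : 'rV[R]_r -> R) : measurable_fun setT k ->
    measurable_fun setT (fun u : R => V [set x | u < k x]).
  move=> mk.
  pose C := (fun p : 'rV[R]_r * measurableTypeR R => (p.2 < k p.1)%R) @^-1` [set true].
  have mC : measurable C.
    apply: (@measurable_preimage _ _ _ _
      (fun p : 'rV[R]_r * measurableTypeR R => (p.2 < k p.1)%R)) => //.
    by apply: measurable_fun_ltr => //; exact: measurableT_comp.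
  have := measurable_fun_ysection V mC.
  by apply: eq_measurable_fun => u _; rewrite /= ysectionE.
have MD : M - `|D| <= M by rewrite lerBlDr lerDl.
have MDe : M - `|D| <= M + D + e.
  by have := ler_norm (- D); rewrite normrN; clear -e0; lra.
have : (\int[V]_x (g A' M x)%:E <= \int[V]_x (g A (M + D + e) x)%:E)%E.
  rewrite !layer_cake//; try (by move=> x; exact: g0); try exact: mg.
  apply: ge0_le_integral => //.
  - by apply: measurable_funTS; apply: mlev; exact: mg.
  - by apply: measurable_funTS; apply: mlev; exact: mg.
  move=> u; rewrite /= in_itv/= andbT => u0; rewrite !lev//.
  rewrite (aboveE _ mA' bA' vA') (aboveE _ mA bA vA) lee_fin lerD2l lerN2.
  by have := dom (u - (M + D + e)) e e0; rewrite (_ : _ + D + e = u - M)//; ring.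
rewrite !ig// lee_fin ler_pM2l//; lra.
Qed.

(** If [x] were too high, contracting the cube around [z0] towards [x] would give a part of [A] of
    positive volume above the level [c - D + e], below which domination by [A'] already places all
    of [A]. *)
Lemma dominated_support (A A' : set 'rV[R]_r) b (N v D c d : R) (x z0 : 'rV[R]_r) : 0 < v ->
  measurable A -> bdd N A -> V A = v%:E -> cvx A ->
  measurable A' -> bdd N A' -> V A' = v%:E ->
  0 < d -> (forall z : 'rV[R]_r, (forall i, `|z ord0 i - z0 ord0 i| < d) -> A z) ->
  dominated b A' A (- D) -> A x -> A' `<=` [set y | dotv b y <= c] ->
  dotv b x + D <= c.
Proof.
move=> v0 mA bA vA cA mA' bA' vA' d0 dA dom Ax A'c; rewrite leNgt; apply/negP => cD.
pose e := (dotv b x + D - c) / 2.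
have e0 : 0 < e by rewrite divr_gt0// subr_gt0.
have full : low b A' c = v.
  apply: EFin_inj; rewrite -(lowE _ mA' bA') -vA'; congr (V _).
  by apply/seteqP; split => [y []//|y A'y]; split => //; exact: A'c.
have := dom c e e0; rewrite full => H.
have : (0 < V (A `&` [set y | (c - D + e < dotv b y)%R]))%E; last first.
  by rewrite (aboveE _ mA bA vA) lte_fin; lra.
have ce : c - D + e = dotv b x - e by rewrite /e; field.
(* [S] exceeds the change of the functional from [x] to any point of the cube, so contraction by [l]
   changes it by less than [e]. *)
pose S := 1 + \sum_i `|b ord0 i| * (d + `|z0 ord0 i - x ord0 i|).
have S0 : 0 < S.
  by rewrite ltr_pwDl// sumr_ge0// => i _; rewrite mulr_ge0// addr_ge0// ltW.
pose l := Num.min 1 (e / S).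
have l0 : 0 < l by rewrite lt_min ltr01 divr_gt0.
have l1 : l <= 1 by rewrite ge_min lexx.
have lS : l * S <= e by rewrite -ler_pdivlMr// ge_min lexx orbT.
apply: (@lebesgue_rV_cube_gt0 _ _ _ ((1 - l) *: x + l *: z0) (l * d)).
- by rewrite mulr_gt0.
- by apply: measurableI => //; exact: measurable_above.
move=> y yd.
have [z yE] : exists z, y = (1 - l) *: x + l *: z.
  by exists (l^-1 *: (y - (1 - l) *: x)); rewrite scalerA mulfV ?gt_eqF// scale1r addrC subrK.
have zd i : `|z ord0 i - z0 ord0 i| < d.
  have := yd i; rewrite yE !mxE [X in `|X|](_ : _ = l * (z ord0 i - z0 ord0 i)).
    by rewrite normrM gtr0_norm// ltr_pM2l.
  by ring.
have Az : A z by exact: dA.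
split; first by rewrite yE; apply: cA => //; exact: ltW.
rewrite /= ce yE (_ : _ + _ = x + l *: (z - x)); last first.
  by rewrite scalerBl scale1r scalerBr addrA addrAC.
rewrite dotvDr ltrD2l dotvZr ltrNl -mulrN -dotvNr opprB.
apply: (@lt_le_trans _ _ (l * S)) => //.
rewrite ltr_pM2l//; apply: (le_lt_trans (ler_norm _)).
rewrite /S ltr_pwDl//; apply: (le_trans (ler_norm_sum _ _ _)).
apply: ler_sum => i _; rewrite normrM ler_wpM2l// !mxE.
rewrite -normrN opprB (_ : _ - _ = (z ord0 i - z0 ord0 i) + (z0 ord0 i - x ord0 i)); last by ring.
by apply: (le_trans (ler_normD _ _)); rewrite lerD2r ltW.
Qed.

Section translates.
Variables (A0 A1 Am : set 'rV[R]_r) (N v : R).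
Hypothesis v0 : 0 < v.
Hypotheses (m0 : measurable A0) (b0 : bdd N A0) (v0' : V A0 = v%:E) (c0 : cvx A0).
Hypotheses (m1 : measurable A1) (b1 : bdd N A1) (v1 : V A1 = v%:E) (c1 : cvx A1).
Hypotheses (mm : measurable Am) (bm : bdd N Am) (vm : V Am = v%:E).
Hypothesis mid : forall x y, A0 x -> A1 y -> Am ((1 - 2^-1) *: x + 2^-1 *: y).

Lemma centroid_mid b :
  dotv b (centroid Am) = (dotv b (centroid A0) + dotv b (centroid A1)) / 2.
Proof.
have [D [d01 d10 d0m dm0]] := dominated_translate b v0 m0 b0 v0' c0 m1 b1 v1 c1 mm bm vm mid.
have := dominated_centroid v0 m0 b0 v0' m1 b1 v1 d01.
have := dominated_centroid v0 m1 b1 v1 m0 b0 v0' d10.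
have := dominated_centroid v0 m0 b0 v0' mm bm vm d0m.
have := dominated_centroid v0 mm bm vm m0 b0 v0' dm0.
lra.
Qed.

(** [D] is at least the displacement of the centroids along [b], which eliminates [D] from
    [dominated_support]. *)
Lemma centroid_support b (c d : R) (x z0 : 'rV[R]_r) :
  0 < d -> (forall z : 'rV[R]_r, (forall i, `|z ord0 i - z0 ord0 i| < d) -> A0 z) ->
  A0 x -> A1 `<=` [set y | dotv b y <= c] ->
  dotv b x + dotv b (centroid A1) - dotv b (centroid A0) <= c.
Proof.
move=> d0 dA A0x A1c.
have [D [d01 d10 _ _]] := dominated_translate b v0 m0 b0 v0' c0 m1 b1 v1 c1 mm bm vm mid.
have := dominated_centroid v0 m0 b0 v0' m1 b1 v1 d01.
have := dominated_support v0 m0 b0 v0' c0 m1 b1 v1 d0 dA d10 A0x A1c.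
lra.
Qed.

End translates.

End centroids.

(** * Facets over a family of constant volume *)

Section constant_fibres.
Context {R : realType} {r k : nat}.
Variables (K : 'rV[R]_k -> set 'rV[R]_r) (N e : R).
Hypotheses (mK : forall y, measurable (K y)) (bK : forall y, bdd N (K y))
  (cK : forall y y' z z' t, K y z -> K y' z' -> 0 <= t -> t <= 1 ->
    K ((1 - t) *: y + t *: y') ((1 - t) *: z + t *: z'))
  (e0 : 0 < e) (eK : forall (y : 'rV[R]_k) (z : 'rV[R]_r), (forall i, `|y ord0 i| < e) ->
    (forall i, `|z ord0 i| < e) -> K y z).
Hypothesis volK : forall y, inner K y -> vol K y = vol K 0.

Let v := vol K 0.
Let v0 : 0 < v.
Proof. exact: (vol_gt0 mK bK cK e0 eK (inner0 e0 eK)). Qed.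

Let VK y : inner K y -> lebesgue_rV r (K y) = v%:E.
Proof. by move=> /volK vy; rewrite (volE mK bK) vy. Qed.

Let Oh y y' : inner K y -> inner K y' -> inner K ((1 - 2^-1) *: y + 2^-1 *: y').
Proof.
by move=> Oy Oy'; apply: (inner_cvx cK e0 eK) => //; rewrite invf_le1// ler1n.
Qed.

Let Kmid y y' z z' : K y z -> K y' z' ->
  K ((1 - 2^-1) *: y + 2^-1 *: y') ((1 - 2^-1) *: z + 2^-1 *: z').
Proof.
by move=> Kz Kz'; apply: cK => //; rewrite invf_le1// ler1n.
Qed.

(** The value of the functional [(b, c)] at the centroid of the fibre over [y], as a point of the
    total space. *)
Let cen b c y := dotv b (centroid (K y)) + dotv c y.

Let cen_mid b c y y' : inner K y -> inner K y' ->
  cen b c ((1 - 2^-1) *: y + 2^-1 *: y') = (cen b c y + cen b c y') / 2.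
Proof.
move=> Oy Oy'; rewrite /cen (centroid_mid v0 (mK y) (@bK y) (VK Oy) (family_cvx cK (y := y))
  (mK y') (@bK y') (VK Oy') (family_cvx cK (y := y')) (mK _) (@bK _) (VK (Oh Oy Oy'))).
  by rewrite dotvDr !dotvZr; field.
by move=> x x'; exact: Kmid.
Qed.

(** The functional reaches its bound [h] in the fibre over [y]. By [centroid_support] the other
    fibres are displaced like their centroids, so a larger value at another centroid would push that
    fibre beyond [h]. *)
Let cen_max b c h y z y' : (forall y z, K y z -> dotv b z + dotv c y <= h) ->
  inner K y -> K y z -> dotv b z + dotv c y = h -> inner K y' -> cen b c y' <= cen b c y.
Proof.
move=> Kh Oy Kz E Oy'; have [d d0 [z0 Hz0]] := inner_cube cK e0 eK Oy.
have H := centroid_support v0 (mK y) (@bK y) (VK Oy) (family_cvx cK (y := y))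
  (mK y') (@bK y') (VK Oy') (family_cvx cK (y := y')) (mK _) (@bK _) (VK (Oh Oy Oy'))
  (fun _ _ => @Kmid _ _ _ _) (b := b) (c := h - dotv c y') d0 Hz0 Kz.
have : dotv b z + dotv b (centroid (K y')) - dotv b (centroid (K y)) <= h - dotv c y'.
  by apply: H => z' Kz' /=; rewrite lerBrDr; exact: Kh.
by rewrite /cen -E; lra.
Qed.

(* [cen b c] is midpoint affine and maximal at the foot of a point of the facet, hence constant
   around it, and then, by midpoint affinity again, constant around [0]. *)
Let cen_const b c h y z : (forall y z, K y z -> dotv b z + dotv c y <= h) ->
  inner K y -> K y z -> dotv b z + dotv c y = h ->
  exists2 d, 0 < d & forall w : 'rV[R]_k, (forall i, `|w ord0 i| < d) -> cen b c w = cen b c 0.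
Proof.
move=> Kh Oy Kz E; have [d d0 Od] := inner_near cK e0 eK Oy.
have O0 := inner0 e0 eK; have [d' d'0 Od'] := inner_near cK e0 eK O0.
exists (Num.min d d'); first by rewrite lt_min d0.
move=> w wd.
have wd1 i : `|w ord0 i| < d by have := wd i; rewrite lt_min => /andP[].
have wd2 i : `|w ord0 i| < d' by have := wd i; rewrite lt_min => /andP[].
have Ow : inner K w by have := Od' w wd2; rewrite add0r.
have Oyw : inner K (y + w) by exact: Od.
have Oyw' : inner K (y - w) by apply: Od => i; rewrite mxE normrN.
have half (u1 u2 u3 u4 : 'rV[R]_k) : u1 + u2 = u3 + u4 ->
    (1 - 2^-1) *: u1 + 2^-1 *: u2 = (1 - 2^-1) *: u3 + 2^-1 *: u4 :> 'rV[R]_k.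
  by move=> u12; rewrite (_ : 1 - 2^-1 = 2^-1) -?scalerDr ?u12//; field.
have m1 := cen_max Kh Oy Kz E Oyw; have m2 := cen_max Kh Oy Kz E Oyw'.
have E1 : cen b c (y + w) + cen b c (y - w) = cen b c y + cen b c y.
  apply: (mulIf (_ : 2^-1 != 0)); first by rewrite invr_eq0 pnatr_eq0.
  rewrite -(cen_mid b c Oyw Oyw') -(cen_mid b c Oy Oy); congr (cen b c _).
  by apply: half; rewrite addrACA subrr addr0.
have E2 : cen b c w + cen b c y = cen b c 0 + cen b c (y + w).
  apply: (mulIf (_ : 2^-1 != 0)); first by rewrite invr_eq0 pnatr_eq0.
  rewrite -(cen_mid b c Ow Oy) -(cen_mid b c O0 Oyw); congr (cen b c _).
  by apply: half; rewrite add0r addrC.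
lra.
Qed.

(** Local constancy of [cen] at 0 along the coordinate vectors expresses [c j] through [b j] and
    difference quotients of the centroid. These form [T] and do not involve [j]. *)
Lemma facet_graph m (b : 'I_m -> 'rV[R]_r) (c : 'I_m -> 'rV[R]_k) (h : 'I_m -> R)
    (Q : pred 'I_m) :
  (forall j y z, Q j -> K y z -> dotv (b j) z + dotv (c j) y <= h j) ->
  (forall j, Q j -> exists y z, [/\ inner K y, K y z & dotv (b j) z + dotv (c j) y = h j]) ->
  exists T, forall j, Q j -> c j = b j *m T.
Proof.
move=> Kh H.
have /choice[d dP] : forall j, exists d, 0 < d /\ (Q j -> forall w : 'rV[R]_k,
    (forall i, `|w ord0 i| < d) -> cen (b j) (c j) w = cen (b j) (c j) 0).
  move=> j; case: (boolP (Q j)) => [Qj|_]; last by exists 1.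
  have [y [z [Oy Kz E]]] := H j Qj.
  have [d d0 dP] := cen_const (fun y z => Kh j y z Qj) Oy Kz E.
  by exists d.
(* A single increment below all [d j], so that one matrix serves every [j]. *)
pose t := (\big[Num.min/1]_j d j) / 2.
have t0 : 0 < t by rewrite divr_gt0// lt_bigmin// => j _; have [] := dP j.
have td j : t < d j.
  apply: (@lt_le_trans _ _ (\big[Num.min/1]_j d j)); last exact: bigmin_le_cond.
  rewrite /t ltr_pdivrMr// ltr_pMr ?ltr1n//.
  by rewrite lt_bigmin// => i _; have [] := dP i.
pose w i : 'rV[R]_k := t *: delta_mx ord0 i.
have wd i j i' : `|w i ord0 i'| < d j.
  rewrite !mxE eqxx/=; case: eqVneq => _; rewrite ?mulr1 ?mulr0 ?normr0.
    by rewrite gtr0_norm.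
  by have [] := dP j.
exists (\matrix_(l, i) (- t^-1 * (centroid (K (w i)) - centroid (K 0)) ord0 l)) => j Qj.
apply/rowP => i.
have [_ /(_ Qj)/(_ (w i) (fun i' => wd i j i'))] := dP j.
rewrite /cen dotv0 addr0 => E.
have cw : dotv (c j) (w i) = t * c j ord0 i.
  rewrite /dotv (bigD1 i)//= big1 ?addr0 => [|i' ii'].
    by rewrite !mxE !eqxx mulr1 mulrC.
  by rewrite !mxE (negbTE ii') andbF !mulr0.
have {}E : t * c j ord0 i = - dotv (b j) (centroid (K (w i)) - centroid (K 0)).
  by rewrite -cw dotvDr dotvNr; lra.
rewrite -[LHS](@mulKf _ t) ?gt_eqF//.
rewrite E mulrN -mulNr /dotv mulr_sumr mxE; apply: eq_bigr => l _.
by rewrite !mxE; ring.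
Qed.

End constant_fibres.

(** * The equality case *)

Section relative_interior.
Context {R : realType} {n : nat}.
Implicit Types (S P F : set 'rV[R]_n) (a x w : 'rV[R]_n).

Lemma finite_span S : exists s : seq 'rV[R]_n,
  (forall x, x \in s -> S x) /\ (forall x, S x -> x \in << s >>%VS).
Proof.
pose Q d := asbool (exists s : seq 'rV[R]_n, (forall x, x \in s -> S x) /\ \dim << s >>%VS = d).
have Q0 : exists d, Q d by exists 0%N; apply/asboolP; exists [::]; rewrite span_nil dimv0.
have Qn d : Q d -> (d <= n)%N.
  move=> /asboolP[s [_ <-]]; apply: leq_trans (dimvS (subvf _)) _.
  by rewrite dimvf dim_matrix mul1r.
have [d /asboolP[s [sS sd]] dmax] := ex_maxnP Q0 Qn.
exists s; split => // x Sx.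
have sub : (<< s >> <= <<x :: s>>)%VS by rewrite span_cons addvSr.
have : Q (\dim <<x :: s>>).
  apply/asboolP; exists (x :: s); split => // y; rewrite inE => /orP[/eqP->//|]; exact: sS.
move=> /dmax; rewrite -sd => dle.
have /eqP -> : (<< s >> == <<x :: s>>)%VS by rewrite eqEdim sub.
by apply: memv_span; rewrite inE eqxx.
Qed.

(** The point is the barycentre of [x0] and further points of [F] whose differences from [x0] span
    [perp a]. A direction in [perp a] is a combination of these points with coefficients summing to
    0, so a small step only perturbs positive weights. *)
Lemma facet_relative_interior P F a : cvx F -> interior P 0 -> facets P F ->
  outer_unit_normal P F a ->
  exists2 x, F x & forall w, dotv a w = 0 -> exists2 e, 0 < e & F (x + e *: w).
Proof.
move=> cF intP facF normF.
have [h [h0 Ph a0 [x0 Fx0] FE]] := facet_normal intP facF normF.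
have Fh x : F x -> dotv a x = h by rewrite FE => -[].
have [_ [k kn [x1 [L [aff dL]]]]] := facF.
have [s [sF Fs]] := finite_span [set x - x0 | x in F].
have aff_s : affine_set [set x | x - x0 \in << s >>%VS].
  move=> x y t /= xs ys.
  rewrite (_ : _ - x0 = t *: (x - x0) + (1 - t) *: (y - x0)); last first.
    by rewrite scalerBr [(1 - t) *: (y - x0)]scalerBr addrACA -opprD -scalerDl addrCA subrr addr0 scale1r.
  by rewrite rpredD// rpredZ.
have hull_s : affine_hull F `<=` [set x | x - x0 \in << s >>%VS].
  by apply: affine_hull_sub => // x Fx /=; apply: Fs; exists x.
have Ls : (L <= << s >>)%VS.
  apply/subvP => u uL.
  have h1 : x1 + u - x0 \in << s >>%VS by apply: hull_s; rewrite aff; exists u.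
  have h2 : x1 + 0 - x0 \in << s >>%VS by apply: hull_s; rewrite aff; exists 0 => //=; rewrite mem0v.
  have := rpredB h1 h2.
  by rewrite addr0 opprB addrA subrK addrC addrA addNr add0r.
have sE : << s >>%VS = perp a.
  apply/eqP; rewrite eqEdim; apply/andP; split.
    apply/span_subvP => _ /sF[x Fx <-].
    by rewrite mem_perp dotvDr dotvNr !Fh// subrr.
  by rewrite -ltnS dim_perp// -[X in (X <= _)%N]kn ltnS -dL dimvS.
pose m := size s.
pose p (i : 'I_m.+1) := x0 + (0 :: s)`_i.
have Fp i : F (p i).
  rewrite /p; have : (0 :: s)`_i \in 0 :: s by rewrite mem_nth.
  rewrite inE => /orP[/eqP->|/sF[x Fx <-]]; first by rewrite addr0.
  by rewrite addrC subrK.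
have dirP w : dotv a w = 0 -> exists c : 'I_m.+1 -> R, \sum_i c i = 0 /\ w = \sum_i c i *: p i.
  move=> /eqP; rewrite -mem_perp -sE => ws.
  have := coord_span (ws : w \in <<in_tuple s>>%VS) => wE.
  pose c0 i := coord (in_tuple s) i w.
  have [T TE] : exists T, T = \sum_j c0 j by eexists.
  (* The base point [x0] receives the weight [- T], which brings the sum to 0. *)
  exists (fun i => if unlift ord0 i is Some j then c0 j else - T).
  have E1 : \sum_(i < m.+1) (if unlift ord0 i is Some j then c0 j else - T) = 0.
    rewrite big_ord_recl unlift_none; under eq_bigr do rewrite liftK.
    by rewrite TE addNr.
  split => //; under eq_bigr do rewrite /p scalerDr.
  rewrite big_split/= -scaler_suml E1 scale0r add0r big_ord_recl/= scaler0 add0r.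
  by rewrite wE; apply: eq_bigr => i _; rewrite liftK/=.
pose q : R := m.+1%:R^-1.
have q0 : 0 < q by rewrite invr_gt0.
exists (\sum_i q *: p i).
  apply: cvx_sum => //; first by move=> i; exact: ltW.
  by rewrite sumr_const card_ord -mulr_natr mulVf// pnatr_eq0.
move=> w /dirP[c [c0 ->]].
(* Since each [|c i|] is at most [C], the weights [q + q / C * c i] stay nonnegative. *)
pose C := 1 + \sum_i `|c i|.
have C0 : 0 < C by rewrite ltr_pwDl// sumr_ge0.
exists (q / C); first by rewrite divr_gt0.
rewrite scaler_sumr -big_split/=.
rewrite (eq_bigr (fun i => (q + q / C * c i) *: p i)); last first.
  by move=> i _; rewrite scalerA -scalerDl.
apply: cvx_sum => //; last first.
  rewrite big_split/= -mulr_sumr c0 mulr0 addr0 sumr_const card_ord -mulr_natr.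
  by rewrite mulVf// pnatr_eq0.
move=> i; rewrite -{1}[q]mulr1 -mulrA -mulrDr mulr_ge0 ?(ltW q0)//.
have : `|c i| <= C.
  rewrite /C (bigD1 i)//= addrCA lerDl addr_ge0// sumr_ge0//.
rewrite ler_norml => /andP[ci _].
by rewrite -[1](mulVf (lt0r_neq0 C0)) -mulrDr mulr_ge0 ?invr_ge0 ?(ltW C0)// -lerBlDl sub0r.
Qed.

End relative_interior.

Section graph_complement.
Context {R : realType} {n r k : nat}.

(** The graph is the kernel of a map to R^k, hence has dimension at least n - k. On L the [B]-part
    vanishes, so a common vector [y *m D] is orthogonal to every row of [D] and is 0. *)
Lemma graph_complementary (L : {vspace 'rV[R]_n}) (B : 'M[R]_(r, n)) (D : 'M[R]_(k, n))
    (T : 'M[R]_(r, k)) : \dim L = k -> (forall x, x \in L -> exists y, x = y *m D) ->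
  B *m D^T = 0 ->
  exists L', complementary L L' /\ forall x : 'rV[R]_n, x *m D^T = x *m B^T *m T -> x \in L'.
Proof.
move=> dL LD BD.
pose f := linfun (mulmxr (D^T - B^T *m T) : 'rV[R]_n -> 'rV[R]_k).
have fE x : (x \in lker f) = (x *m D^T == x *m B^T *m T).
  by rewrite memv_ker lfunE/= mulmxBr mulmxA subr_eq0.
exists (lker f); split; last by move=> x /eqP; rewrite fE.
have LL' : (L :&: lker f = 0)%VS.
  apply/eqP; rewrite -subv0; apply/subvP => x; rewrite memv_cap memv0 fE => /andP[/LD[y ->]].
  have DB : D *m B^T = 0 by rewrite -[LHS]trmxK trmx_mul trmxK BD trmx0.
  rewrite -(mulmxA y D B^T) DB mulmx0 mul0mx => /eqP yD.
  apply/eqP; apply: row_mul_tr_eq0.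
  by rewrite trmx_mul mulmxA yD mul0mx.
split => //; apply/eqP; rewrite eqEdim subvf/= dimv_disjoint_sum//.
rewrite -(limg_ker_dim f fullv) capfv addnC leq_add2r dL.
by apply: leq_trans (dimvS (subvf _)) _; rewrite dimvf dim_matrix mul1r.
Qed.

End graph_complement.

(** * Subspace concentration in positive dimension *)

Section subspace.
Context {R : realType} {n m : nat}.
Variables (P : set 'rV[R]_n) (F : 'I_m -> set 'rV[R]_n) (a : 'I_m -> 'rV[R]_n).
Hypotheses (n0 : (0 < n)%N) (polytopeP : polytope P) (intP : (interior P) 0)
  (centroidP : centroid P = 0) (injF : injective F) (facetsP : range F = facets P)
  (normalF : forall i, outer_unit_normal P (F i) (a i)).
Local Notation V := (lebesgue_rV n).

Let coP : compact P. Proof. exact: polytope_compact. Qed.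
Let cP : cvx P. Proof. exact: polytope_cvx. Qed.
Let P0 : P 0. Proof. exact: nbhs_singleton. Qed.
Let mP : measurable P. Proof. exact: measurable_P. Qed.
Let facF i : facets P (F i). Proof. by rewrite -facetsP; exists i. Qed.

Let normal_height : exists h : 'I_m -> R, [/\ forall i, 0 < h i,
  forall i x, P x -> dotv (a i) x <= h i, forall i, F i !=set0 &
  forall i, F i = P `&` [set x | dotv (a i) x = h i]].
Proof.
have /choice[h hP] := fun i => facet_normal intP (facF i) (normalF i).
by exists h; split => i; have [? Ph ? ? ?] := hP i; try exact: Ph.
Qed.

Definition cone_vol i := fine (V (facet_cone (F i))).

Lemma cone_volE i : V (facet_cone (F i)) = (cone_vol i)%:E.
Proof.
have [h [h0 Pa F0 FE]] := normal_height; have [N bN] := compact_bdd coP.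
rewrite /cone_vol fineK//; apply: (@bdd_fin_num _ _ N).
  exact: (measurable_cone coP cP FE F0 i).
by move=> x Cx; apply: bN; exact: (cone_sub cP P0 FE F0 Cx).
Qed.

Lemma cone_vol_ge0 i : 0 <= cone_vol i.
Proof. exact: fine_ge0. Qed.

Lemma polytope_volume : V P = (\sum_i cone_vol i)%:E.
Proof.
have [h [h0 Pa F0 FE]] := normal_height.
rewrite (cone_volume_total coP cP P0 h0 Pa FE F0 injF n0 polytopeP intP facetsP).
by rewrite -sumEFin; apply: eq_bigr => i _; rewrite cone_volE.
Qed.

Lemma polytope_volume_gt0 : 0 < \sum_i cone_vol i.
Proof.
rewrite -lte_fin -polytope_volume; have [e e0 eP] := interior_cube intP.
by apply: (lebesgue_rV_cube_gt0 (x := 0) e0 mP) => y ye; apply: eP => i; have := ye i; rewrite mxE subr0.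
Qed.

Lemma centroid_integral u : (\int[V]_(x in P) (dotv u x)%:E = 0)%E.
Proof.
have [N bN] := compact_bdd coP.
rewrite (integral_dotv u mP bN) ?centroidP ?dotv0 ?mulr0//.
by rewrite polytope_volume; exact: polytope_volume_gt0.
Qed.

Definition cone_mass (L : {vspace 'rV[R]_n}) := \sum_(i | a i \in L) cone_vol i.

Lemma cone_massE (L : {vspace 'rV[R]_n}) : (\sum_(i < m | a i \in L) V (facet_cone (F i)))%E = (cone_mass L)%:E.
Proof. by rewrite -sumEFin; apply: eq_bigr => i _; rewrite cone_volE. Qed.

(** In case of equality [main_inequality] leaves no room for the defect, and its vanishing feeds the
    constancy of the fibre volumes and then [facet_graph]. *)
Let subspace (L : {vspace 'rV[R]_n}) : n%:R * cone_mass L <= (\dim L)%:R * \sum_i cone_vol i /\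
  (n%:R * cone_mass L = (\dim L)%:R * \sum_i cone_vol i ->
   exists L', complementary L L' /\ forall j, a j \notin L -> a j \in L').
Proof.
have [h [h0 Pa F0 FE]] := normal_height.
have [D fD LD] := vspace_matrix L.
have [r [B [B' [D' [[BD1 BB DD BD DB] [rk BDT perpB]]]]]] := orth_split fD.
set k := \dim L in D fD LD D' BD1 DD BD DB rk BDT perpB *.
have Qa i : a i \in L -> B *m (a i)^T = 0.
  by move=> /LD[y ->]; rewrite trmx_mul mulmxA BDT mul0mx.
have [p pP [c c0]] := main_inequality BD1 BB DD BD DB coP cP intP centroid_integral
  h0 Pa FE F0 injF Qa.
have Id0 : (0 <= \int[lebesgue_rV k]_y (defect B D P p y)%:E)%E.
  by apply: integral_ge0 => y _; rewrite lee_fin; exact: defect_ge0.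
rewrite cone_massE polytope_volume -!EFinM => main; split.
  rewrite -lee_fin; apply: le_trans main; apply: leeDl.
  by apply: mule_ge0 => //; rewrite lee_fin ltW.
move=> eqL; move: main; rewrite eqL.
(* If L is the whole space the complement is 0; otherwise the fibres have dimension [r > 0], as the
   scaling argument requires. *)
have [kn|kn] := eqVneq k n.
  move=> _; exists 0%VS; have Lf : L = fullv.
    apply/eqP; rewrite eqEdim subvf dimvf dim_matrix/= mul1r -/k kn; exact: leqnn.
  split; last by move=> j; rewrite Lf memvf.
  by split; [exact: capv0|rewrite Lf; exact: addv0].
have r0 : (0 < r)%N.
  by rewrite lt0n; apply: contra kn => /eqP r0; rewrite -rk r0 add0n.
move=> main.
have I0 : (\int[lebesgue_rV k]_y (defect B D P p y)%:E = 0)%E.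
  apply/eqP; rewrite eq_le Id0 andbT.
  have : (c%:E * \int[lebesgue_rV k]_y (defect B D P p y)%:E <= 0)%E.
    by move: main; rewrite -[leRHS]adde0 leeD2lE.
  by rewrite pmule_rle0.
have md : measurable_fun setT (fun y => (defect B D P p y)%:E).
  by apply/measurable_EFinP; exact: measurable_defect.
have [Z [mZ Z0 ZP]] : ae_eq (lebesgue_rV k) setT (fun y => (defect B D P p y)%:E) (cst 0%E).
  apply: ((ae_eq_integral_abs (lebesgue_rV k) measurableT md).1 _); rewrite -[RHS]I0; apply: eq_integral => y _.
  by rewrite gee0_abs// lee_fin; exact: defect_ge0.
have defZ y : ~ Z y -> defect B D P p y = 0.
  move=> nZ; apply: contrapT => dn; apply: nZ; apply: ZP => /= /(_ I) H.
  by apply: dn; apply: EFin_inj.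
have [N bN] := fib_bdd BB DB coP.
have [e e0 eP] := fib_cube B D intP.
have mK y : measurable (fib B D P y) by exact: measurable_fib.
have cK y y' z z' t : fib B D P y z -> fib B D P y' z' -> 0 <= t -> t <= 1 ->
    fib B D P ((1 - t) *: y + t *: y') ((1 - t) *: z + t *: z').
  exact: fib_cvx.
have volK y : inner (fib B D P) y -> vol (fib B D P) y = vol (fib B D P) 0.
  apply: (vol_const mK bN cK e0 eP r0 mZ Z0 pP) => {}y nZ vy.
  have /eqP := defZ y nZ; rewrite mulf_eq0 gt_eqF//= subr_eq0 => /eqP.
  by move=> <-.
have [||T TP] := facet_graph mK bN cK e0 eP volK (b := fun j => a j *m B^T)
    (c := fun j => a j *m D^T) (h := h) (Q := fun j => a j \notin L).
- move=> j y z _ Kz; rewrite -!dotv_mulmx -dotvDr; exact: Pa Kz.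
- move=> j jL.
  have cFj : cvx (F j) by exact: (facet_cvx cP FE).
  have [x Fx xP] := facet_relative_interior cFj intP (facF j) (normalF j).
  have [Px ax] : P x /\ dotv (a j) x = h j by move: Fx; rewrite FE => -[].
  (* Since [a j] is not in L, [b] is nonzero, so subtracting a multiple of [b *m B] turns [x] into a
     direction along the facet without changing its [D]-coordinate. Moving by [w0] in this direction
     multiplies the [D]-coordinate by [1 + w0] and stays in [P]; hence the foot of [x] is
     [inner]. *)
  pose b := a j *m B^T.
  have bn0 : b != 0.
    apply: contra jL => /eqP b0; apply/LD; exact: perpB.
  have bb0 : dotv b b != 0 by apply: contra_neq bn0; exact: dotv_eq0.
  have [|w0 w00 Fx'] := xP (x - (h j / dotv b b) *: (b *m B)).
    by rewrite dotvDr dotvNr ax dotvZr dotv_mulmx -/b divfK// subrr.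
  have Px' : P (x + w0 *: (x - (h j / dotv b b) *: (b *m B))).
    by move: Fx'; rewrite FE => -[].
  exists (x *m D'), (x *m B'); split.
  + exists (1 + w0)^-1, ((1 + w0) *: (x *m D')).
    have w1 : 0 < 1 + w0 by rewrite addr_gt0.
    split; first by rewrite invr_ge0 ltW.
    * by rewrite invf_lt1// ltrDl.
    * exists ((x + w0 *: (x - (h j / dotv b b) *: (b *m B))) *m B').
      rewrite /fib/= (_ : (1 + w0) *: (x *m D') = (x + w0 *: (x - (h j / dotv b b) *: (b *m B))) *m D').
        by rewrite (glue_unglue BD1).
      rewrite mulmxDl -scalemxAl mulmxBl -scalemxAl -mulmxA BD mulmx0 scaler0 subr0.
      by rewrite scalerDl scale1r.
    * by rewrite scalerA mulVf ?scale1r// gt_eqF.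
  + by rewrite /fib/= (glue_unglue BD1).
  + by rewrite -!dotv_mulmx -dotvDr -/(glue_rV B D (x *m D', x *m B')) (glue_unglue BD1).
have [L' [cL L'P]] := graph_complementary T (erefl _) (fun x => (LD x).1) BDT.
by exists L'; split => // j jL; apply: L'P; exact: TP.
Qed.

Let nR : n%:R != 0 :> R. Proof. by rewrite pnatr_eq0 -lt0n. Qed.
Let nR0 : 0 < n%:R :> R. Proof. by rewrite ltr0n. Qed.

Lemma subspace_inequality (L : {vspace 'rV[R]_n}) : cone_mass L <= (\dim L)%:R / n%:R * \sum_i cone_vol i.
Proof. by rewrite mulrAC ler_pdivlMr// mulrC; exact: (subspace L).1. Qed.

Lemma subspace_equality (L : {vspace 'rV[R]_n}) : cone_mass L = (\dim L)%:R / n%:R * \sum_i cone_vol i ->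
  exists L', complementary L L' /\ forall j, a j \notin L -> a j \in L'.
Proof.
by move=> E; apply: (subspace L).2; rewrite E mulrA mulrCA mulfV// mulr1.
Qed.

Lemma complementary_mass (L L' : {vspace 'rV[R]_n}) : complementary L L' ->
  (\dim L)%:R / n%:R * \sum_i cone_vol i + (\dim L')%:R / n%:R * \sum_i cone_vol i =
  \sum_i cone_vol i.
Proof.
move=> [LL' LL]; rewrite -mulrDl -mulrDl -natrD -dimv_disjoint_sum// LL.
by rewrite dimvf dim_matrix mul1r divff// mul1r.
Qed.

(** The masses of L and L' together reach the total, each is at most its share, and the shares add
    up to the total; so both inequalities are equalities. *)
Lemma concentrated_equality (L L' : {vspace 'rV[R]_n}) : complementary L L' ->
  \sum_(j | (a j \notin L) && (a j \notin L')) cone_vol j = 0 ->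
  cone_mass L = (\dim L)%:R / n%:R * \sum_i cone_vol i.
Proof.
move=> cL null; apply/eqP; rewrite eq_le subspace_inequality/=.
have := subspace_inequality L'; have := complementary_mass cL.
have : \sum_i cone_vol i <= cone_mass L + cone_mass L'.
  rewrite (bigID (fun i => a i \in L))/= lerD2l (bigID (fun i => a i \in L'))/= null addr0.
  rewrite /cone_mass [leRHS](bigID (fun i => a i \notin L))/=.
  rewrite [X in _ <= X + _](eq_bigl (fun i => (a i \notin L) && (a i \in L'))) => [|i].
    by rewrite lerDl sumr_ge0// => i _; exact: cone_vol_ge0.
  by rewrite andbC.
lra.
Qed.

Lemma subspace_equalityP (L : {vspace 'rV[R]_n}) :
  cone_mass L = (\dim L)%:R / n%:R * \sum_i cone_vol i <->
  exists L', complementary L L' /\ forall j, a j \notin L -> a j \in L'.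
Proof.
split; first exact: subspace_equality.
move=> [L' [cL aL']]; apply: (concentrated_equality cL).
by apply: big1 => j /andP[/aL' ->].
Qed.

Local Notation mu := (cone_volume_measure F a : {measure set 'rV[R]_n -> \bar R}).

Lemma cone_volume_measureE (A : set 'rV[R]_n) (Q : pred 'I_m) : (forall i, A (a i) <-> Q i) ->
  mu A = (\sum_(i | Q i) cone_vol i)%:E.
Proof.
move=> AQ; rewrite /=/cone_volume_measure -sumEFin [RHS]big_mkcond.
apply: eq_bigr => i _; rewrite cone_volE diracE; case: ifPn => [/AQ Aa|/negP nQ].
  by rewrite mem_set// mule1.
by rewrite memNset ?mule0// => /AQ.
Qed.

Lemma positive_dimension : subspace_concentration (cone_volume_measure F a) /\
  (forall L : {vspace 'rV[R]_n},
    (\sum_(i < m | a i \in L) lebesgue_rV n (facet_cone (F i)) <=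
       ((\dim L)%:R / n%:R)%:E * lebesgue_rV n P)%E /\
    ((\sum_(i < m | a i \in L) lebesgue_rV n (facet_cone (F i)))%E =
       (((\dim L)%:R / n%:R)%:E * lebesgue_rV n P)%E <->
     exists L' : {vspace 'rV[R]_n},
       complementary L L' /\
       [set a j | j in [set j | a j \notin L]] `<=` [set` L'])).
Proof.
have sphere_a i : sphere (a i) by have [] := normalF i.
split; last first.
  move=> L; rewrite cone_massE polytope_volume -EFinM lee_fin; split.
    exact: subspace_inequality.
  split=> [[/subspace_equalityP[L' [cL aL']]]|[L' [cL aL']]].
    by exists L'; split => // _ [j /= /aL' ? <-].
  congr EFin; apply/subspace_equalityP; exists L'; split => // j jL.
  by apply: aL'; exists j.
have massE (L : {vspace 'rV[R]_n}) :
    mu ([set` L] `&` sphere) = (cone_mass L)%:E.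
  by apply: cone_volume_measureE => i; split => [[]|].
have totalE : mu sphere = (\sum_i cone_vol i)%:E.
  exact: cone_volume_measureE.
split.
- by rewrite (cone_volume_measureE (Q := predT))// ltry.
- rewrite (cone_volume_measureE (Q := pred0)); first by rewrite big_pred0.
  by move=> i; split => // /(_ (sphere_a i)).
move=> L; rewrite massE totalE -EFinM lee_fin; split; first exact: subspace_inequality.
have nullE (L' : {vspace 'rV[R]_n}) :
    mu (sphere `\` ([set` L] `|` [set` L'])) =
    (\sum_(j | (a j \notin L) && (a j \notin L')) cone_vol j)%:E.
  apply: cone_volume_measureE => i; split => [[_ /not_orP[/negP h1 /negP h2]]|/andP[/negP h1 /negP h2]].
    by rewrite h1.
  by split => // -[].
split=> [[/subspace_equalityP[L' [cL aL']]]|[L' [cL _]]].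
  (* Complementarity and concentration are symmetric in L and L', so L' attains equality too. *)
  have aL j : a j \notin L' -> a j \in L.
    by apply: contraR; exact: aL'.
  exists L'; split => //.
    rewrite massE -EFinM; congr EFin; apply/subspace_equalityP; exists L.
    by split => //; case: cL => c1 c2; split; rewrite 1?capvC 1?addvC.
  by rewrite nullE big1// => j /andP[/aL' ->].
by rewrite nullE => -[null]; congr EFin; exact: concentrated_equality null.
Qed.

End subspace.

Theorem theorem1p1 (R : realType) (n : nat) (P : set 'rV[R]_n)
  (m : nat) (F : 'I_m -> set 'rV[R]_n) (a : 'I_m -> 'rV[R]_n)
  (polytopeP : polytope P)
  (intP : (interior P) 0)
  (centroidP : centroid P = 0)
  (injF : injective F)
  (facetsP : range F = facets P)
  (normalF : forall i, outer_unit_normal P (F i) (a i)) :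
  subspace_concentration (cone_volume_measure F a) /\
  (forall L : {vspace 'rV[R]_n},
    (\sum_(i < m | a i \in L) lebesgue_rV n (facet_cone (F i)) <=
       ((\dim L)%:R / n%:R)%:E * lebesgue_rV n P)%E /\
    ((\sum_(i < m | a i \in L) lebesgue_rV n (facet_cone (F i)))%E =
       (((\dim L)%:R / n%:R)%:E * lebesgue_rV n P)%E <->
     exists L' : {vspace 'rV[R]_n},
       complementary L L' /\
       [set a j | j in [set j | a j \notin L]] `<=` [set` L'])).
Proof.
(* In dimension 0 there are no facets and [n%:R^-1] is 0, so both sides vanish and the zero subspace
   is a complement. *)
have [n0|n0] := posnP n; last exact: positive_dimension.
have noF (i : 'I_m) : False.
  have : facets P (F i) by rewrite -facetsP; exists i.
  by move=> [_ [k kn _]]; move: n0; rewrite -kn.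
have sum0 (Q : pred 'I_m) (f : 'I_m -> \bar R) : (\sum_(i | Q i) f i = 0)%E.
  by apply: big1 => i; case: (noF i).
have mu0 A : (cone_volume_measure F a : {measure set 'rV[R]_n -> \bar R}) A = 0%E.
  exact: sum0.
have n00 : n%:R^-1 = 0 :> R by rewrite n0 invr0.
have complL (L : {vspace 'rV[R]_n}) : complementary L 0%VS.
  split; first exact: capv0.
  by rewrite addv0; apply/eqP; rewrite eqEdim subvf dimvf dim_matrix mul1r [X in (X <= _)%N]n0.
split; first split.
- by rewrite mu0.
- by rewrite mu0.
- move=> L; rewrite !mu0 mule0; split => //; split => // _.
  by exists 0%VS; rewrite !mu0 mule0.
move=> L; rewrite sum0 n00 mulr0 mul0e; split => //; split => // _.
by exists 0%VS; split => // x [j]; case: (noF j).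
Qed.
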